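(* In the scaled framework described in the context, assume (A1)–(A11), (H1)–(H3), that $F(u) > 0$ and $G(u) < 0$ for all $u \in W\setminus\{0\}$, and that (for every $c\in\mathbb{R}$) $h(u)\neq 0$ for all $u\in\mathcal{N}_c$. Let $I^- = (-\infty,0)$. Then: (i) For each $c \in I^-$, $\lambda_{c,k} \nearrow \infty$ ($k\ge1$) is a sequence of critical values of $\lambda_c$. Moreover, $\Phi_{\lambda_{c,k}}$ has a nontrivial critical point $u_{c,k}$ with $\Phi_{\lambda_{c,k}}(u_{c,k}) = c$. (ii) For each $k \ge 1$, the mapping $I^- \to \mathbb{R}$, $c \mapsto \lambda_{c,k}$ is continuous, decreasing, and satisfies $\lim_{c \to 0^-} \lambda_{c,k} = -\infty$ and $\lim_{c \to -\infty} \lambda_{c,k} = \infty$. (iii) For each $\lambda \in \mathbb{R}$, $\Phi_\lambda$ has a sequence of nontrivial critical points $(v_{\lambda,k})$ such that $\Phi_\lambda(v_{\lambda,k}) \nearrow 0$ and $\|v_{\lambda,k}\| \to 0$. Moreover, $\Phi_\lambda$ has no nontrivial critical point with critical value in $\mathbb{R}\setminus I^-$.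
   Context: Scaled framework. $W$ is a reflexive (real) Banach space with dual $W^*$; $\rightharpoonup$ is weak convergence. $W$ carries a scaling: a continuous map $W\times[0,\infty)\to W$, $(u,t)\mapsto u_t$, with (A1) $(u_{t_1})_{t_2}=u_{t_1t_2}$ for all $u\in W$, $t_1,t_2\ge0$; (A2) $(\tau u)_t=\tau u_t$ for all $u\in W$, $\tau\in\mathbb{R}$, $t\ge0$; (A3) $u_0=0$, $u_1=u$; (A4) $u_t$ is bounded on bounded sets in $W\times[0,\infty)$; (A5) for some (fixed) $s>0$, $\|u_t\|=O(t^s)$ as $t\to\infty$ uniformly in $u$ on bounded sets. A potential operator is $p\in C(W,W^* )$ that is the Fréchet derivative of some $P\in C^1(W,\mathbb{R})$ (its potential, normalized by $P(0)=0$). A scaled operator is an odd potential operator $A_s$ that maps bounded sets into bounded sets and satisfies $A_s(u_t)v_t=t^sA_s(u)v$ for all $u,v\in W$, $t\ge0$. Given are scaled operators $A_s,B_s$ with potentials $I_s(u)=\int_0^1A_s(\tau u)u\,d\tau$, $J_s(u)=\int_0^1B_s(\tau u)u\,d\tau$, and odd potential operators $f,g\in C(W,W^* )$ with potentials $F(u)=\int_0^1f(\tau u)u\,d\tau$, $G(u)=\int_0^1g(\tau u)u\,d\tau$, satisfying: (A6) $A_s(u)u>0$ for $u\ne0$; (A7) every sequence with $u_j\rightharpoonup u$ and $A_s(u_j)(u_j-u)\to0$ has a subsequence converging strongly to $u$; (A8) $B_s(u)u>0$ for $u\neq0$; (A9) $u_j\rightharpoonup u$ implies $B_s(u_j)\to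 B_s(u)$ in $W^*$; (A10) $I_s(u)\to\infty$ as $\|u\|\to\infty$; (A11) every solution of $A_s(u)=\lambda B_s(u)$ ($\lambda\in\mathbb{R}$) satisfies $I_s(u)=\lambda J_s(u)$; (H1) for some $r>s>q>0$, $f(u_t)v_t=t^qf(u)v$ and $g(u_t)v_t=t^rg(u)v$ for all $u,v\in W$, $t\ge0$; (H2) $u_j\rightharpoonup u$ implies $f(u_j)\to f(u)$ and $g(u_j)\to g(u)$ in $W^*$ (in particular $f,g$ map bounded sets into bounded sets); (H3) for all $\alpha,\beta,\gamma,\delta\in\mathbb{R}$, every solution of $\alpha A_s(u)=\beta B_s(u)+\gamma f(u)+\delta g(u)$ satisfies $s\alpha I_s(u)=s\beta J_s(u)+q\gamma F(u)+r\delta G(u)$. Notation. $\Phi_\lambda(u)=I_s(u)-\lambda J_s(u)-F(u)-G(u)$ on $W$. For $c\in\mathbb{R}$, $\lambda_c(u)=\dfrac{I_s(u)-F(u)-G(u)-c}{J_s(u)}$ on $W\setminus\{0\}$ (note $J_s>0$ there). $\mathcal{M}_s=\{u\in W:I_s(u)=1\}$. The scaled Nehari set is $\mathcal{N}_c=\{u_t:u\in\mathcal{M}_s,\ t>0,\ \varphi_{c,u}'(t)=0\}$ with $\varphi_{c,u}(t)=\lambda_c(u_t)$; equivalently $\mathcal{N}_c=\{u\in W\setminus\{0\}:(s-q)F(u)-(r-s)G(u)+cs=0\}$. $h(u)=(s-q)f(u)-(r-s)g(u)$. $\Lambda_c=\lambda_c|_{\mathcal{N}_c}$. $i(M)$ is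 the Fadell–Rabinowitz $\mathbb{Z}_2$-cohomological index of a symmetric ($M=-M$) set $M\subset W\setminus\{0\}$: $i(\emptyset)=0$, and for $M\neq\emptyset$, with $\overline M=M/\{u\sim-u\}$, classifying map $\theta:\overline M\to\mathbb{RP}^\infty$ of $M\to\overline M$, and $\omega$ the generator of $H^1(\mathbb{RP}^\infty;\mathbb{Z}_2)$, $i(M)=\sup\{m\ge1:\theta^*(\omega^{m-1})\neq0\}$ (Alexander–Spanier cohomology, $\mathbb{Z}_2$ coefficients). For $k\ge1$, $$\lambda_{c,k}=\inf\Big\{\sup_{u\in M}\Lambda_c(u): M\subset\mathcal{N}_c\text{ symmetric},\ i(M)\ge k\Big\}.$$ $a_k\nearrow a$ means $(a_k)$ is nondecreasing with limit $a$ (possibly $\infty$). ''Decreasing'' means strictly decreasing.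
   Formalization: The formal theorem assumes in addition that W is infinite-dimensional; in finite dimension λ_{c,k} = inf ∅ = ∞ for k > dim W, so (i) fails (e.g. W = ℝ with power nonlinearities). *)

(* Defs.v *)
From HB Require Import structures.
From mathcomp Require Import all_boot all_order all_algebra.
From mathcomp Require Import generic_quotient.
From mathcomp Require Import all_classical all_reals all_analysis.
Import Order.TTheory GRing.Theory Num.Theory.
Import numFieldNormedType.Exports.

Set Implicit Arguments.
Unset Strict Implicit.
Unset Printing Implicit Defensive.

Local Open Scope classical_set_scope.
Local Open Scope ring_scope.
Local Open Scope quotient_scope.

Section Dual.
Context {R : realType} (W : normedModType R).

Definition continuous_linear_form : {pred W -> R^o} :=
  fun l => `[< linear l /\ continuous l >].

Record dual := Dual {
  dual_fun :> W -> R^o ;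
  dual_funP : dual_fun \in continuous_linear_form }.

HB.instance Definition _ := [isSub for dual_fun].
HB.instance Definition _ := [Choice of dual by <:].

Lemma continuous_linear_form_submod : submod_closed continuous_linear_form.
Proof.
split.
  apply/asboolP; split; first by move=> a u v; rewrite /= scaler0 addr0.
  by move=> x; exact: cvg_cst.
move=> a l m /asboolP[l_lin l_cont] /asboolP[m_lin m_cont].
apply/asboolP; split.
  move=> b u v.
  rewrite !fctE l_lin m_lin !scalerDr addrACA; congr (_ + _).
  by rewrite !scalerA mulrC.
move=> x; apply: (@cvgD _ _ _ _ _ (a *: l) m); last exact: m_cont.
by apply: cvgM; [exact: cvg_cst|exact: l_cont].
Qed.

HB.instance Definition _ :=
  GRing.isSubmodClosed.Build R (W -> R^o) continuous_linear_form
    continuous_linear_form_submod.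
HB.instance Definition _ := [SubChoice_isSubLmodule of dual by <:].

Lemma dual_linear (l : dual) : linear l.
Proof. by have /asboolP[] := dual_funP l. Qed.

Lemma dual_continuous (l : dual) : continuous l.
Proof. by have /asboolP[] := dual_funP l. Qed.

HB.instance Definition _ (l : dual) :=
  GRing.isLinear.Build R W R^o *:%R l (dual_linear l).

Definition dual_norm (l : dual) : R :=
  sup [set `|l x| | x in [set x : W | `|x| <= 1]].

Lemma dual_norm_has_sup (l : dual) :
  has_sup [set `|l x| | x in [set x : W | `|x| <= 1]].
Proof.
split; first by exists `|l 0|, 0 => //=; rewrite normr0.
have /bounded_funP/(_ 1)[M lM] := continuous_linear_bounded 0 (@dual_continuous l 0).
by exists M => _ [x x1 <-]; exact: lM.
Qed.

Lemma dual_norm_ub (l : dual) (x : W) : `|l x| <= dual_norm l * `|x|.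
Proof.
have [->|x0] := eqVneq x 0; first by rewrite linear0 !normr0 mulr0.
have nx : 0 < `|x| by rewrite normr_gt0.
rewrite -ler_pdivrMr// mulrC.
rewrite -(ger0_norm (ltW nx)) -normfV -normrM -linearZ/=.
apply: ub_le_sup; first by have [] := dual_norm_has_sup l.
exists (`|x|^-1 *: x) => //=.
by rewrite normrZ normfV normr_id mulVf// gt_eqF.
Qed.

Lemma dual_norm_le (l : dual) (C : R) :
  (forall x, `|x| <= 1 -> `|l x| <= C) -> dual_norm l <= C.
Proof.
move=> lC; apply: ge_sup; first by have [] := dual_norm_has_sup l.
by move=> _ [x x1 <-]; exact: lC.
Qed.

Lemma dual_norm_ge0 (l : dual) : 0 <= dual_norm l.
Proof.
apply: (@le_trans _ _ `|l 0|) => //.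
apply: ub_le_sup; first by have [] := dual_norm_has_sup l.
by exists 0 => //=; rewrite normr0.
Qed.

Lemma dual_normD (l m : dual) : dual_norm (l + m) <= dual_norm l + dual_norm m.
Proof.
apply: dual_norm_le => x x1; apply: (le_trans (ler_normD _ _)).
by apply: lerD; apply: (le_trans (dual_norm_ub _ _)); rewrite ler_piMr ?dual_norm_ge0.
Qed.

Lemma dual_normZ_le (a : R) (l : dual) : dual_norm (a *: l) <= `|a| * dual_norm l.
Proof.
apply: dual_norm_le => x x1; rewrite [X in `|X|]/= normrM ler_wpM2l//.
by apply: (le_trans (dual_norm_ub _ _)); rewrite ler_piMr ?dual_norm_ge0.
Qed.

Lemma dual_normZ (a : R) (l : dual) : dual_norm (a *: l) = `|a| * dual_norm l.
Proof.
apply/le_anti; rewrite dual_normZ_le/=.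
have [->|a0] := eqVneq a 0; first by rewrite normr0 mul0r dual_norm_ge0.
rewrite -ler_pdivlMl ?normr_gt0// -normfV.
by have := dual_normZ_le a^-1 (a *: l); rewrite scalerA mulVf// scale1r.
Qed.

Lemma dual_norm0_eq0 (l : dual) : dual_norm l = 0 -> l = 0.
Proof.
move=> l0; apply/val_inj/funext => x /=.
by apply/eqP; rewrite -normr_le0 (le_trans (dual_norm_ub l x))// l0 mul0r.
Qed.

HB.instance Definition _ :=
  Lmodule_isNormed.Build R dual dual_normD dual_normZ dual_norm0_eq0.

End Dual.

Definition reflexive_space {R : realType} (W : normedModType R) : Prop :=
  forall X : dual (dual W), exists u : W, forall l : dual W, X l = l u.

Definition infinite_dimensional {R : realType} (W : lmodType R) : Prop :=
  forall (n : nat) (e : 'I_n -> W),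
    exists u : W, forall a : 'I_n -> R, u <> \sum_(i < n) a i *: e i.

Definition weakly_cvg {R : realType} (W : normedModType R)
    (u_ : nat -> W) (u : W) : Prop :=
  forall l : dual W, l (u_ n) @[n --> \oo] --> l u.

(* Alexander-Spanier cohomology with coefficients in Z/2. *)
Section AlexanderSpanier.
Variable X : topologicalType.

Definition cochain (n : nat) : Type := ('I_n.+1 -> X) -> 'F_2.

(* No signs: the coefficients have characteristic 2. *)
Definition as_diff n (c : cochain n) : cochain n.+1 :=
  fun t => \sum_(i < n.+2) c (fun j : 'I_n.+1 => t (lift i j)).

(* c vanishes on U^(n+1) for every member U of some open cover of X *)
Definition locally_zero n (c : cochain n) : Prop :=
  forall x : X, exists U : set X,
    [/\ open U, U x & forall t, (forall i, U (t i)) -> c t = 0].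

(* The complex is that of the cochains modulo the locally zero ones; a class of
   H^n is given by a cochain c with [as_cocycle c], and it is zero iff
   [as_coboundary c]. *)
Definition as_cocycle n (c : cochain n) : Prop := locally_zero (as_diff c).

Definition as_coboundary n : cochain n -> Prop :=
  match n with
  | 0 => fun c => locally_zero c
  | m.+1 => fun c => exists b : cochain m, locally_zero (fun t => c t - as_diff b t)
  end.

Definition cup p q (a : cochain p) (b : cochain q) : cochain (p + q) :=
  fun t => a (fun i : 'I_p.+1 => t (inord i)) *
           b (fun j : 'I_q.+1 => t (inord (p + j))).

Fixpoint cup_exp (w : cochain 1) (n : nat) : cochain n :=
  match n with
  | 0 => fun=> 1
  | m.+1 => cup w (@cup_exp w m)
  end.

(* The class of w is nonzero and spans H^1(X; Z/2). *)
Definition generates_H1 (w : cochain 1) : Prop :=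
  [/\ as_cocycle w, ~ as_coboundary w &
      forall c : cochain 1, as_cocycle c ->
        exists a : 'F_2, as_coboundary (fun t => c t - a * w t)].

End AlexanderSpanier.

Arguments cup_exp {X} w n.

Definition as_pullback (X Y : topologicalType) (f : X -> Y) n
  (c : cochain Y n) : cochain X n := fun t => c (f \o t).

Section Antipodal.
Context {V : zmodType} {T : topologicalType} (v : T -> V).

Let antipodal_rel (x y : T) : bool := (v x == v y) || (v x == - v y).

Local Lemma antipodal_refl : reflexive antipodal_rel.
Proof. by move=> x; rewrite /antipodal_rel eqxx. Qed.

Local Lemma antipodal_sym : symmetric antipodal_rel.
Proof.
by move=> x y; rewrite /antipodal_rel eq_sym -eqr_oppLR [- v x == _]eq_sym.
Qed.

Local Lemma antipodal_trans : transitive antipodal_rel.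
Proof.
move=> y x z; rewrite /antipodal_rel => /orP[]/eqP-> // /orP[]/eqP->;
by rewrite ?opprK eqxx ?orbT.
Qed.

Definition antipodal_equiv :=
  EquivRel antipodal_rel antipodal_refl antipodal_sym antipodal_trans.

Definition antipodal_quotient := {eq_quot antipodal_equiv}.

HB.instance Definition _ :=
  Topological.copy antipodal_quotient (quotient_topology antipodal_quotient).
HB.instance Definition _ := Quotient.on antipodal_quotient.

Definition antipodal_proj : T -> antipodal_quotient := \pi_antipodal_quotient.

End Antipodal.

Section InfiniteSphere.
Variable R : realType.

Definition on_infinite_sphere : {pred nat -> R} := fun x =>
  `[< exists n, (forall i, (n < i)%N -> x i = 0) /\
                \sum_(i < n.+1) x i ^+ 2 = 1 >].

Record infinite_sphere := InfiniteSphere {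
  sphere_val :> nat -> R ;
  sphere_valP : sphere_val \in on_infinite_sphere }.

HB.instance Definition _ := [isSub for sphere_val].
HB.instance Definition _ := [Choice of infinite_sphere by <:].

(* The infinite sphere is the union of the spheres S^n with the weak (CW)
   topology: U is open iff its trace on each S^n is open; the topology of S^n is the one
   induced by the product topology of R^nat. *)
Definition sphere_open (U : set infinite_sphere) : Prop :=
  forall n, exists V : set {ptws nat -> R}, open V /\
    forall x : infinite_sphere, (forall i, (n < i)%N -> x i = 0) ->
      U x <-> V (sphere_val x).

Lemma sphere_openT : sphere_open setT.
Proof. by move=> n; exists setT; split => //; exact: openT. Qed.

Lemma sphere_openI : setI_closed sphere_open.
Proof.
move=> A B oA oB n.
have [VA [oVA AV]] := oA n; have [VB [oVB BV]] := oB n.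
exists (VA `&` VB); split; first exact: openI.
move=> x xn; have [AVx VAx] := AV x xn; have [BVx VBx] := BV x xn.
by split=> -[xA xB]; split; [exact: AVx|exact: BVx|exact: VAx|exact: VBx].
Qed.

Lemma sphere_open_bigU (I : Type) (U : I -> set infinite_sphere) :
  (forall i, sphere_open (U i)) -> sphere_open (\bigcup_i U i).
Proof.
move=> oU n; have /choice[V V_] := fun i => oU i n.
exists (\bigcup_i V i); split.
  by apply: bigcup_open => i _; have [] := V_ i.
move=> x xn; split=> -[i _ ix]; exists i => //.
  by have [_ /(_ _ xn)[+ _]] := V_ i; exact.
by have [_ /(_ _ xn)[_]] := V_ i; exact.
Qed.

HB.instance Definition _ := isOpenTopological.Build infinite_sphere
  sphere_openT sphere_openI sphere_open_bigU.

Definition infinite_projective_space :=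
  antipodal_quotient (sphere_val : infinite_sphere -> nat -> R).

HB.instance Definition _ := Topological.on infinite_projective_space.

End InfiniteSphere.

Section Index.
Context {R : realType} {W : normedModType R}.
Implicit Types M : set W.

Definition symmetric_set M : Prop := forall u, M u -> M (- u).

Definition orbit_space M := antipodal_quotient (set_val : M -> W).

HB.instance Definition _ M := Topological.on (orbit_space M).

(* A map classifies the double cover M -> M/{u ~ -u} iff it is covered by a
   Z/2-equivariant, i.e. odd, map from M to the infinite sphere. *)
Definition classifying_map M (theta : orbit_space M -> infinite_projective_space R) :=
  continuous theta /\
  exists f : M -> infinite_sphere R,
    [/\ continuous f,
        forall x y : M, set_val y = - set_val x ->
          sphere_val (f y) = - sphere_val (f x) &
        forall x, theta (antipodal_proj set_val x) =
                  antipodal_proj (@sphere_val R) (f x)].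

(* theta^*(w^(m-1)) <> 0 does not depend on the classifying map theta, which is
   unique up to homotopy, nor on the cochain w, whose class is unique. *)
Definition fr_index M : \bar R :=
  if M == set0 then 0%E else
  ereal_sup [set (m%:R)%:E | m in
    [set m : nat | (1 <= m)%N /\
      exists theta : orbit_space M -> infinite_projective_space R,
      exists w : cochain (infinite_projective_space R) 1,
        [/\ classifying_map theta, generates_H1 w &
            ~ as_coboundary (as_pullback theta (cup_exp w m.-1))]]].

End Index.

Section Scaled.
Context {R : realType} {W : completeNormedModType R}.
Local Notation mu := (@lebesgue_measure R).

(* scl u t is u_t; only the values at t >= 0 matter. *)
Record is_scaling (scl : W -> R -> W) (s : R) : Prop := IsScaling {
  scl_continuous :
    {within [set p : W * R | 0 <= p.2], continuous (fun p => scl p.1 p.2)} ;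
  sclA : forall u t1 t2, 0 <= t1 -> 0 <= t2 -> scl (scl u t1) t2 = scl u (t1 * t2) ;
  sclZ : forall u tau t, 0 <= t -> scl (tau *: u) t = tau *: scl u t ;
  scl0 : forall u, scl u 0 = 0 ;
  scl1 : forall u, scl u 1 = u ;
  scl_bounded : forall B T : R, exists C : R,
    forall u t, `|u| <= B -> 0 <= t <= T -> `|scl u t| <= C ;
  scl_exp_gt0 : 0 < s ;
  scl_bigO : forall B : R, exists C T : R,
    forall u t, `|u| <= B -> T <= t -> `|scl u t| <= C * t `^ s }.

Definition potential_operator (p : W -> dual W) : Prop :=
  continuous p /\ exists P : W -> R, forall u, is_diff u P (p u).

Definition odd_operator (p : W -> dual W) : Prop := forall u, p (- u) = - p u.

Definition maps_bounded_sets (p : W -> dual W) : Prop :=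
  forall S : set W, bounded_set S -> bounded_set (p @` S).

Definition homogeneous (scl : W -> R -> W) (d : R) (p : W -> dual W) : Prop :=
  forall u v t, 0 <= t -> p (scl u t) (scl v t) = t `^ d * p u v.

Definition scaled_operator (scl : W -> R -> W) (s : R) (p : W -> dual W) : Prop :=
  [/\ odd_operator p, potential_operator p, maps_bounded_sets p &
      homogeneous scl s p].

Definition weak_to_strong_continuous (p : W -> dual W) : Prop :=
  forall (u_ : nat -> W) u, weakly_cvg u_ u -> p (u_ n) @[n --> \oo] --> p u.

Definition potential (p : W -> dual W) (u : W) : R :=
  \int[mu]_(tau in `[0, 1]) p (tau *: u) u.

Definition critical_point (E : W -> R) (u : W) : Prop :=
  differentiable E u /\ forall v, 'd E u v = 0.

Variables (scl : W -> R -> W) (A B f g : W -> dual W).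

Definition Phi (lambda : R) (u : W) : R :=
  potential A u - lambda * potential B u - potential f u - potential g u.

Definition lambda_fun (c : R) (u : W) : R :=
  (potential A u - potential f u - potential g u - c) / potential B u.

Definition Ms : set W := [set u | potential A u = 1].

Definition nehari (c : R) : set W :=
  [set w | exists (u : W) (t : R), [/\ Ms u, 0 < t,
     is_derive t 1 (fun tau : R => lambda_fun c (scl u tau)) 0 & w = scl u t]].

Definition minimax (c : R) (k : nat) : \bar R :=
  ereal_inf [set ereal_sup [set (lambda_fun c u)%:E | u in M] | M in
    [set M : set W | [/\ M `<=` nehari c, symmetric_set M &
                         (k%:R%:E <= fr_index M)%E]]].

Definition lambda_critical_value (c a : R) : Prop :=
  exists u, [/\ u != 0, critical_point (lambda_fun c) u & lambda_fun c u = a].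

End Scaled.

(* Main.v *)
(* For u <> 0 and c < 0, [lambda_fun c u = l] iff [Phi l u = c], and then u is critical
   for one functional iff it is critical for the other.  Along the ray t |-> u_t the
   function lambda_c has a unique minimum, attained on N_c, so that retracting W \ {0}
   radially onto N_c does not increase lambda_c: a deformation which lowers lambda_c
   on W \ {0} can be brought back to N_c, and neither tangent vectors nor the manifold
   structure of N_c are needed.  The deformation is discrete.  A continuous odd
   field Y is built such that u |-> u - t Y u lowers lambda_c by a fixed multiple of
   |t Y u|; a trajectory which never got below the critical level would have finite
   length, hence would converge to a point where Y does not vanish.  Letting each point
   stop after a number of steps which depends continuously on it gives an odd map.

   The index is handled by cochains on lists of points which are invariant under
   independent sign changes of the points, the class of the double cover being
   represented by the coboundary of a (discontinuous) odd function into Z/2.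
   Iterated barycentric subdivision of the antipodal fundamental chain shows that it
   is at least k on the unit sphere of l^1 in dimension k.

   Monotonicity and continuity of lambda_{c,k} in c follow by projecting from N_c to
   N_d, since lambda_d = lambda_c + (c - d) / J_s and J_s is bounded above and away
   from 0 on sublevel sets; (iii) then solves lambda_{c,k} = lambda for c. *)
Require Import Defs.
From HB Require Import structures.
From mathcomp Require Import all_boot all_order all_algebra.
From mathcomp Require Import generic_quotient.
From mathcomp Require Import ring lra zify.
From mathcomp Require Import all_classical all_reals all_analysis.
Import Order.TTheory GRing.Theory Num.Theory.
Import numFieldNormedType.Exports.
Set Implicit Arguments.
Unset Strict Implicit.
Unset Printing Implicit Defensive.
Local Open Scope classical_set_scope.
Local Open Scope ring_scope.

(** * Cochains on lists of points *)

(** [W] is not assumed separable, yet countable families are needed for three things: an odd map of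
    [W] minus 0 into the infinite sphere, without which there would be no classifying map; the
    series that defines the descent field; the proof that minimax values tend to infinity with k.
    They all come from [B]: it maps balls to totally bounded sets, and [B u u > 0] keeps a
    functional close to [B u] from vanishing at [u].

    Alexander-Spanier relations hold only on small lists of points. Subdivision makes the simplices
    small without changing the value of the chain, and stays on the sphere because the faces of the
    l^1 sphere are flat.

    The index quantifies over generators of H^1 of the projective space. To bound it from below one
    generator must be exhibited, which requires computing this group; the contraction of the
    infinite sphere serves that purpose. The CW topology of the sphere forces all maps into it to
    have, locally, finitely many nonzero coordinates. *)

Lemma F2_add (x : 'F_2) : x + x = 0.
Proof. by case: x => -[|[|//]] i; exact/val_inj. Qed.

(** Identities in characteristic 2 are proved by naming the terms [c] that occur twice; [ring] then
    checks an identity valid in every commutative ring. *)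
Lemma F2_eq_mod2 (c a b : 'F_2) : a = b + (c + c) -> a = b.
Proof. by rewrite F2_add addr0. Qed.

Lemma F2_sub (x y : 'F_2) : x - y = x + y.
Proof. by apply: (@F2_eq_mod2 (- y)); ring. Qed.

Lemma F2_addE (x y z : 'F_2) : (x + y = z) -> x = z + y.
Proof. by move=> <-; apply: (@F2_eq_mod2 (-y)); ring. Qed.

Lemma in_map_iff_ex (A B : Type) (f : A -> B) (l : seq A) b :
  List.In b (map f l) -> exists a, List.In a l /\ b = f a.
Proof.
elim: l => //= a l IH [<-|/IH[a' [a'l ->]]]; first by exists a; split => //; left.
by exists a'; split => //; right.
Qed.

Section ListCochains.
Context {X : eqType}.
Implicit Types (c : seq X -> 'F_2) (s t : seq X) (w : X -> X -> 'F_2).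

(** Simplicial coboundary: the sum over all deletions of one entry, either the head or an entry of
    the tail. The recursion makes the algebra of [as_diff] accessible to induction; [ldiff_lst]
    links the two. *)
Fixpoint ldiff c s : 'F_2 :=
  if s is x :: s' then c s' + ldiff (fun t => c (x :: t)) s' else 0.

Lemma ldiff_ext c c' s :
  (forall t, size t = (size s).-1 -> {subset t <= s} -> c t = c' t) ->
  ldiff c s = ldiff c' s.
Proof.
elim: s c c' => //= x s IH c c' cc'; congr (_ + _).
  by apply: cc' => // y ys; rewrite inE ys orbT.
case: s IH cc' => // y s IH cc'.
apply: (IH (fun t => c (x :: t)) (fun t => c' (x :: t))) => t /= st ts; apply: cc' => /=.
  by rewrite st.
by move=> z; rewrite !inE => /orP[->//|/ts]; rewrite inE => ->; rewrite orbT.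
Qed.

Lemma eq_ldiff c c' s : c =1 c' -> ldiff c s = ldiff c' s.
Proof. by move=> cc'; apply: ldiff_ext. Qed.

Lemma ldiffD c c' s : ldiff (fun t => c t + c' t) s = ldiff c s + ldiff c' s.
Proof.
elim: s c c' => [|x s IH] c c' /=; first by rewrite addr0.
by rewrite IH; ring.
Qed.

Lemma ldiffM (a : 'F_2) c s : ldiff (fun t => a * c t) s = a * ldiff c s.
Proof.
elim: s c => [|x s IH] c /=; first by rewrite mulr0.
by rewrite IH; ring.
Qed.

Lemma ldiff0 s : ldiff (fun=> 0) s = 0.
Proof. by elim: s => //= x s ->; rewrite addr0. Qed.

Lemma ldiff_ldiff c s : ldiff (ldiff c) s = 0.
Proof.
elim: s c => //= x s IH c.
by rewrite ldiffD IH addr0 F2_add.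
Qed.

Definition cup1 w c s : 'F_2 := if s is x :: ((y :: _) as s') then w x y * c s' else 0.

Definition cup0 (e : X -> 'F_2) c s : 'F_2 := if s is x :: _ then e x * c s else 0.

Definition cocyc3 w (x y z : X) : Prop := w y z + w x z + w x y = 0.

Definition cocycle_on w s := {in s & &, forall x y z, cocyc3 w x y z}.

Lemma sub_cocycle_on w s t : {subset t <= s} -> cocycle_on w s -> cocycle_on w t.
Proof. by move=> ts ws x y z /ts ? /ts ? /ts ?; exact: ws. Qed.

(** Leibniz rule; the term with the coboundary of [w] drops out. On two points it fails: the
    left-hand side is 0, the right-hand side [w x y * c [::]]. *)
Lemma ldiff_cup1 w c s : cocycle_on w s -> (3 <= size s)%N ->
  ldiff (cup1 w c) s = cup1 w (ldiff c) s.
Proof.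
case: s => [//|x [//|y [//|z s]]] ws _ /=.
rewrite ldiffM -/(ldiff _ _) /=.
have : cocyc3 w x y z by apply: ws; rewrite !inE eqxx ?orbT.
rewrite /cocyc3 -addrA => /F2_addE ->; rewrite add0r.
apply: (@F2_eq_mod2 (w x z * c (z :: s))); ring.
Qed.

(** Deleting the head leaves the factor [e y], all other faces keep [e x]; since [c] is a cocycle,
    its values on these other faces add up to [c (y :: s)]. *)
Lemma ldiff_cup0 e c x y s : ldiff c (x :: y :: s) = 0 ->
  ldiff (cup0 e c) (x :: y :: s) = (e x + e y) * c (y :: s).
Proof.
rewrite /= ldiffM => h.
rewrite -mulrDr (_ : c (x :: s) + _ = c (y :: s)); first ring.
by apply/esym; rewrite -[RHS]add0r; apply: F2_addE.
Qed.

Definition prodl (l : seq (X -> X -> 'F_2)) : seq X -> 'F_2 :=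
  foldr cup1 (fun=> 1) l.

Lemma prodl_cons w l : prodl (w :: l) = cup1 w (prodl l).
Proof. by []. Qed.

Lemma ldiff_prodl l s : (forall w, List.In w l -> cocycle_on w s) ->
  size s = (size l).+2 -> ldiff (prodl l) s = 0.
Proof.
elim: l s => [|w l IH] s ws.
  by case: s ws => [//|x [//|y [|//]]] _ _ /=; rewrite addr0 F2_add.
move=> ss; rewrite prodl_cons ldiff_cup1; last 2 first.
- by apply: ws; left.
- by rewrite ss.
case: s ws ss => [//|x [//|y s]] ws [ss] /=.
rewrite [X in _ * X](_ : _ = ldiff (prodl l) (y :: s)) // IH ?mulr0//.
  move=> w' w'l; apply: (@sub_cocycle_on _ [:: x, y & s]).
    by move=> z; rewrite !inE => ->; rewrite orbT.
  by apply: ws; right.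
by rewrite /= ss.
Qed.

(* [(w, w', e)] records that [w] and [w'] differ by the coboundary of [e]. *)
Definition triple : Type := ((X -> X -> 'F_2) * (X -> X -> 'F_2) * (X -> 'F_2))%type.

(** A primitive of the difference of two cup products, factors of which are pairwise cohomologous.
    It telescopes: with P, P' the products of the tails and T a primitive of P - P', the difference
    wP - w'P' = (w - w')P + w'(P - P') has the primitive eP + w'T. *)
Fixpoint transfer (l : seq triple) : seq X -> 'F_2 :=
  if l is a :: l' then
    fun s => cup1 a.1.2 (transfer l') s + cup0 a.2 (prodl [seq p.1.1 | p <- l']) s
  else fun=> 0.

Lemma transfer_nil l : transfer l [::] = 0.
Proof. by case: l => //= a l; rewrite addr0. Qed.

Lemma prodl_transfer (l : seq triple) s :
  (forall a, List.In a l ->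
     [/\ cocycle_on a.1.1 s, cocycle_on a.1.2 s &
         {in s &, forall x y, a.1.1 x y = a.1.2 x y + (a.2 x + a.2 y)}]) ->
  size s = (size l).+1 ->
  prodl [seq p.1.1 | p <- l] s =
    prodl [seq p.1.2 | p <- l] s + ldiff (transfer l) s.
Proof.
elim: l s => [|a l IH] s hl.
  by move=> _; rewrite /= ldiff0 addr0.
case: s hl => [//|x [//|y s]] hl [ss].
have [c1 c2 E] := hl a (or_introl erefl).
have sub : {subset y :: s <= [:: x, y & s]}.
  by move=> z; rewrite !inE => ->; rewrite orbT.
have hl' : forall b, List.In b l ->
     [/\ cocycle_on b.1.1 (y :: s), cocycle_on b.1.2 (y :: s) &
         {in y :: s &, forall x y, b.1.1 x y = b.1.2 x y + (b.2 x + b.2 y)}].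
  move=> b bl; have [d1 d2 E'] := hl b (or_intror bl).
  split; [exact: sub_cocycle_on d1|exact: sub_cocycle_on d2|].
  by move=> u v /sub us /sub vs; exact: E'.
rewrite [transfer _]/= ldiffD [prodl _ _]/= [X in _ = X + _]/=.
rewrite -!/(prodl _) ldiff_cup0; last first.
  apply: ldiff_prodl; last by rewrite /= size_map ss.
  move=> w wl; have [b [bl ->]] := in_map_iff_ex wl.
  by have [] := hl b (or_intror bl).
rewrite E ?inE ?eqxx ?orbT// mulrDl IH//; last by rewrite /= ss.
have -> : ldiff (cup1 a.1.2 (transfer l)) [:: x, y & s] =
    a.1.2 x y * ldiff (transfer l) (y :: s).
  (* With [l] empty there are only two points and [ldiff_cup1] does not apply, but then [transfer]
     is zero. *)
  case: l ss {IH hl hl'} => [|b l] ss.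
    by rewrite (size0nil ss) /= !addr0 mulr0.
  by rewrite ldiff_cup1//= ss.
rewrite [X in _ = _ + (_ + _ * X)](_ : _ = prodl [seq p.1.1 | p <- l] (y :: s))//.
  rewrite IH//; last by rewrite /= ss.
  ring.
by rewrite IH//= ss.
Qed.

Variable r : rel X.

Definition invariant1 (e : X -> 'F_2) := forall x y, r x y -> e x = e y.
Definition invariant2 w := forall x x' y y', r x x' -> r y y' -> w x y = w x' y'.
(** The points may be moved by [r] independently of one another: this is what a cochain pulled back
    from the quotient satisfies. *)
Definition linvariant c := forall s t, all2 r s t -> c s = c t.

Lemma cup1_invariant w c : invariant2 w -> linvariant c -> linvariant (cup1 w c).
Proof.
move=> iw ic [|x [|y s]] [|x' [|y' t]]//=; try by rewrite andbF.
move=> /and3P[xx' yy' st]; rewrite (iw _ x' _ y')// (ic _ (y' :: t))//=.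
by rewrite yy'.
Qed.

Lemma cup0_invariant e c : invariant1 e -> linvariant c -> linvariant (cup0 e c).
Proof.
move=> ie ic [|x s] [|x' t]//= /andP[xx' st].
by rewrite (ie _ x')// (ic _ (x' :: t))//= xx'.
Qed.

Lemma prodl_invariant l : (forall w, List.In w l -> invariant2 w) -> linvariant (prodl l).
Proof.
elim: l => // w l IH iw; apply: cup1_invariant; first by apply: iw; left.
by apply: IH => w' w'l; apply: iw; right.
Qed.

Lemma transfer_invariant (l : seq triple) :
  (forall a, List.In a l -> [/\ invariant2 a.1.1, invariant2 a.1.2 & invariant1 a.2]) ->
  linvariant (transfer l).
Proof.
elim: l => [|a l IH] il; first by [].
move=> s t st /=; have [ia1 ia2 ia3] := il a (or_introl erefl).
rewrite (cup1_invariant ia2 _ st)//; last by apply: IH => b bl; apply: il; right.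
rewrite (cup0_invariant ia3 _ st)//; apply: prodl_invariant.
by move=> w wl; have [b [bl ->]] := in_map_iff_ex wl; have [] := il b (or_intror bl).
Qed.

End ListCochains.

(** * Barycentric subdivision and the antipodal fundamental chain *)

Section Subdivision.
Context {R : realType} {V : lmodType R}.
Implicit Types (c : seq V -> 'F_2) (s t : seq V).

Definition barycenter s : V := (size s)%:R^-1 *: \sum_(x <- s) x.

(** The transpose of barycentric subdivision: [c] is evaluated on the cone, with vertex the
    barycenter, over the subdivided boundary of [s]. The fuel [n] is meant to be the number of
    vertices. *)
Fixpoint sdn n c s : 'F_2 :=
  if n is n'.+1 then ldiff (sdn n' (fun t => c (barycenter s :: t))) s else c s.

Definition sd c s := sdn (size s) c s.

Definition lopp s := [seq - x | x <- s].

Lemma sdnD n c c' s : sdn n (fun t => c t + c' t) s = sdn n c s + sdn n c' s.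
Proof.
elim: n c c' s => //= n IH c c' s.
by rewrite -ldiffD; apply: eq_ldiff => t; rewrite IH.
Qed.

(** Subdivision is a chain map. In [ldiff c (b :: t)], with b the barycenter, the face [t] opposite
    to b gives the claim; by induction the other faces give a coboundary of a coboundary. *)
Lemma sdn_ldiff n c s : size s = n.+1 -> sdn n.+1 (ldiff c) s = ldiff (sdn n c) s.
Proof.
elim: n c s => [|n IH] c s ss.
  by case: s ss => [//|x [|//]] _ /=; rewrite !addr0.
rewrite [LHS]/= -/(sdn n.+1 _).
rewrite (@eq_ldiff _ _ (fun t => sdn n.+1 c t +
   sdn n.+1 (ldiff (fun t => c (barycenter s :: t))) t)); last first.
  by move=> t; rewrite -sdnD.
rewrite ldiffD [X in _ + X](_ : _ = 0) ?addr0//.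
rewrite -[RHS](ldiff_ldiff (sdn n (fun t => c (barycenter s :: t))) s).
by apply: ldiff_ext => t; rewrite ss => st _; exact: IH.
Qed.

Lemma sd_ldiff c : sd (ldiff c) = ldiff (sd c).
Proof.
apply/funext => -[|x s] //; rewrite /sd [size _]/= sdn_ldiff//.
by apply: ldiff_ext => t /= ->.
Qed.

Lemma iter_sd_ldiff N c : iter N sd (ldiff c) = ldiff (iter N sd c).
Proof. by elim: N => //= N ->; rewrite sd_ldiff. Qed.

Lemma ldiff_opp c s : ldiff c (lopp s) = ldiff (c \o lopp) s.
Proof. by elim: s c => //= x s IH c; rewrite IH. Qed.

Lemma barycenter_opp s : barycenter (lopp s) = - barycenter s.
Proof. by rewrite /barycenter size_map big_map sumrN scalerN. Qed.

Lemma sdn_opp n c s : sdn n c (lopp s) = sdn n (c \o lopp) s.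
Proof.
elim: n c s => //= n IH c s; rewrite ldiff_opp; apply: eq_ldiff => t /=.
by rewrite IH barycenter_opp.
Qed.

Lemma sd_opp c : sd c \o lopp = sd (c \o lopp).
Proof. by apply/funext => s /=; rewrite /sd sdn_opp size_map. Qed.

Lemma iter_sd_opp N c : iter N sd c \o lopp = iter N sd (c \o lopp).
Proof. by elim: N => //= N IH; rewrite sd_opp IH. Qed.

Lemma iter_sdD N c c' :
  iter N sd (fun t => c t + c' t) = (fun t => iter N sd c t + iter N sd c' t).
Proof.
elim: N => //= N ->; apply/funext => s; exact: sdnD.
Qed.

Lemma iter_sd0 N : iter N sd (fun=> 0) = (fun=> 0).
Proof.
elim: N => //= N ->; apply/funext => s; rewrite /sd.
suff H n t : sdn n (fun=> 0) t = 0 by exact: H.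
elim: n t => //= n IH t.
by rewrite -[RHS](ldiff0 t); apply: eq_ldiff.
Qed.

Variable e : nat -> V.

(* Evaluation on the chain z_0 = [e 0], z_(m+1) = e_(m+1) * (z_m + T z_m), a
   fundamental cycle of the projective space of dimension m + 1. *)
Fixpoint zeval m c : 'F_2 :=
  if m is m'.+1 then zeval m' (fun t => c (e m :: t) + c (e m :: lopp t))
  else c [:: e 0%N].

(** The simplices of the chain behind [zeval]; conditions on cochains need to be checked on them
    only. *)
Fixpoint face m s : Prop :=
  if m is m'.+1 then exists t, [/\ face m' t, s = e m :: t \/ s = e m :: lopp t & True]
  else s = [:: e 0%N].

Lemma zeval_ext m c c' : (forall s, face m s -> c s = c' s) -> zeval m c = zeval m c'.
Proof.
elim: m c c' => [|m IH] c c' cc' /=; first exact: cc'.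
apply: IH => t ft; rewrite cc'; last by exists t; split => //; left.
by rewrite cc'//; exists t; split => //; right.
Qed.

Lemma zevalD m c c' : zeval m (fun t => c t + c' t) = zeval m c + zeval m c'.
Proof.
elim: m c c' => //= m IH c c'; rewrite -IH.
by apply: zeval_ext => t _; ring.
Qed.

Lemma zeval0 m : zeval m (fun=> 0) = 0.
Proof. by elim: m => //= m IH; rewrite -[RHS]IH; apply: zeval_ext => t _; rewrite addr0. Qed.

Lemma loppK : involutive lopp.
Proof. by move=> s; rewrite /lopp -map_comp map_id_in// => x _ /=; rewrite opprK. Qed.

(** Dual to: the boundary of z_(m+1) is z_m + T z_m. The cone also contributes the cone over the
    boundary of z_m + T z_m, which is zero modulo 2 because the boundary of z_m is invariant under
    T. *)
Lemma zeval_ldiff m c : zeval m.+1 (ldiff c) = zeval m (fun t => c t + c (lopp t)).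
Proof.
elim: m c => [|m IH] c.
  rewrite /lopp /= !addr0; apply: (@F2_eq_mod2 (c [:: e 1%N])). ring.
rewrite [LHS](_ : _ = zeval m.+1 (fun t => (c t + c (lopp t)) +
    (ldiff (fun u => c (e m.+2 :: u) + c (e m.+2 :: lopp u)) t))); last first.
  rewrite -[LHS]/(zeval m.+1 (fun t => ldiff c (e m.+2 :: t) + ldiff c (e m.+2 :: lopp t))).
  by apply: zeval_ext => t _; rewrite /= ldiffD ldiff_opp/=; ring.
rewrite zevalD IH [X in _ + X](_ : _ = 0) ?addr0//.
rewrite -[RHS](zeval0 m); apply: zeval_ext => t _; rewrite loppK.
by apply: (@F2_eq_mod2 (c (e m.+2 :: t) + c (e m.+2 :: lopp t))); ring.
Qed.

End Subdivision.

(** * Continuous choice of radii *)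

Section Lipschitz_sup.
Context {R : realType} {V : normedModType R}.
Variable P : V -> R -> Prop.
Hypothesis P_shift : forall u v rho, P u rho -> `|u - v| < rho -> P v (rho - `|u - v|).

(* 1-Lipschitz, hence a continuous choice of radii which avoids partitions of unity. *)
Definition sup_radius (u : V) : R :=
  sup [set rho : R | rho = 0 \/ (0 < rho <= 1 /\ P u rho)].

Let has_sup_radius u : has_sup [set rho : R | rho = 0 \/ (0 < rho <= 1 /\ P u rho)].
Proof.
by split; [exists 0; left|exists 1 => x [->|[/andP[]]]//].
Qed.

Lemma sup_radius_ge0 u : 0 <= sup_radius u.
Proof. by apply: ub_le_sup; [exact: (has_sup_radius u).2|left]. Qed.

Lemma sup_radius_ge u rho : 0 < rho <= 1 -> P u rho -> rho <= sup_radius u.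
Proof. by move=> r1 Pu; apply: ub_le_sup; [exact: (has_sup_radius u).2|right]. Qed.

Lemma sup_radius_gt u r : 0 <= r -> r < sup_radius u ->
  exists rho, [/\ r < rho, rho <= 1 & P u rho].
Proof.
move=> r0 /(sup_gt (has_sup_radius u).1)[rho].
case=> [->|[/andP[r1 r2] Pu] rr]; first by rewrite ltNge r0.
by exists rho.
Qed.

Let sup_radius_le u v : sup_radius u <= sup_radius v + `|u - v|.
Proof.
rewrite leNgt; apply/negP => /sup_radius_gt[|rho [r1 r2 Pu]].
  by rewrite addr_ge0// sup_radius_ge0.
have uv : `|u - v| < rho.
  by apply: le_lt_trans r1; rewrite lerDr sup_radius_ge0.
have H : 0 < rho - `|u - v| <= 1.
  by rewrite subr_gt0 uv /= lerBlDr (le_trans r2)// lerDl.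
by have := sup_radius_ge H (P_shift Pu uv); rewrite lerBlDr leNgt r1.
Qed.

Lemma sup_radius_lip u v : `|sup_radius u - sup_radius v| <= `|u - v|.
Proof.
rewrite ler_norml; apply/andP; split; last by rewrite lerBlDl sup_radius_le.
by rewrite lerNl opprB lerBlDl distrC sup_radius_le.
Qed.

Lemma sup_radius_continuous : continuous sup_radius.
Proof.
move=> u; apply/cvgrPdist_lt => e e0; near=> v.
rewrite (le_lt_trans (sup_radius_lip _ _))//.
Unshelve. all: by end_near. Qed.

End Lipschitz_sup.

(** * Decrease of the mesh under subdivision *)

Section Mesh.
Context {R : realType} {V : normedModType R}.
Implicit Types (c : seq V -> 'F_2) (s t : seq V) (K : set V).

Definition convex_subset K :=
  forall x y (t : R), K x -> K y -> 0 <= t <= 1 -> K (t *: x + (1 - t) *: y).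

Definition diam_le s (d : R) := {in s &, forall x y, `|x - y| <= d}.

Lemma convex_closed_ball (x : V) d : convex_subset [set v | `|x - v| <= d].
Proof.
move=> u v t /= xu xv /andP[t0 t1].
have -> : x - (t *: u + (1 - t) *: v) = t *: (x - u) + (1 - t) *: (x - v).
  by rewrite !scalerBr addrACA -scalerDl [t + _]addrC subrK scale1r -opprD.
rewrite (le_trans (ler_normD _ _))// !normrZ (ger0_norm t0) ger0_norm ?subr_ge0//.
rewrite (_ : d = t * d + (1 - t) * d); last by rewrite -mulrDl addrC subrK mul1r.
by apply: lerD; apply: ler_wpM2l; rewrite ?subr_ge0.
Qed.

Lemma barycenter_convex K s : convex_subset K -> s != [::] ->
  {in s, forall x, K x} -> K (barycenter s).
Proof.
move=> cK; elim: s => // x s IH _ Ks.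
have [s0|s0] := eqVneq s [::].
  by rewrite s0 /barycenter big_seq1 invr1 scale1r; apply: Ks; rewrite inE eqxx.
have n0 : (size s)%:R != 0 :> R by rewrite pnatr_eq0 size_eq0.
have -> : barycenter (x :: s) =
    ((size s).+1%:R^-1) *: x + (1 - (size s).+1%:R^-1) *: barycenter s.
  rewrite /barycenter big_cons scalerDr /= scalerA; congr (_ + _ *: _).
  have n1 : (size s)%:R + 1 != 0 :> R by rewrite natr1 pnatr_eq0.
  by rewrite -natr1; field; rewrite n0 n1.
apply: cK.
- by apply: Ks; rewrite inE eqxx.
- by apply: IH => // y ys; apply: Ks; rewrite inE ys orbT.
- by rewrite invr_ge0 ler0n /= invf_le1 ?ltr0n// ler1n.
Qed.

(** The entry [v] itself contributes nothing to the average of the differences [x - v]; hence the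
    numerator, one less than the size. *)
Lemma barycenter_dist s v d : v \in s -> diam_le s d ->
  `|barycenter s - v| <= (size s).-1%:R / (size s)%:R * d.
Proof.
move=> vs sd.
have n0 : (0 < size s)%N by case: s vs {sd}.
have -> : barycenter s - v = (size s)%:R^-1 *: \sum_(x <- s) (x - v).
  rewrite big_split /= scalerDr big_const_seq count_predT iter_addr_0.
  by rewrite -[(- v) *+ _]scaler_nat scalerA mulVf ?scale1r// pnatr_eq0 -lt0n.
rewrite normrZ ger0_norm ?invr_ge0// mulrAC mulrC ler_wpM2r ?invr_ge0//.
rewrite (le_trans (ler_norm_sum _ _ _))// (big_rem v)//= subrr normr0 add0r.
rewrite -(size_rem vs) mulr_natl.
have : {in rem v s, forall x, `|x - v| <= d}.
  by move=> x /mem_rem xs; exact: sd.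
elim: (rem v s) => [|x t IH] h; first by rewrite big_nil.
rewrite big_cons /= mulrS lerD//; first by apply: h; rewrite inE eqxx.
by apply: IH => y yt; apply: h; rewrite inE yt orbT.
Qed.

Definition in_hull s (p : V) :=
  forall K, convex_subset K -> {in s, forall x, K x} -> K p.

Lemma diam_leW s t d : {subset t <= s} -> diam_le s d -> diam_le t d.
Proof. by move=> ts sd x y /ts xs /ts; exact: sd. Qed.

Definition mesh_ratio n : R := n%:R / n.+1%:R.

Lemma mesh_ratio_ge0 n : 0 <= mesh_ratio n.
Proof. by rewrite /mesh_ratio divr_ge0. Qed.

Lemma mesh_ratio_lt1 n : mesh_ratio n < 1.
Proof. by rewrite /mesh_ratio ltr_pdivrMr ?ltr0n// mul1r ltr_nat. Qed.

Lemma mesh_ratioS n : mesh_ratio n <= mesh_ratio n.+1.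
Proof.
rewrite /mesh_ratio ler_pdivrMr ?ltr0n// mulrAC ler_pdivlMr ?ltr0n//.
by rewrite -!natrM ler_nat; lia.
Qed.

(** An edge of the subdivided simplex either ends at the barycenter, and [barycenter_dist] bounds
    it, or belongs to the subdivision of a proper face, where the ratio is smaller by
    [mesh_ratioS]. *)
Lemma sdn_ext n c c' s d : size s = n.+1 -> 0 <= d -> diam_le s d ->
  (forall t, size t = n.+1 -> {in t, forall x, in_hull s x} ->
     diam_le t (mesh_ratio n * d) -> c t = c' t) ->
  sdn n.+1 c s = sdn n.+1 c' s.
Proof.
elim: n c c' s => [|n IH] c c' s ss d0 sd cc'.
  case: s ss sd cc' => [//|v [|//]] _ sd cc' /=; rewrite !addr0; apply: cc' => //.
    move=> x; rewrite inE => /eqP -> K cK vK; exact: barycenter_convex.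
  by move=> x y; rewrite !inE => /eqP-> /eqP->; rewrite subrr normr0 /mesh_ratio !mul0r.
rewrite -[sdn n.+2 c s]/(ldiff (sdn n.+1 (fun t => c (barycenter s :: t))) s).
rewrite -[sdn n.+2 c' s]/(ldiff (sdn n.+1 (fun t => c' (barycenter s :: t))) s).
have s0 : s != [::] by rewrite -size_eq0 ss.
apply: ldiff_ext => u; rewrite ss => su us; apply: IH => //; first exact: diam_leW sd.
move=> t st ut td; apply: cc' => [|x|]; first by rewrite /= st.
- rewrite inE => /orP[/eqP -> K cK sK|xt]; first exact: barycenter_convex.
  by move=> K cK sK; apply: (ut x) => // y /us /sK.
- have bx x : x \in t -> `|barycenter s - x| <= mesh_ratio n.+1 * d.
    move=> xt; apply: (ut x xt _ (@convex_closed_ball (barycenter s) _)) => y /us ys /=.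
    by have := barycenter_dist ys sd; rewrite ss.
  move=> x y; rewrite !inE => /orP[/eqP->|xt] /orP[/eqP->|yt].
  + by rewrite subrr normr0 mulr_ge0// mesh_ratio_ge0.
  + exact: bx.
  + by rewrite distrC; exact: bx.
  + by rewrite (le_trans (td _ _ xt yt))// ler_wpM2r// mesh_ratioS.
Qed.

Lemma iter_sd_ext N n K c c' s d : convex_subset K -> size s = n.+1 -> 0 <= d ->
  diam_le s d -> {in s, forall x, K x} ->
  (forall t, size t = n.+1 -> {in t, forall x, K x} ->
     diam_le t (mesh_ratio n ^+ N * d) -> c t = c' t) ->
  iter N sd c s = iter N sd c' s.
Proof.
move=> cK; elim: N s d => [|N IH] s d ss d0 sdd sK cc'.
  by rewrite /=; apply: cc' => //; rewrite expr0 mul1r.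
rewrite !iterS /sd ss.
apply: (sdn_ext ss d0 sdd) => t st ht td.
apply: (IH t (mesh_ratio n * d)) => //; first by rewrite mulr_ge0// mesh_ratio_ge0.
  by move=> x xt; apply: (ht x xt).
by move=> u su uK ud; apply: cc' => //; rewrite exprSr -mulrA.
Qed.

End Mesh.

Lemma eventually_small {R : realType} (a d e : R) : 0 <= a < 1 -> 0 < e ->
  exists N, a ^+ N * d <= e.
Proof.
move=> /andP[a0 a1] e0.
have : (fun n => a ^+ n * d) @ \oo --> (0 * d : R).
  by apply: cvgM; [apply: cvg_expr; rewrite ger0_norm|exact: cvg_cst].
rewrite mul0r => /cvgrPdist_le/(_ _ e0)[N _ /(_ N (leqnn N))] /=.
rewrite sub0r normrN => h; exists N; exact: le_trans (ler_norm _) h.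
Qed.

Lemma In_nseq (T : Type) (x y : T) k : List.In x (nseq k y) -> x = y.
Proof. by elim: k => //= k IH [->|/IH]. Qed.

(** * Nonvanishing of the top power on an antipodal sphere *)

Section BorsukUlam.
Context {R : realType} {V : normedModType R}.
Implicit Types (s t : seq V).
Variables (e : nat -> V) (S : set V) (n : nat).
Hypothesis e_le1 : forall i, `|e i| <= 1.
Hypothesis S_face : forall m s, (m <= n)%N -> face e m s ->
  exists K : set V, [/\ convex_subset K, K `<=` S & {in s, forall x, K x}].
Variable eps : V -> 'F_2.
Hypothesis eps_opp : forall x, S x -> eps (- x) = eps x + 1.

Definition coboundary1 {T : Type} (a : T -> 'F_2) : T -> T -> 'F_2 := fun x y => a x + a y.

Lemma cocyc3_coboundary1 {T : eqType} (a : T -> 'F_2) x y z : cocyc3 (coboundary1 a) x y z.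
Proof. by rewrite /cocyc3 /coboundary1; apply: (@F2_eq_mod2 (a x + a y + a z)); ring. Qed.

Let pw m : seq V -> 'F_2 := prodl (nseq m (coboundary1 eps)).

Lemma face_size m s : face e m s -> size s = m.+1.
Proof.
elim: m s => [|m IH] s /=; first by move=> ->.
by move=> [t [/IH st [->|->] _]] /=; rewrite ?size_map st.
Qed.

Lemma face_norm m s x : face e m s -> x \in s -> `|x| <= 1.
Proof.
elim: m s x => [|m IH] s x /=; first by move=> ->; rewrite inE => /eqP->.
move=> [t [/IH st [->|->] _]] /=; rewrite inE => /orP[/eqP->//|].
  exact: st.
by move=> /mapP[y yt ->]; rewrite normrN; exact: st.
Qed.

Lemma face_diam m s : face e m s -> diam_le s 2.
Proof.
move=> fs x y xs ys; rewrite (le_trans (ler_normB _ _))//.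
by rewrite -[2]/(1 + 1) lerD// (face_norm fs).
Qed.

Lemma zeval_sd_ext N m c c' : (m <= n)%N ->
  (forall t, size t = m.+1 -> {in t, forall x, S x} ->
     diam_le t (mesh_ratio m ^+ N * 2) -> c t = c' t) ->
  zeval e m (iter N sd c) = zeval e m (iter N sd c').
Proof.
move=> mn cc'; apply: zeval_ext => s fs.
have [K [cK KS sK]] := S_face mn fs.
apply: (iter_sd_ext (K := K) (d := 2) cK (face_size fs)) => //; first exact: face_diam fs.
by move=> t st tK td; apply: cc' => // x /tK /KS.
Qed.

Lemma zeval_sd_ldiff N m c :
  zeval e m.+1 (iter N sd (ldiff c)) = zeval e m (iter N sd (fun t => c t + c (lopp t))).
Proof.
rewrite iter_sd_ldiff zeval_ldiff iter_sdD; apply: zeval_ext => t _.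
by rewrite -(iter_sd_opp N c).
Qed.

Lemma prodl_opp m t : {in t, forall x, S x} -> pw m (lopp t) = pw m t.
Proof.
elim: m t => // m IH [//|x [//|y t]] St.
have H : pw m (lopp (y :: t)) = pw m (y :: t).
  by apply: IH => z zt; apply: St; rewrite inE zt orbT.
move: H; rewrite /pw /= => ->; congr (_ * _); rewrite /coboundary1.
rewrite !eps_opp; try by apply: St; rewrite !inE eqxx ?orbT.
by apply: (@F2_eq_mod2 1); ring.
Qed.

Lemma iter_sd1 N (c : seq V -> 'F_2) v : iter N sd c [:: v] = c [:: v].
Proof.
elim: N => //= N IH; rewrite /sd /= addr0 /barycenter big_seq1 invr1 scale1r.
exact: IH.
Qed.

(** The cochain [pw m.+1] is the coboundary of the product of [eps] with [pw m], so its value on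
    z_(m+1) is that of this product on z_m + T z_m. As [eps] changes by 1 under the antipodal map
    and [pw m] not at all, the value of [pw m] on z_m remains. *)
Lemma zeval_prodl N m : (m <= n)%N -> zeval e m (iter N sd (pw m)) = 1.
Proof.
elim: m => [|m IH] mn; first by rewrite /= iter_sd1.
rewrite (@zeval_sd_ext N m.+1 _ (ldiff (cup0 eps (pw m)))) //; last first.
  move=> [//|x [//|y t]] [st] _ _; rewrite ldiff_cup0//.
  apply: ldiff_prodl; last by rewrite size_nseq /= st.
  by move=> w wl; rewrite (In_nseq wl) => a b c _ _ _; exact: cocyc3_coboundary1.
rewrite zeval_sd_ldiff -[RHS](IH (ltnW mn)); apply: zeval_sd_ext; first exact: ltnW.
move=> [//|x t] _ St _.
rewrite -[cup0 _ _ (x :: t)]/(eps x * pw m (x :: t)).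
rewrite -[cup0 _ _ (lopp _)]/(eps (- x) * pw m (lopp (x :: t))) prodl_opp// eps_opp.
  by apply: (@F2_eq_mod2 (eps x * pw m (x :: t))); ring.
by apply: St; rewrite inE eqxx.
Qed.

(* Evaluate both sides on the fundamental chain: [pw n] gives 1 and, [b] being
   invariant under the antipodal map, [ldiff b] gives 0. *)
Lemma prodl_not_coboundary (b : seq V -> 'F_2) (d : R) : 0 < d ->
  b [::] = 0 ->
  (forall s, {in s, forall x, S x} -> b (lopp s) = b s) ->
  ~ (forall s, size s = n.+1 -> {in s, forall x, S x} -> diam_le s d ->
       prodl (nseq n (coboundary1 eps)) s = ldiff b s).
Proof.
move=> d0 b0 bopp H.
have r1 : 0 <= (mesh_ratio n : R) < 1 by rewrite mesh_ratio_ge0 mesh_ratio_lt1.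
have [N Nd] := eventually_small 2 r1 d0.
have := zeval_prodl N (leqnn n).
rewrite (@zeval_sd_ext N n _ (ldiff b))//; last first.
  move=> t st tS td; apply: H => // x y xt yt.
  exact: le_trans (td _ _ xt yt) Nd.
suff E m : m = n -> zeval e m (iter N sd (ldiff b)) = 0.
  by rewrite (E _ erefl) => /esym/eqP; rewrite oner_eq0.
(* In dimension 0 the coboundary of [b] at one point is [b [::]], whence the hypothesis [b0]. *)
case: m => [|m] mn; first by rewrite /= iter_sd1 /= b0 addr0.
rewrite zeval_sd_ldiff -[RHS](zeval0 e m) -(iter_sd0 N); apply: zeval_sd_ext.
  by rewrite -mn.
by move=> t _ tS _; rewrite bopp// F2_add.
Qed.

End BorsukUlam.

(** * The unit sphere of l^1 *)

Section CrossPolytope.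
Context {R : realType} (n : nat).

(** Unlike the Euclidean sphere it is a union of convex faces, so that barycenters of simplices in a
    face remain on it. *)
Definition cross_polytope : set 'rV[R]_n.+1 := [set x | \sum_i `|x ord0 i| = 1].

Definition cross_vertex (j : nat) : 'rV[R]_n.+1 := delta_mx 0 (inord j).

Lemma cross_polytope_opp x : cross_polytope x -> cross_polytope (- x).
Proof.
by rewrite /cross_polytope /= => <-; apply: eq_bigr => i _; rewrite mxE normrN.
Qed.

Lemma rV_norm_le k (x : 'rV[R]_k) (d : R) : 0 <= d ->
  (`|x| <= d) <-> (forall i, `|x ord0 i| <= d).
Proof.
move=> d0; rewrite [`|x|]/Num.norm /= mx_normrE; split.
  by move=> /bigmax_leP[_ h] i; exact: (h (ord0, i)).
by move=> h; apply/bigmax_leP; split => // -[i j] _; rewrite (ord1 i).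
Qed.

Lemma cross_vertex_le1 j : `|cross_vertex j| <= 1.
Proof.
apply/rV_norm_le => // i; rewrite /cross_vertex mxE eqxx /=.
by case: (i == inord j); rewrite ?normr1 ?normr0.
Qed.

Lemma cross_polytope_le1 x : cross_polytope x -> `|x| <= 1.
Proof.
move=> x1; apply/rV_norm_le => // i; rewrite -x1 (bigD1 i)//= lerDl.
exact: sumr_ge0.
Qed.

Lemma l1_norm_continuous : continuous (fun x : 'rV[R]_n.+1 => \sum_i `|x ord0 i|).
Proof.
have c1 (i : 'I_n.+1) : continuous (fun x : 'rV[R]_n.+1 => `|x ord0 i|).
  move=> x; apply: (@continuous_comp _ _ _ (fun x : 'rV[R]_n.+1 => x ord0 i) Num.norm).
    exact: coord_continuous.
  exact: norm_continuous.
move=> x; apply: (cvg_big add_continuous); first exact: nbhs_filter.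
by move=> i _; exact: c1.
Qed.

Lemma cross_polytope_compact : compact cross_polytope.
Proof.
apply: bounded_closed_compact.
  exists 1; split => // y y1 x /cross_polytope_le1 /le_trans; apply; exact: ltW.
apply: (@closed_comp _ _ (fun x : 'rV[R]_n.+1 => \sum_i `|x ord0 i|) [set 1]).
  by move=> x _; exact: l1_norm_continuous.
exact: closed_eq.
Qed.

(** Coning adds a vertex with sign +, and the antipodal map changes all the earlier signs at once:
    within one simplex no vertex occurs with both signs. *)
Lemma face_signs m s : face cross_vertex m s ->
  exists sg : nat -> R, (forall j, sg j * sg j = 1) /\
    {in s, forall x, exists2 j, (j <= m)%N & x = sg j *: cross_vertex j}.
Proof.
elim: m s => [|m IH] s /=.
  move=> ->; exists (fun=> 1); split; first by move=> _; rewrite mulr1.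
  by move=> x; rewrite inE => /eqP->; exists 0%N; rewrite ?scale1r.
move=> [t [/IH[sg [sg1 tE]] + _]].
have H (d : R) : d * d = 1 -> {in [seq d *: x | x <- t], forall x, exists2 j, (j <= m)%N &
    x = (if j == m.+1 then 1 else d * sg j) *: cross_vertex j}.
  move=> dd x /mapP[y /tE[j jm ->] ->]; exists j => //.
  by rewrite ltn_eqF// scalerA.
have tE1 : t = [seq 1 *: x | x <- t].
  by rewrite -[LHS]map_id; apply: eq_map => x; rewrite scale1r.
have tE2 : lopp t = [seq -1 *: x | x <- t].
  by apply: eq_map => x; rewrite scaleN1r.
rewrite {1}tE1 tE2 => sE.
have [d dd {}sE] : exists2 d : R, d * d = 1 & s = cross_vertex m.+1 :: [seq d *: x | x <- t].
  by case: sE => ->; [exists 1; rewrite ?mulr1|exists (-1); rewrite ?mulrNN ?mulr1].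
exists (fun j => if j == m.+1 then 1 else d * sg j); split.
  by move=> j; case: eqP => _; rewrite ?mulr1// mulrACA dd sg1 mulr1.
move=> x; rewrite sE inE => /orP[/eqP->|/(H _ dd)[j jm ->]].
  by exists m.+1; rewrite // eqxx scale1r.
by exists j => //; exact: leqW.
Qed.

Lemma cross_polytope_face m s : (m <= n)%N -> face cross_vertex m s ->
  exists K : set 'rV[R]_n.+1,
    [/\ convex_subset K, K `<=` cross_polytope & {in s, forall x, K x}].
Proof.
move=> mn /face_signs[sg [sg1 sE]].
(* The facet of the polytope in the closed orthant with signs [sg]. *)
exists [set x | (forall i : 'I_n.+1, 0 <= sg i * x ord0 i) /\
                \sum_(i < n.+1) sg i * x ord0 i = 1]; split.
- move=> x y t [x0 x1] [y0 y1] /andP[t0 t1]; split.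
    move=> i; rewrite !mxE mulrDr !(mulrCA (sg i)).
    by rewrite addr_ge0// mulr_ge0// subr_ge0.
  under eq_bigr do rewrite !mxE mulrDr !(mulrCA (sg _)).
  by rewrite big_split /= -!mulr_sumr x1 y1 !mulr1 addrC subrK.
- move=> x [x0 x1]; rewrite /cross_polytope /= -x1; apply: eq_bigr => i _.
  rewrite -(ger0_norm (x0 i)) normrM (_ : `|sg i| = 1) ?mul1r//.
  apply/eqP; rewrite -(@eqrXn2 _ 2)// expr1n -normrX expr2 sg1 normr1//.
- move=> x /sE[j jm ->]; split.
    move=> i; rewrite /cross_vertex !mxE eqxx /= mulrA.
    have [->|_] := eqVneq i (inord j); last by rewrite mulr0.
    by rewrite inordK ?ltnS ?(leq_trans jm)// sg1 mulr1.
  rewrite (bigD1 (inord j))//= big1 ?addr0; last first.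
    by move=> i ij; rewrite /cross_vertex !mxE (negbTE ij) /= !mulr0.
  by rewrite /cross_vertex !mxE !eqxx /= mulr1 inordK ?ltnS ?(leq_trans jm)// sg1.
Qed.

(** From local to uniform smallness: [sup_radius] is continuous and positive on the compact
    polytope, and half of its minimum serves as a Lebesgue number. *)
Lemma cross_polytope_nontrivial (eps : 'rV[R]_n.+1 -> 'F_2) (b : seq 'rV[R]_n.+1 -> 'F_2) :
  (forall x, cross_polytope x -> eps (- x) = eps x + 1) ->
  b [::] = 0 ->
  (forall s, {in s, forall x, cross_polytope x} -> b (lopp s) = b s) ->
  ~ (forall z, cross_polytope z -> exists2 rho, 0 < rho &
      forall s, size s = n.+1 ->
        {in s, forall x, cross_polytope x /\ `|z - x| < rho} ->
        prodl (nseq n (coboundary1 eps)) s = ldiff b s).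
Proof.
move=> epsN b0 bN H.
pose P (z : 'rV[R]_n.+1) rho := forall s, size s = n.+1 ->
  {in s, forall x, cross_polytope x /\ `|z - x| < rho} ->
  prodl (nseq n (coboundary1 eps)) s = ldiff b s.
have Psh u v rho : P u rho -> `|u - v| < rho -> P v (rho - `|u - v|).
  move=> Pu uv s ss sS; apply: Pu => // x /sS[Sx vx]; split => //.
  rewrite (le_lt_trans (ler_distD v _ _))//.
  by rewrite -ltrBrDl.
have Lc := sup_radius_continuous Psh.
have L0 z : cross_polytope z -> 0 < sup_radius P z.
  move=> /H[rho r0 Pz].
  have r1 : 0 < Num.min rho 1 <= 1 by rewrite lt_min r0 ltr01 ge_min lexx orbT.
  have := @sup_radius_ge _ _ P z (Num.min rho 1) r1.
  move=> /(_ _)/(lt_le_trans (andP r1).1); apply => s ss sS; apply: Pz => // x /sS[Sx zx].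
  by split => //; rewrite (lt_le_trans zx)// ge_min lexx.
have S0 : cross_polytope !=set0.
  have [K [_ KS sK]] := @cross_polytope_face 0 [:: cross_vertex 0] (leq0n n) erefl.
  by exists (cross_vertex 0); apply: KS; apply: sK; rewrite inE eqxx.
have [z zS zmin] := EVT_min_rV S0 cross_polytope_compact (continuous_subspaceT Lc).
rewrite inE in zS; have Lz := L0 _ zS.
apply: (@prodl_not_coboundary _ _ cross_vertex cross_polytope n
   cross_vertex_le1 cross_polytope_face eps epsN b (sup_radius P z / 2)) => //.
  by rewrite divr_gt0.
move=> s ss sS sd.
have [x xs] : exists x, x \in s by case: (s) ss => // x t _; exists x; rewrite inE eqxx.
have [||rho [r1 _ Px]] := @sup_radius_gt _ _ P x (sup_radius P z / 2).
- by rewrite divr_ge0// ltW.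
- apply: lt_le_trans (zmin x _); last by rewrite inE; exact: sS.
  by rewrite ltr_pdivrMr// ltr_pMr// ltr1n.
apply: Px => // y ys; split; first exact: sS.
exact: le_lt_trans (sd _ _ xs ys) r1.
Qed.

End CrossPolytope.

(** * Path lifting *)

(** [P] passes between any two points near [t], in both directions, so it reaches the supremum of
    the initial segment on which it holds and goes beyond it. *)
Lemma interval_induction {R : realType} (a b : R) (P : R -> Prop) : a <= b ->
  (forall t : R, a <= t <= b -> exists2 d : R, 0 < d & forall t1 t2 : R,
     a <= t1 <= b -> a <= t2 <= b -> `|t - t1| < d -> `|t - t2| < d -> P t1 -> P t2) ->
  P a -> P b.
Proof.
move=> ab loc Pa.
pose A := [set t | a <= t <= b /\ forall u, a <= u <= t -> P u].
have Aa : A a by split; [rewrite lexx|move=> u; rewrite andbC => /le_anti ->].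
have supA : has_sup A by split; [exists a|exists b => t [/andP[]]].
set s := sup A.
have as_ : a <= s by apply: ub_le_sup => //; exact: supA.2.
have sb : s <= b by apply: ge_sup; [exists a|move=> t [/andP[]]].
have sab : a <= s <= b by rewrite as_.
have [d d0 H] := loc s sab.
have [t [[/andP[at_ tb] Pt] st]] := sup_adherent d0 supA.
have ts : t <= s by apply: ub_le_sup => //; [exact: supA.2|split; rewrite ?at_].
have near u : a <= u <= b -> `|s - u| < d -> P u.
  move=> uab su; apply: (H t u) => //; first by rewrite at_.
    by rewrite ger0_norm ?subr_ge0// ltrBlDl -ltrBlDr.
  by apply: Pt; rewrite at_ lexx.
have [sb'|sb'] := ltP s b; last by apply: near; rewrite ?ab ?lexx// (le_anti (_ : s <= b <= s)) ?sb// subrr normr0.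
have : A (Num.min b (s + d / 2)).
  have m1 : a <= Num.min b (s + d / 2).
    by rewrite le_min ab (le_trans as_)// lerDl divr_ge0 ?ltW.
  split; first by rewrite m1 ge_min lexx.
  move=> u /andP[au]; rewrite le_min => /andP[ub us].
  have [ut|tu] := leP u t; first by apply: Pt; rewrite au.
  apply: near; first by rewrite au.
  rewrite ltr_norml; apply/andP; split; first by rewrite ltrBrDl; lra.
  by rewrite /s in us st *; lra.
move/(ub_le_sup supA.2); rewrite -/s leNgt lt_min sb' /= ltrDl.
by rewrite divr_gt0.
Qed.

Section PathLift.
Context {R : realType} {Y : topologicalType} (c : Y -> Y -> 'F_2).
Implicit Types (U : set Y).

Definition cocyc_set U := forall x y z, U x -> U y -> U z -> cocyc3 c x y z.

Lemma cocyc_set_refl U x : cocyc_set U -> U x -> c x x = 0.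
Proof. by move=> cU Ux; have := cU x x x Ux Ux Ux; rewrite /cocyc3 F2_add add0r. Qed.

Lemma cocyc_set_sym U x y : cocyc_set U -> U x -> U y -> c x y = c y x.
Proof.
move=> cU Ux Uy; have := cU x y x Ux Uy Ux; rewrite /cocyc3 (cocyc_set_refl cU Ux) addr0.
by move/F2_addE ->; rewrite add0r.
Qed.

Lemma cocyc_set_trans U x y z : cocyc_set U -> U x -> U y -> U z ->
  c x z = c x y + c y z.
Proof.
move=> cU Ux Uy Uz; have := cU x y z Ux Uy Uz; rewrite /cocyc3 => h.
rewrite -[LHS]addr0 -h; apply: (@F2_eq_mod2 (c x z)); ring.
Qed.

Hypothesis c_loc : forall y : Y, exists2 U : set Y, nbhs y U & cocyc_set U.

Variable gam : R -> Y.
Hypothesis gam_cont : forall t : R, 0 <= t <= 1 -> gam @ t --> gam t.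

Lemma path_chart (t : R) : 0 <= t <= 1 ->
  exists2 d : R, 0 < d & exists2 U, cocyc_set U & forall u, `|t - u| < d -> U (gam u).
Proof.
move=> t01; have [U Ut cU] := c_loc (gam t).
have /nbhs_ballP[d /= d0 dU] := gam_cont t01 Ut.
by exists d => //; exists U => // u tu; exact: dU.
Qed.

(** [beta] is a primitive of [c] along the path, normalised at 0. The relation is required for
    nearby times only, because [c] is a cocycle only locally. *)
Definition lifts_path (T : R) (beta : R -> 'F_2) : Prop :=
  beta 0 = 0 /\ forall t : R, 0 <= t <= T -> exists2 d : R, 0 < d & forall t1 t2 : R,
    0 <= t1 <= T -> 0 <= t2 <= T -> `|t - t1| < d -> `|t - t2| < d ->
    c (gam t1) (gam t2) = beta t1 + beta t2.

Lemma lifts_path_exists : exists beta, lifts_path 1 beta.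
Proof.
apply: (@interval_induction R 0 1 (fun T => exists beta, lifts_path T beta)) => //; last first.
  exists (fun=> 0); split => // t; rewrite andbC => /le_anti ->; exists 1 => // t1 t2.
  rewrite andbC => /le_anti ->; rewrite andbC => /le_anti -> _ _; rewrite addr0.
  have [|d d0 [U cU dU]] := @path_chart 0; first by rewrite lexx ler01.
  by apply: cocyc_set_refl cU _; apply: dU; rewrite subrr normr0.
move=> t t01; have [d d0 [U cU dU]] := path_chart t01; exists d => // t1 t2.
move=> /andP[t10 t11] /andP[t20 t21] tt1 tt2 [beta [b0 bE]].
have [t21_le|t12] := leP t2 t1.
  exists beta; split => // u /andP[u0 u1].
  have [|e e0 He] := bE u; first by rewrite u0 (le_trans u1).
  exists e => // v1 v2 /andP[v10 v11] /andP[v20 v21].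
  by apply: He; rewrite ?v10 ?v20 ?(le_trans v11) ?(le_trans v21).
have Umid u : t1 <= u <= t2 -> U (gam u).
  move=> /andP[u1 u2]; apply: dU; move: tt1 tt2; rewrite !ltr_norml.
  by move=> /andP[? ?] /andP[? ?]; apply/andP; split; lra.
have Ut1 : U (gam t1) by apply: Umid; rewrite lexx ltW.
(* From [t1] to [t2] the path stays in the chart [U], where [c (gam t1)] is a primitive of [c]. *)
pose beta' u := if u <= t1 then beta u else beta t1 + c (gam t1) (gam u).
have b'1 u : u <= t1 -> beta' u = beta u by rewrite /beta' => ->.
have b'2 u : t1 <= u <= t2 -> beta' u = beta t1 + c (gam t1) (gam u).
  move=> /andP[u1 u2]; rewrite /beta'; case: ifP => // u1'.
  by rewrite (le_anti (_ : u <= t1 <= u)) ?u1 ?u1'// (cocyc_set_refl cU) ?addr0.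
exists beta'; split; first by rewrite b'1.
move=> u /andP[u0 u2].
have [ut1|t1u|ut1] := ltgtP u t1.
- have [|e e0 He] := bE u; first by rewrite u0 ltW.
  exists (Num.min e (t1 - u)); first by rewrite lt_min e0 subr_gt0.
  move=> v1 v2 /andP[v10 _] /andP[v20 _]; rewrite !lt_min => /andP[ue1 uu1] /andP[ue2 uu2].
  have w1 : v1 <= t1 by move: uu1; rewrite ltr_norml => /andP[? ?]; lra.
  have w2 : v2 <= t1 by move: uu2; rewrite ltr_norml => /andP[? ?]; lra.
  by rewrite !b'1//; apply: He; rewrite ?v10 ?v20.
- exists (u - t1); first by rewrite subr_gt0.
  move=> v1 v2 /andP[v10 v12] /andP[v20 v22] uu1 uu2.
  have w1 : t1 <= v1 <= t2 by rewrite v12 andbT; move: uu1; rewrite ltr_norml => /andP[? ?]; lra.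
  have w2 : t1 <= v2 <= t2 by rewrite v22 andbT; move: uu2; rewrite ltr_norml => /andP[? ?]; lra.
  rewrite !b'2// (@cocyc_set_trans U _ (gam t1))//; try exact: Umid.
  rewrite (@cocyc_set_sym U _ (gam t1))//; try exact: Umid.
  by apply/esym; apply: (@F2_eq_mod2 (beta t1)); ring.
(* At the junction two points on either side are both compared with [gam t1]. *)
- have [|e e0 He] := bE t1; first by rewrite t10 lexx.
  have key v : 0 <= v <= t2 -> `|u - v| < e -> c (gam t1) (gam v) = beta t1 + beta' v
      /\ (U (gam v) \/ v < t1).
    move=> /andP[v0 v2]; rewrite ut1 => uv.
    have [vt|tv] := leP v t1; last first.
      have H : t1 <= v <= t2 by rewrite v2 andbT ltW.
      split; last by left; exact: Umid.
      by rewrite b'2//; apply/esym; apply: (@F2_eq_mod2 (beta t1)); ring.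
    rewrite b'1// He ?t10 ?lexx// ?v0// ?subrr ?normr0//; split => //.
    by move: vt; rewrite le_eqVlt => /orP[/eqP ->|]; [left|right].
  exists (Num.min e (Num.min d (d - `|t - t1|))).
    by rewrite !lt_min e0 d0 subr_gt0.
  move=> v1 v2 v1h v2h; rewrite !lt_min => /and3P[v1e _ v1d] /and3P[v2e _ v2d].
  have UU v : `|u - v| < d - `|t - t1| -> U (gam v).
    move=> uv; apply: dU; rewrite (le_lt_trans (ler_distD t1 _ _))//.
    by rewrite -ltrBrDl; move: uv; rewrite ut1.
  have [E1 _] := key _ v1h v1e; have [E2 _] := key _ v2h v2e.
  rewrite (@cocyc_set_trans U _ (gam t1))//; try exact: UU.
  rewrite (@cocyc_set_sym U _ (gam t1)) ?E1 ?E2//; try exact: UU.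
  by apply: (@F2_eq_mod2 (beta t1)); ring.
Qed.

(** Inside one chart the local relations add up along the path, however far apart [t1] and [t2]
    are. *)
Lemma lifts_path_segment beta U (t1 t2 : R) : lifts_path 1 beta -> cocyc_set U ->
  0 <= t1 -> t1 <= t2 -> t2 <= 1 -> (forall u, t1 <= u <= t2 -> U (gam u)) ->
  c (gam t1) (gam t2) = beta t1 + beta t2.
Proof.
move=> [_ bE] cU t10 t12 t21 HU.
have U1 : U (gam t1) by apply: HU; rewrite lexx.
apply: (@interval_induction R t1 t2 (fun t => c (gam t1) (gam t) = beta t1 + beta t)) => //.
  move=> t /andP[t1t tt2].
  have [|d d0 H] := bE t; first by rewrite (le_trans t10)//= (le_trans tt2).
  exists d => // u1 u2 /andP[u11 u12] /andP[u21 u22] tu1 tu2 E.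
  rewrite (@cocyc_set_trans U _ (gam u1))//; try by apply: HU; apply/andP.
  rewrite E H ?(le_trans t10) ?(le_trans u12) ?(le_trans u22)//.
  by apply: (@F2_eq_mod2 (beta u1)); ring.
by rewrite F2_add (cocyc_set_refl cU).
Qed.

End PathLift.

(** * The infinite sphere *)

Section SphereTopology.
Context {R : realType}.
Local Notation S := (infinite_sphere R).
Implicit Types (x y : S) (z : nat -> R).

Definition supported n z := forall i, (n < i)%N -> z i = 0.

Lemma supportedW n m z : (n <= m)%N -> supported n z -> supported m z.
Proof. by move=> nm zn i mi; apply: zn; exact: leq_ltn_trans nm mi. Qed.

Lemma sphere_supported x : exists n, supported n x.
Proof. by have /asboolP[n []] := sphere_valP x; exists n. Qed.

Lemma sphere_openE (U : set S) : open U = sphere_open U.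
Proof. by []. Qed.

Lemma sphere_coord_continuous i : continuous (fun x : S => sphere_val x i).
Proof.
apply/continuousP => Q oQ; rewrite sphere_openE => n.
exists ((fun f : {ptws nat -> R} => f i) @^-1` Q); split => //.
by apply: open_comp => // f _; exact: (@proj_continuous nat (fun=> R) i f).
Qed.

Lemma ptws_cvg (T : Type) (F : set_system T) (FF : Filter F) (G : T -> nat -> R)
    (p : nat -> R) : (forall i, G t i @[t --> F] --> p i) ->
  (fun t => (G t : {ptws nat -> R})) @ F --> (p : {ptws nat -> R}).
Proof. by move=> Gi; apply/(@pointwise_cvgP nat R) => i; exact: Gi. Qed.

(** In the CW topology coordinatewise convergence does not suffice in general; it does inside one
    finite-dimensional sphere, whence the common bound [n] on the supports. *)
Lemma sphere_cvg (T : Type) (F : set_system T) (FF : Filter F) (G : T -> S) (p : S) n :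
  supported n p -> (\forall t \near F, supported n (G t)) ->
  (forall i, sphere_val (G t) i @[t --> F] --> sphere_val p i) ->
  G @ F --> p.
Proof.
move=> pn Gn Gi U; rewrite nbhsE => -[Q [oQ Qp] QU].
have [V [oV QV]] := oQ n.
have GV : \forall t \near F, V (sphere_val (G t)).
  have : (fun t => (sphere_val (G t) : {ptws nat -> R})) @ F --> (sphere_val p : {ptws nat -> R}).
    exact: ptws_cvg.
  by apply; apply: open_nbhs_nbhs; split => //; apply/(QV _ pn).
suff : \forall t \near F, U (G t) by [].
by apply: filterS2 Gn GV => t tn Vt; apply: QU; apply/(QV _ tn).
Qed.

Lemma sphere_open_skeleton (A : set S) :
  (forall n y, supported n y -> A y -> \forall w \near y, supported n (w : S) -> A w) ->
  open A.
Proof.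
move=> HA; rewrite sphere_openE => n.
exists (\bigcup_(V in [set V : set {ptws nat -> R} | open V /\
   forall x, supported n x -> V (sphere_val x) -> A x]) V); split.
  by apply: bigcup_open => V [].
move=> x xn; split => [Ax|[V [_ VA] Vx]]; last exact: VA.
have := HA n x xn Ax; rewrite /= {1}/prop_near1 nbhsE => -[Q [oQ Qx] QA].
rewrite sphere_openE in oQ.
have [V [oV QV]] := oQ n; exists V; last by apply/(QV x xn).
by split => // w wn Vw; apply: QA => //; apply/(QV w wn).
Qed.

Lemma sphere_oppP x : - sphere_val x \in on_infinite_sphere (R := R).
Proof.
have /asboolP[n [xn x1]] := sphere_valP x; apply/asboolP; exists n; split.
  by move=> i ni; rewrite fctE xn// oppr0.
by rewrite -x1; apply: eq_bigr => i _; rewrite fctE sqrrN.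
Qed.

Definition sphere_opp x : S := InfiniteSphere (sphere_oppP x).

Lemma sphere_opp_continuous : continuous sphere_opp.
Proof.
apply/continuousP => Q; rewrite !sphere_openE => oQ n; have [V [oV QV]] := oQ n.
have cN : continuous (fun f : {ptws nat -> R} => ((fun i => - f i) : {ptws nat -> R})).
  move=> f; apply: (@ptws_cvg _ (nbhs f) _ (fun g i => - g i) (fun i => - f i)) => i.
  have c : (fun g : {ptws nat -> R} => g i) @ nbhs f --> f i by exact: (@proj_continuous nat (fun=> R) i f).
  apply/cvgrPdist_lt => e e0; have /cvgrPdist_lt/(_ _ e0) := c.
  by apply: filterS => g /= h; rewrite -opprD normrN.
exists ((fun f : {ptws nat -> R} => ((fun i => - f i) : {ptws nat -> R})) @^-1` V); split.
  by apply: open_comp oV => f _; exact: cN.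
move=> x xn; have xn' : forall i, (n < i)%N -> sphere_opp x i = 0.
  by move=> i ni; rewrite /= fctE xn// oppr0.
exact: (QV (sphere_opp x) xn').
Qed.

(** A limit, so that no bound on the supports enters the definition; [dotE] turns it into a finite
    sum. *)
Definition dot z z' : R := limn (series (fun i => z i * z' i)).

Lemma dotE n z z' : supported n z -> dot z z' = \sum_(i < n.+1) z i * z' i.
Proof.
move=> zn; apply: lim_near_cst => //; exists n.+1 => // m /= nm.
rewrite seriesEnat /= (@big_cat_nat _ _ _ n.+1)//= [X in _ + X]big_nat_cond.
rewrite [X in _ + X]big1 ?addr0 ?big_mkord// => i /andP[/andP[ni _] _].
by rewrite zn ?mul0r.
Qed.

Lemma dotC z z' : dot z z' = dot z' z.
Proof. by congr (limn (series _)); apply/funext => i; rewrite mulrC. Qed.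

Lemma dotN n z z' : supported n z -> dot (- z) z' = - dot z z'.
Proof.
move=> zn; rewrite (@dotE n) ?(@dotE n z)//.
  by rewrite -sumrN; apply: eq_bigr => i _; rewrite fctE mulNr.
by move=> i ni; rewrite fctE zn// oppr0.
Qed.

Lemma sphere_dot1 x : dot x x = 1.
Proof.
have /asboolP[n [xn x1]] := sphere_valP x; rewrite (dotE _ xn) -x1.
by apply: eq_bigr => i _; rewrite expr2.
Qed.

Lemma dot_gt0 n z i : supported n z -> z i != 0 -> 0 < dot z z.
Proof.
move=> zn zi; rewrite (dotE _ zn).
have ni : (i < n.+1)%N by rewrite ltnS leqNgt; apply/negP => /zn; apply/eqP.
rewrite (bigD1 (Ordinal ni))//= ltr_pwDl//.
  by rewrite -expr2 exprn_even_gt0.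
by apply: sumr_ge0 => j _; rewrite -expr2 sqr_ge0.
Qed.

Lemma sphere_neq0 x : exists i, sphere_val x i != 0.
Proof.
apply: contrapT => /forallNP x0; have := sphere_dot1 x.
have [n xn] := sphere_supported x.
rewrite (dotE _ xn) big1 => [|i _]; first by move=> /esym/eqP; rewrite oner_eq0.
by have /negP := x0 i; rewrite negbK => /eqP ->; rewrite mul0r.
Qed.

Lemma basepoint_subproof : (fun i => (i == 0)%:R) \in on_infinite_sphere (R := R).
Proof.
apply/asboolP; exists 0%N; split; first by case.
by rewrite big_ord1 eqxx expr1n.
Qed.

Definition basepoint : S := InfiniteSphere basepoint_subproof.

Definition normalize z : S := insubd basepoint (fun i => z i / Num.sqrt (dot z z)).

Lemma normalizeE n z i : supported n z -> z i != 0 ->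
  sphere_val (normalize z) = (fun i => z i / Num.sqrt (dot z z)).
Proof.
move=> zn zi; have d0 := dot_gt0 zn zi.
rewrite /normalize val_insubd ifT//; apply/asboolP; exists n; split.
  by move=> j nj; rewrite zn// mul0r.
under eq_bigr do rewrite exprMn exprVn sqr_sqrtr ?(ltW d0)//.
rewrite -mulr_suml (dotE _ zn); under eq_bigr do rewrite expr2.
by rewrite -(dotE _ zn) divff// gt_eqF.
Qed.

Lemma normalize_id x : normalize x = x.
Proof.
have [n xn] := sphere_supported x; have [i xi] := sphere_neq0 x.
apply/val_inj; rewrite [LHS](normalizeE xn xi) sphere_dot1 sqrtr1.
by apply/funext => j; rewrite divr1.
Qed.

Lemma normalize_cvg (T : Type) (F : set_system T) (FF : Filter F) (G : T -> nat -> R)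
    z n j : supported n z -> z j != 0 ->
  (\forall t \near F, supported n (G t)) ->
  (forall i, G t i @[t --> F] --> z i) ->
  normalize (G t) @[t --> F] --> normalize z.
Proof.
move=> zn zj Gn Gi; have d0 := dot_gt0 zn zj.
have Gj : \forall t \near F, G t j != 0.
  have : `|z j| > 0 by rewrite normr_gt0.
  move=> zj0; have /cvgrPdist_lt/(_ _ zj0) := Gi j.
  apply: filterS => t; apply: contraTneq => ->; by rewrite subr0 ltxx.
have Gd : dot (G t) (G t) @[t --> F] --> dot z z.
  rewrite (dotE _ zn).
  have : \sum_(i < n.+1) G t i * G t i @[t --> F] --> \sum_(i < n.+1) z i * z i.
    apply: (cvg_big add_continuous) => i _; exact: cvgM.
  apply: cvg_trans; apply: near_eq_cvg; near=> t.
  by rewrite (@dotE n)//; near: t.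
apply: (@sphere_cvg _ _ _ _ _ n).
- by move=> i ni; rewrite (normalizeE zn zj) zn ?mul0r.
- near=> t; have tn : supported n (G t) by near: t.
  have tj : G t j != 0 by near: t.
  by move=> i ni; rewrite (normalizeE tn tj) tn ?mul0r.
- move=> i; rewrite (normalizeE zn zj).
  have : G t i / Num.sqrt (dot (G t) (G t)) @[t --> F] --> z i / Num.sqrt (dot z z).
    apply: cvgM => //; apply: cvgV; first by rewrite gt_eqF// sqrtr_gt0.
    by apply: (cvg_comp _ _ Gd); exact: sqrt_continuous.
  apply: cvg_trans; apply: near_eq_cvg; near=> t.
  have tn : supported n (G t) by near: t.
  have tj : G t j != 0 by near: t.
  by rewrite (normalizeE tn tj).
Unshelve. all: by end_near. Qed.

Definition shift z i : R := if i is j.+1 then z j else 0.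

(** A path from the base point at t = 0 to [x] at t = 1. The straight segment may pass through 0;
    the middle term prevents this, since just after the last nonzero coordinate of [x] only the
    shifted copy contributes. *)
Definition contraction_line x (t : R) i : R :=
  t ^+ 2 * sphere_val x i + t * (1 - t) * shift x i + (1 - t) ^+ 2 * (i == 0)%:R.

Lemma contraction_line_supported n x t : supported n x ->
  supported n.+1 (contraction_line x t).
Proof.
move=> xn [//|i] ni; rewrite /contraction_line /= xn; last exact: ltnW.
by rewrite xn// !mulr0 !addr0.
Qed.

Lemma contraction_line_neq0 x t : exists i, contraction_line x t i != 0.
Proof.
rewrite /contraction_line.
have [->|t0] := eqVneq t 0.
  by exists 0%N; rewrite expr0n /= !mul0r subr0 expr1n mulr1 !add0r oner_eq0.
have [->|t1] := eqVneq t 1.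
  have [i xi] := sphere_neq0 x; exists i.
  by rewrite subrr mulr0 expr0n /= !mul0r expr1n mul1r !addr0.
have [n xn] := sphere_supported x.
have ex : exists i, sphere_val x i != 0 := sphere_neq0 x.
have ub i : sphere_val x i != 0 -> (i <= n)%N.
  by rewrite leqNgt; apply: contra => /xn ->.
case: (ex_maxnP ex ub) => m xm mmax; exists m.+1 => /=.
rewrite (_ : sphere_val x m.+1 = 0); last first.
  by apply/eqP/negPn/negP => /mmax; rewrite ltnn.
by rewrite !mulr0 add0r addr0 mulf_neq0// mulf_neq0// subr_eq0 eq_sym.
Qed.

Definition contract x t : S := normalize (contraction_line x t).

Lemma contract0 x : contract x 0 = basepoint.
Proof.
rewrite /contract (_ : contraction_line x 0 = basepoint) ?normalize_id//.
by apply/funext => i; rewrite /contraction_line expr0n /= !mul0r subr0 expr1n mul1r !add0r.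
Qed.

Lemma contract1 x : contract x 1 = x.
Proof.
rewrite /contract (_ : contraction_line x 1 = x) ?normalize_id//.
by apply/funext => i; rewrite /contraction_line subrr mulr0 expr0n /= !mul0r expr1n mul1r !addr0.
Qed.

Lemma contract_continuous n x (t : R) : supported n x ->
  contract p.1 p.2 @[p --> filter_prod (within [set y : S | supported n y] (nbhs x)) (nbhs t)]
    --> contract x t.
Proof.
move=> xn; have [j xj] := contraction_line_neq0 x t.
set F := filter_prod _ _.
have c1 i : sphere_val p.1 i @[p --> F] --> sphere_val x i.
  apply: (@cvg_comp _ _ _ fst (fun y : S => sphere_val y i) _ (nbhs x)).
    apply: cvg_trans; [exact: cvg_fst|exact: cvg_within].
  exact: sphere_coord_continuous.
have c2 : p.2 @[p --> F] --> t by exact: cvg_snd.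
apply: (@normalize_cvg _ F _ (fun p => contraction_line p.1 p.2) _ n.+1 j
  (contraction_line_supported t xn) xj).
  exists ([set y : S | supported n y], setT) => /=; last by move=> p [p1 _]; exact: contraction_line_supported.
  by split; [exact: withinT|exact: filterT].
move=> i; apply: cvgD; last first.
  apply: cvgM; last exact: cvg_cst.
  by rewrite expr2; apply: cvgM; apply: cvgB => //; exact: cvg_cst.
apply: cvgD.
  by apply: cvgM => //; rewrite expr2; apply: cvgM.
apply: cvgM; first by apply: cvgM => //; apply: cvgB => //; exact: cvg_cst.
by case: i => [|i] /=; [exact: cvg_cst|exact: c1].
Qed.

Lemma contract_nbhs n x (t : R) (U : set S) : supported n x -> nbhs (contract x t) U ->
  exists2 A : set S, nbhs x A & exists2 d : R, 0 < d &
    forall (y : S) (u : R), supported n y -> A y -> `|t - u| < d -> U (contract y u).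
Proof.
move=> xn /(contract_continuous xn)[[A B] /= [nA /nbhs_ballP[d /= d0 dB]] AB].
exists [set y : S | supported n y -> A y] => //; exists d => // y u yn Ay tu.
by apply: (AB (y, u)); split; [exact: Ay|exact: dB].
Qed.

Lemma contract_path x (t : R) : contract x @ t --> contract x t.
Proof.
have [n xn] := sphere_supported x; move=> U /(contract_nbhs xn)[A nA [d d0 H]].
apply/nbhs_ballP; exists d => // u tu; apply: H => //; exact: nbhs_singleton nA.
Qed.

Lemma sphere_locally_constant (T : Type) (g : S -> T) :
  (forall x, exists2 U : set S, nbhs x U & forall y, U y -> g y = g x) ->
  forall x y, g x = g y.
Proof.
move=> loc; suff H x : g x = g basepoint by move=> x y; rewrite !H.
rewrite -(contract1 x).
apply: (@interval_induction R 0 1 (fun t => g (contract x t) = g basepoint)) => //; last first.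
  by rewrite contract0.
move=> t t01; have [U nU gU] := loc (contract x t).
have /nbhs_ballP[d /= d0 dU] := contract_path nU.
by exists d => // t1 t2 _ _ tt1 tt2; rewrite (gU _ (dU _ tt1)) (gU _ (dU _ tt2)).
Qed.

(** The sphere being contractible, the value of a primitive at [x] is found by lifting [c] along the
    path from the base point to [x]. Comparing neighbouring paths gives the relation within each
    skeleton, and [sphere_open_skeleton] turns this into a neighbourhood in the sphere. *)
Lemma sphere_H1_trivial (c : S -> S -> 'F_2) :
  (forall x : S, exists2 U : set S, nbhs x U & cocyc_set c U) ->
  exists b : S -> 'F_2, forall x : S, exists2 U : set S, nbhs x U &
    forall y w, U y -> U w -> c y w = b y + b w.
Proof.
move=> cloc.
have gc x (t : R) : 0 <= t <= 1 -> contract x @ t --> contract x t by move=> _; exact: contract_path.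
have /choice[beta betaP] := fun x => lifts_path_exists cloc (gc x).
pose b x := beta x 1.
have slice n (x : S) : supported n x ->
    \forall y \near x, supported n (y : S) -> c x y = b x + b y.
  move=> xn.
  (* Interval induction on the contraction parameter; the neighbourhood of [x] may shrink at each
     step, but there are finitely many in effect. *)
  pose P (t : R) := \forall y \near x, supported n (y : S) ->
    c (contract x t) (contract y t) = beta x t + beta y t.
  suff : P 1 by apply: filterS => y; rewrite !contract1.
  apply: (@interval_induction R 0 1 P) => //; last first.
    rewrite /P; near=> y => _; rewrite !contract0 !(betaP _).1 addr0.
    by have [U nU cU] := cloc basepoint; exact: cocyc_set_refl cU (nbhs_singleton nU).
  move=> t t01; have [U nU cU] := cloc (contract x t).
  have [A nA [d d0 AU]] := contract_nbhs xn nU.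
  exists d => // t1 t2 /andP[t10 t11] /andP[t20 t21] tt1 tt2 Pt1.
  have seg (y : S) : supported n y -> A y ->
      c (contract y t1) (contract y t2) = beta y t1 + beta y t2.
    move=> yn Ay; have Uy (u : R) : `|t - u| < d -> U (contract y u) by exact: AU.
    have mid (u v w : R) : `|t - u| < d -> `|t - v| < d -> u <= w <= v -> `|t - w| < d.
      rewrite !ltr_norml => /andP[? ?] /andP[? ?] /andP[? ?]; apply/andP; split; lra.
    have [t12|/ltW t21'] := leP t1 t2.
      apply: (lifts_path_segment (betaP y) cU) => // u u12; apply: Uy.
      exact: (mid t1 t2).
    rewrite (cocyc_set_sym cU (Uy _ tt1) (Uy _ tt2)) [RHS]addrC.
    apply: (lifts_path_segment (betaP y) cU) => // u u12; apply: Uy.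
    exact: (mid t2 t1).
  near=> y => yn.
  have Ay : A y by near: y.
  have Ax : A x by exact: nbhs_singleton nA.
  have E : c (contract x t1) (contract y t1) = beta x t1 + beta y t1.
    by move: yn; near: y.
  have Ux (u : R) : `|t - u| < d -> U (contract x u) by exact: AU.
  have Uy (u : R) : `|t - u| < d -> U (contract y u) by exact: AU.
  rewrite (cocyc_set_trans cU (Ux _ tt2) (Ux _ tt1) (Uy _ tt2)).
  rewrite (cocyc_set_trans cU (Ux _ tt1) (Uy _ tt1) (Uy _ tt2)).
  rewrite E (seg y yn Ay) (cocyc_set_sym cU (Ux _ tt2) (Ux _ tt1)) (seg x xn Ax).
  by apply: (@F2_eq_mod2 (beta x t1 + beta y t1)); ring.
exists b => z; have [U nU cU] := cloc z.
have := nU; rewrite {1}nbhsE => -[Q [oQ Qz] QU].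
(* Openness can be tested skeleton by skeleton, where [slice] applies around each point of [V]. *)
pose V := [set y | Q y /\ c z y = b z + b y].
have oV : open V.
  apply: sphere_open_skeleton => n y yn [Qy cy].
  have nO : nbhs y Q by apply: open_nbhs_nbhs; split.
  have := slice n y yn; apply: filterS2 nO => w Qw H wn; split => //.
  rewrite (cocyc_set_trans cU (QU _ Qz) (QU _ Qy) (QU _ Qw)) cy (H wn).
  by apply: (@F2_eq_mod2 (b y)); ring.
have Vz : V z by split => //; rewrite F2_add (cocyc_set_refl cU (QU z Qz)).
exists V; first by apply: open_nbhs_nbhs; split.
move=> y w [Qy Ey] [Qw Ew].
rewrite (cocyc_set_trans cU (QU _ Qy) (QU _ Qz) (QU _ Qw)) Ew
  (cocyc_set_sym cU (QU _ Qy) (QU _ Qz)) Ey.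
by apply: (@F2_eq_mod2 (b z)); ring.
Unshelve. all: by end_near. Qed.

End SphereTopology.

(** * Cohomology of the infinite projective space *)

Section TupleLists.
Context {X : eqType}.

Definition lst n (t : 'I_n -> X) : seq X := [seq t i | i <- enum 'I_n].

Lemma lst_cons n (t : 'I_n.+1 -> X) : lst t = t ord0 :: lst (fun j => t (lift ord0 j)).
Proof. by rewrite /lst enum_ordSl /= -map_comp. Qed.

Lemma size_lst n (t : 'I_n -> X) : size (lst t) = n.
Proof. by rewrite size_map size_enum_ord. Qed.

Lemma nth_lst n (t : 'I_n -> X) x0 (i : 'I_n) : nth x0 (lst t) i = t i.
Proof. by rewrite (nth_map i) ?size_enum_ord// nth_ord_enum. Qed.

Lemma lst_nth n x0 s : size s = n -> lst (fun i : 'I_n => nth x0 s i) = s.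
Proof.
move=> sn; apply: (@eq_from_nth _ x0); rewrite size_lst// => i ni.
by rewrite (nth_lst _ _ (Ordinal ni)).
Qed.

Lemma mem_lst n (t : 'I_n -> X) x : x \in lst t -> exists i, x = t i.
Proof. by move=> /mapP[i _ ->]; exists i. Qed.

Lemma ldiff_lst n (C : seq X -> 'F_2) (t : 'I_n.+1 -> X) :
  ldiff C (lst t) = \sum_(i < n.+1) C (lst (fun j : 'I_n => t (lift i j))).
Proof.
elim: n C t => [|n IH] C t; rewrite lst_cons /=.
  by rewrite big_ord1 (_ : lst _ = [::]) ?addr0//; apply/eqP; rewrite -size_eq0 size_lst.
rewrite IH [RHS]big_ord_recl; congr (_ + _); apply: eq_bigr => i _.
rewrite [in RHS]lst_cons; congr (C (_ :: _)); first by congr t; exact/val_inj.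
by congr lst; apply/funext => j; congr t; apply/val_inj; rewrite /= /bump !leq0n !add1n addnS.
Qed.

End TupleLists.

Lemma ldiff_map (X Y : eqType) (phi : X -> Y) c s :
  ldiff (fun t => c (map phi t)) s = ldiff c (map phi s).
Proof. by elim: s c => //= x s IH c; rewrite (IH (fun t => c (phi x :: t))). Qed.

Lemma prodl_map (X Y : eqType) (phi : X -> Y) w m s :
  prodl (nseq m w) (map phi s) = prodl (nseq m (fun x y => w (phi x) (phi y))) s.
Proof. by elim: m s => // m IH [|x [|y s]]//=; rewrite -IH. Qed.

Lemma prodl_nseq_ext (X : eqType) (w w' : X -> X -> 'F_2) m s :
  {in s &, forall x y, w x y = w' x y} -> prodl (nseq m w) s = prodl (nseq m w') s.
Proof.
elim: m s => // m IH [|x [|y s]] E //=.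
rewrite E ?inE ?eqxx ?orbT//; congr (_ * _); apply: IH => u v us vs.
by apply: E; rewrite inE ?us ?vs orbT.
Qed.

Section CochainLists.
Context {X : topologicalType}.

Definition bin (w : cochain X 1) (x y : X) : 'F_2 := w (fun i => if i == ord0 then x else y).

Lemma binE (w : cochain X 1) t : w t = bin w (t ord0) (t ord_max).
Proof.
congr w; apply/funext => i; case: eqP => [->//|].
by case: i => -[|[|//]] ? h; [case: h|]; try congr t; apply/val_inj.
Qed.

Lemma as_diff_lst n (c : cochain X n) x0 t :
  as_diff c t = ldiff (fun s => c (fun i => nth x0 s i)) (lst t).
Proof.
rewrite ldiff_lst; apply: eq_bigr => i _; congr c.
by apply/funext => j; rewrite nth_lst.
Qed.

Lemma as_diff0 (c : cochain X 0) t :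
  as_diff c t = c (fun=> t ord0) + c (fun=> t ord_max).
Proof.
rewrite (as_diff_lst c (t ord0)) ldiff_lst big_ord_recl big_ord1 addrC.
by congr (c _ + c _); apply/funext => i; rewrite nth_lst; congr t; apply/val_inj;
  rewrite /= (ord1 i).
Qed.

Lemma as_diff1 (c : cochain X 1) x y z :
  as_diff c (fun i : 'I_3 => nth x [:: x; y; z] i) = bin c y z + bin c x z + bin c x y.
Proof.
rewrite /as_diff big_ord_recl big_ord_recl big_ord1 addrA.
by rewrite !binE.
Qed.

Lemma cup_expE (w : cochain X 1) m t :
  cup_exp w m t = prodl (nseq m (bin w)) (lst t).
Proof.
elim: m t => // m IH t; pose u j := t (lift ord0 j).
have -> : prodl (nseq m.+1 (bin w)) (lst t) =
    bin w (t ord0) (u ord0) * prodl (nseq m (bin w)) (lst u).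
  by rewrite lst_cons -/u (lst_cons u).
rewrite -IH /= /cup binE; congr (bin w (t _) (t _) * cup_exp w m _).
- by apply/val_inj; rewrite /= inordK.
- by apply/val_inj; rewrite /= inordK.
- by apply/funext => j; congr t; apply/val_inj; rewrite /= inordK ?add1n// ltnS.
Qed.

End CochainLists.

(** * Cochains of an antipodal quotient *)

Section OrbitQuotient.
Context {V : zmodType} {T : topologicalType} (v : T -> V).
Local Notation Q := (antipodal_quotient v).
Local Notation proj := (antipodal_proj v).

Lemma antipodal_projP x y : proj x = proj y <-> v x = v y \/ v x = - v y.
Proof.
rewrite /antipodal_proj; split.
  by move/eqmodP => /orP[/eqP->|/eqP->]; [left|right].
by move=> [E|E]; apply/eqmodP; rewrite /= E eqxx ?orbT.
Qed.

Lemma antipodal_proj_repr (q : Q) : proj (repr q) = q.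
Proof. by rewrite /antipodal_proj reprK. Qed.

Lemma antipodal_proj_continuous : continuous proj.
Proof. exact: pi_continuous. Qed.

Variable opp : T -> T.
Hypotheses (v_inj : injective v) (oppE : forall x, v (opp x) = - v x)
  (opp_cont : continuous opp).

Lemma antipodal_proj_open (U : set T) : open U -> open (proj @` U : set Q).
Proof.
move=> oU; suff : open (proj @^-1` (proj @` U)) by [].
rewrite (_ : _ @^-1` _ = U `|` opp @^-1` U).
  by apply: openU => //; apply: open_comp => // x _; exact: opp_cont.
apply/seteqP; split => x /=.
  move=> [y Uy /antipodal_projP[/v_inj <-|E]]; first by left.
  by right; rewrite (_ : opp x = y)//; apply: v_inj; rewrite oppE -E.
move=> [Ux|Ux]; first by exists x.
by exists (opp x) => //; apply/antipodal_projP; right; rewrite oppE.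
Qed.

(** The projection is continuous, open and onto, so neighbourhoods and tuples of the quotient may be
    replaced by ones upstairs. *)
Lemma locally_zeroP n (c : cochain Q n) :
  locally_zero c <-> forall z : T, exists2 U : set T, nbhs z U &
    forall t : 'I_n.+1 -> T, (forall i, U (t i)) -> c (proj \o t) = 0.
Proof.
split=> [c0 z|H q].
  have [U [oU Uz cU]] := c0 (proj z); exists (proj @^-1` U).
    by apply: antipodal_proj_continuous; exact: open_nbhs_nbhs.
  by move=> t Ut; apply: cU.
have [U + cU] := H (repr q); rewrite nbhsE => -[U' [oU' U'z] U'U].
exists (proj @` U'); split; first exact: antipodal_proj_open.
  by exists (repr q) => //; exact: antipodal_proj_repr.
move=> t Ut; have /choice[t' t'P] : forall i, exists y, U' y /\ proj y = t i.
  by move=> i; have [y] := Ut i; exists y.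
rewrite (_ : t = proj \o t'); last by apply/funext => i /=; rewrite (t'P i).2.
by apply: cU => i; apply: U'U; exact: (t'P i).1.
Qed.

(** [eps] tells the two sheets apart. The second relation is necessarily local: for [x] and its
    antipode the left-hand side is 0, both having the same projection, and the right-hand side is
    1. *)
Definition sheeted (w : Q -> Q -> 'F_2) (eps : T -> 'F_2) : Prop :=
  (forall x y, v y = - v x -> eps y = eps x + 1) /\
  forall z : T, exists2 U : set T, nbhs z U &
    forall x y, U x -> U y -> w (proj x) (proj y) = eps x + eps y.

End OrbitQuotient.

Section ProjectiveSpace.
Context {R : realType}.
Local Notation S := (infinite_sphere R).
Local Notation P := (infinite_projective_space R).
Local Notation proj := (antipodal_proj (@sphere_val R)).

Lemma sphere_val_inj : injective (@sphere_val R).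
Proof. exact: val_inj. Qed.

Let oppE (x : S) : sphere_val (sphere_opp x) = - sphere_val x. Proof. by []. Qed.

Let locally_zero_sphere n (c : cochain P n) :=
  @locally_zeroP _ _ (@sphere_val R) _ sphere_val_inj oppE sphere_opp_continuous n c.

Definition flip (x : S) : 'F_2 := if repr (proj x) == x then 0 else 1.

(** Two lines are compared through their chosen representatives, according to the sign of the scalar
    product. This is local constancy in disguise: the discontinuity of the choice is that of
    [flip]. *)
Definition sphere_cocycle (p p' : P) : 'F_2 :=
  if 0 < dot (sphere_val (repr p)) (sphere_val (repr p')) then 0 else 1.

Lemma repr_proj (x : S) :
  repr (proj x) = x /\ flip x = 0 \/
  sphere_val (repr (proj x)) = - sphere_val x /\ flip x = 1.
Proof.
have /antipodal_projP := antipodal_proj_repr (v := @sphere_val R) (proj x).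
rewrite /flip; case: eqP => [-> _|E [/sphere_val_inj//|E']]; first by left.
by right.
Qed.

Lemma sphere_neq_opp (x : S) : sphere_val x <> - sphere_val x.
Proof.
move=> E; have [i /eqP] := sphere_neq0 x; apply.
by have := congr1 (fun f => f i) E; rewrite fctE => ?; lra.
Qed.

Lemma flip_opp (x y : S) : sphere_val y = - sphere_val x -> flip y = flip x + 1.
Proof.
move=> yx; have E : proj x = proj y by apply/antipodal_projP; right; rewrite yx opprK.
case: (repr_proj x) (repr_proj y) => [[+ ->]|[+ ->]] [[+ ->]|[+ ->]];
  rewrite -?E ?add0r ?F2_add// => Ex Ey.
- by case: (@sphere_neq_opp x); rewrite -yx; exact: (congr1 _ (etrans (esym Ex) Ey)).
- case: (@sphere_neq_opp x); rewrite -yx; apply: oppr_inj.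
  exact: (etrans (esym Ex) Ey).
Qed.

Lemma sphere_cocycleE (x y : S) : 0 < dot (sphere_val x) (sphere_val y) ->
  sphere_cocycle (proj x) (proj y) = flip x + flip y.
Proof.
move=> xy; have [n xn] := sphere_supported x; have [m ym] := sphere_supported y.
have xNn : supported n (- sphere_val x) by move=> i ni; rewrite fctE xn ?oppr0.
have yNm : supported m (- sphere_val y) by move=> i ni; rewrite fctE ym ?oppr0.
rewrite /sphere_cocycle; have [[-> ->]|[-> ->]] := repr_proj x;
  have [[-> ->]|[-> ->]] := repr_proj y.
- by rewrite xy addr0.
- by rewrite dotC (dotN _ ym) dotC oppr_gt0 ltNge ltW// add0r.
- by rewrite (dotN _ xn) oppr_gt0 ltNge ltW// addr0.
- by rewrite (dotN _ xn) dotC (dotN _ ym) opprK dotC xy F2_add.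
Qed.

(** From 0 <= |x + y - 2z|^2 = 6 + 2 x.y - 4 z.x - 4 z.y; with both z.x and z.y above 3/4 this
    forces x.y > 0. *)
Lemma dot_gt0_near (x y z : S) :
  3 / 4 < dot (sphere_val z) (sphere_val x) -> 3 / 4 < dot (sphere_val z) (sphere_val y) ->
  0 < dot (sphere_val x) (sphere_val y).
Proof.
have [nx xn] := sphere_supported x; have [ny yn] := sphere_supported y.
have [nz zn] := sphere_supported z.
set n := maxn nx (maxn ny nz).
have {}xn : supported n x by apply: supportedW xn; rewrite leq_maxl.
have {}yn : supported n y by apply: supportedW yn; rewrite leq_max leq_maxl orbT.
have {}zn : supported n z by apply: supportedW zn; rewrite leq_max leq_maxr orbT.
have : 0 <= \sum_(i < n.+1) (sphere_val x i + sphere_val y i - 2 * sphere_val z i) ^+ 2.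
  by apply: sumr_ge0 => i _; exact: sqr_ge0.
have -> : \sum_(i < n.+1) (sphere_val x i + sphere_val y i - 2 * sphere_val z i) ^+ 2 =
  dot x x + dot y y + 4 * dot z z + 2 * dot x y - 4 * dot z x - 4 * dot z y.
  rewrite !(dotE _ xn) !(dotE _ yn) !(dotE _ zn) !mulr_sumr -!sumrN -!big_split /=.
  by apply: eq_bigr => i _; ring.
rewrite !sphere_dot1; lra.
Qed.

Lemma sphere_cocycle_sheeted : sheeted sphere_cocycle flip.
Proof.
split; first exact: flip_opp.
move=> z; have [n zn] := sphere_supported z.
exists [set x : S | 3 / 4 < dot (sphere_val z) (sphere_val x)]; last first.
  by move=> x y zx zy; apply: sphere_cocycleE; exact: dot_gt0_near zx zy.
have : dot (sphere_val z) (sphere_val x) @[x --> z] --> dot (sphere_val z) (sphere_val z).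
  rewrite (dotE _ zn); under eq_fun do rewrite (dotE _ zn).
  apply: (@cvg_big _ _ _ _ _ add_continuous _ (nbhs z) _ _ _ (nbhs_filter z)) => i _.
  by apply: cvgM; [exact: cvg_cst|exact: sphere_coord_continuous].
rewrite sphere_dot1 => /(@cvgr_gt _ _ _ _ _ 1)/(_ (3 / 4)); apply; lra.
Qed.

Definition projective_cochain : cochain P 1 := fun t => sphere_cocycle (t ord0) (t ord_max).

Lemma bin_projective_cochain : bin projective_cochain = sphere_cocycle.
Proof. by apply/funext => x; apply/funext => y; rewrite /bin /projective_cochain /=. Qed.

Lemma projective_cochain_cocycle : as_cocycle projective_cochain.
Proof.
apply/locally_zero_sphere => z.
have [U nU wU] := (sphere_cocycle_sheeted).2 z; exists U => // t Ut.
have -> : proj \o t = fun i => nth (proj (t 0)) [:: proj (t 0); proj (t 1); proj (t (1 + 1))] i.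
  by apply/funext => -[[|[|[|//]]] h] /=; congr (proj (t _)); exact/val_inj.
rewrite as_diff1 bin_projective_cochain !wU//.
by apply: (@F2_eq_mod2 (flip (t 0) + flip (t 1) + flip (t (1 + 1)))); ring.
Qed.

(** A primitive on the quotient added to [flip] would be locally constant, hence constant on the
    connected sphere, although it changes by 1 between antipodes. *)
Lemma projective_cochain_not_coboundary : ~ as_coboundary projective_cochain.
Proof.
move=> [b /locally_zero_sphere Hb].
pose g (x : S) := flip x + b (fun=> proj x).
have gconst : forall x y, g x = g y.
  apply: sphere_locally_constant => z.
  have [U nU wU] := (sphere_cocycle_sheeted).2 z; have [U' nU' bU'] := Hb z.
  exists (U `&` U'); first exact: filterI.
  move=> y [Uy U'y]; have Uz := nbhs_singleton nU; have U'z := nbhs_singleton nU'.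
  have := bU' (fun i => if i == ord0 then y else z).
  move=> /(_ _)/wrap[]; first by move=> i; case: ifP.
  rewrite as_diff0 binE /= bin_projective_cochain wU// F2_sub /g.
  move=> h; apply/eqP; rewrite -subr_eq0 F2_sub; apply/eqP; rewrite -[RHS]h.
  by ring.
have E : proj basepoint = proj (sphere_opp basepoint).
  by apply/antipodal_projP; right; rewrite opprK.
have := gconst basepoint (sphere_opp basepoint).
rewrite /g -E (@flip_opp basepoint (sphere_opp basepoint))// => /addIr/eqP.
by rewrite -subr_eq0 opprD addrA subrr sub0r oppr_eq0 oner_eq0.
Qed.

(** Upstairs [c] has a primitive [b]. As [c] comes from the quotient, [b x + b (- x)] is locally
    constant, hence constant; this constant is the coefficient of the generator, for [b] plus that
    multiple of [flip] descends to the quotient. *)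
Lemma generates_projective_cochain : generates_H1 projective_cochain.
Proof.
split; [exact: projective_cochain_cocycle|exact: projective_cochain_not_coboundary|].
move=> c /locally_zero_sphere cc.
pose cS (x y : S) := bin c (proj x) (proj y).
have [|b bE] := @sphere_H1_trivial R cS.
  move=> z; have [U nU cU] := cc z; exists U => // x y w Ux Uy Uw.
  have := cU (fun i : 'I_3 => nth x [:: x; y; w] i).
  move=> /(_ _)/wrap[]; first by case=> -[|[|[|//]]].
  rewrite (_ : _ \o _ = fun i : 'I_3 => nth (proj x) [:: proj x; proj y; proj w] i).
    by rewrite as_diff1.
  by apply/funext => -[[|[|[|//]]] h].
have projN x : proj (sphere_opp x) = proj x.
  by apply/antipodal_projP; right.
pose g x := b x + b (sphere_opp x).
have gconst : forall x y, g x = g y.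
  apply: sphere_locally_constant => z.
  have [U nU bU] := bE z; have [U' nU' bU'] := bE (sphere_opp z).
  exists (U `&` sphere_opp @^-1` U').
    by apply: filterI => //; exact: sphere_opp_continuous.
  move=> y [Uy U'y]; have Uz := nbhs_singleton nU; have U'z := nbhs_singleton nU'.
  have := bU' _ _ U'y U'z; rewrite /cS !projN -/(cS y z) (bU _ _ Uy Uz) => h.
  apply/eqP; rewrite -subr_eq0 F2_sub /g addrACA h; apply/eqP.
  by apply: (@F2_eq_mod2 (b (sphere_opp y) + b (sphere_opp z))); ring.
exists (g basepoint).
pose d (p : P) : 'F_2 := b (repr p) + g basepoint * flip (repr p).
have dE x : d (proj x) = b x + g basepoint * flip x.
  rewrite /d; have [[->]//|[E fx]] := repr_proj x.
  have -> : repr (proj x) = sphere_opp x by apply: sphere_val_inj; rewrite E.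
  rewrite (@flip_opp x (sphere_opp x))// fx F2_add mulr0 addr0 mulr1 (gconst _ x) /g.
  by rewrite addrA F2_add add0r.
exists (fun t => d (t ord0)); apply/locally_zero_sphere => z.
have [U nU bU] := bE z; have [U' nU' wU'] := (sphere_cocycle_sheeted).2 z.
exists (U `&` U'); first exact: filterI.
move=> t Ut; have [U0 U'0] := Ut ord0; have [U1 U'1] := Ut ord_max.
rewrite as_diff0 !binE /= bin_projective_cochain wU'// -/(cS (t ord0) (t ord_max)) bU//.
rewrite !dE !F2_sub.
apply: (@F2_eq_mod2 (b (t ord0) + b (t ord_max) + g basepoint * (flip (t ord0) + flip (t ord_max)))).
by ring.
Qed.

(* Two generators differ by a coboundary, so that the pull-back of any of them
   has a primitive that changes sign under the antipodal map. *)
Lemma generator_sheeted (w : cochain P 1) : generates_H1 w ->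
  exists eps : S -> 'F_2, sheeted (bin w) eps.
Proof.
move=> [wc wn wg].
have [a [b /locally_zero_sphere Hb]] := wg _ projective_cochain_cocycle.
have a1 : a = 1.
  case: (eqVneq a 1) => // a1; have a0 : a = 0.
    by move: a1; case: a {Hb} => -[|[|//]] i; [move=> _; exact/val_inj|case/eqP; exact/val_inj].
  exfalso; apply: projective_cochain_not_coboundary; exists b; apply/locally_zero_sphere => z.
  have [U nU HU] := Hb z; exists U => // t Ut; rewrite -[RHS](HU t Ut).
  by rewrite a0 mul0r subr0.
exists (fun x => flip x + b (fun=> proj x)); split.
  move=> x y yx; rewrite (flip_opp yx).
  have -> : proj y = proj x by apply/antipodal_projP; right.
  ring.
move=> z; have [U nU HU] := Hb z; have [U' nU' wU'] := (sphere_cocycle_sheeted).2 z.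
exists (U `&` U'); first exact: filterI.
move=> x y [Ux U'x] [Uy U'y].
have := HU (fun i => if i == ord0 then x else y).
move=> /(_ _)/wrap[]; first by move=> i; case: ifP.
rewrite as_diff0 !binE /= bin_projective_cochain wU'// a1 mul1r !F2_sub => h.
rewrite -[LHS]addr0 -h.
by apply: (@F2_eq_mod2 (bin w (proj x) (proj y))); ring.
Qed.

End ProjectiveSpace.

(** * Powers of the class of a double cover *)

Lemma prodl_zero (X : eqType) (l : seq (X -> X -> 'F_2)) w s : List.In w l ->
  {in s &, forall x y, w x y = 0} -> size s = (size l).+1 -> prodl l s = 0.
Proof.
elim: l s => //= w' l IH [//|x [//|y s]] wl w0 [ss] /=.
case: wl => [->|wl]; first by rewrite w0 ?mul0r// !inE eqxx ?orbT.
rewrite -/(prodl l (y :: s)) IH ?mulr0//= ?ss// => u v us vs.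
by apply: w0; rewrite inE ?us ?vs orbT.
Qed.

Lemma cocycle_on_coboundary (X : eqType) (w : X -> X -> 'F_2) a s :
  {in s &, forall x y, w x y = coboundary1 a x y} -> cocycle_on w s.
Proof.
by move=> E x y z xs ys zs; rewrite /cocyc3 !E//; exact: cocyc3_coboundary1.
Qed.

Section OddPrimitive.
Context {R : realType} {W : normedModType R}.
Implicit Types (M : set W) (eps : W -> 'F_2).

Definition flips M : rel W := fun x y => `[< [/\ M x, M y & x = y \/ x = - y] >].

Definition odd_on M eps := forall x, M x -> eps (- x) = eps x + 1.

(* The m-th power of the class of the double cover of M / {+1, -1} vanishes; cochains
   of the quotient are represented by sign invariant cochains on lists of points of M. *)
Definition power_trivial M eps m := exists b : seq W -> 'F_2,
  [/\ b [::] = 0, linvariant (flips M) b &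
   forall z, M z -> exists2 rho : R, 0 < rho & forall s, size s = m.+1 ->
     {in s, forall x, M x /\ `|z - x| < rho} ->
     prodl (nseq m (coboundary1 eps)) s = ldiff b s].

Lemma all2_map2 (X : eqType) (r : rel W) (p p' : X -> W) s :
  (forall x, x \in s -> r (p x) (p' x)) -> all2 r (map p s) (map p' s).
Proof.
elim: s => //= x s IH H; rewrite H ?inE ?eqxx//=; apply: IH => y ys.
by apply: H; rewrite inE ys orbT.
Qed.

(** [choose] selects the same element of the pair x, -x whichever of the two it starts from. *)
Lemma exists_odd : exists eps, forall x : W, x != 0 -> eps (- x) = eps x + 1.
Proof.
exists (fun x => if choose (pred2 x (- x)) x == x then 0 else 1) => x x0.
have xN : x != - x.
  apply: contra x0 => /eqP E.
  have /eqP : (2 : R) *: x = 0 by rewrite scaler_nat mulr2n {1}E addNr.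
  by rewrite scaler_eq0 pnatr_eq0.
have E : choose (pred2 (- x) (- - x)) (- x) = choose (pred2 x (- x)) x.
  have e : pred2 (- x) (- - x) =1 pred2 x (- x) by move=> y /=; rewrite opprK orbC.
  by rewrite (eq_choose e) (@choose_id _ _ (- x) x)//= ?eqxx ?orbT.
rewrite {}E; have /= /orP[/eqP->|/eqP->] := @chooseP _ (pred2 x (- x)) x (predU1l _ erefl).
  by rewrite eqxx (negbTE xN) add0r.
by rewrite eqxx eq_sym (negbTE xN) F2_add.
Qed.

(** The coboundary of [eps] is invariant only under simultaneous sign changes. Replacing [y] by
    whichever of [y] and [- y] is nearer to [x] makes it invariant under independent ones; the value
    0 in case of a tie preserves this. *)
Definition sign_cocycle eps (x y : W) : 'F_2 :=
  if `|x - y| < `|x + y| then eps x + eps y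
  else if `|x + y| < `|x - y| then eps x + eps y + 1 else 0.

Lemma sign_cocycleC eps x y : sign_cocycle eps x y = sign_cocycle eps y x.
Proof. by rewrite /sign_cocycle distrC [y + x]addrC [eps y + _]addrC. Qed.

Lemma sign_cocycleN M eps x y : odd_on M eps -> M x ->
  sign_cocycle eps (- x) y = sign_cocycle eps x y.
Proof.
move=> oe Mx; rewrite /sign_cocycle oe//.
have -> : `|- x - y| = `|x + y| by rewrite -opprD normrN.
have -> : `|- x + y| = `|x - y| by rewrite -normrN opprD opprK.
case: (ltgtP `|x - y| `|x + y|) => // _.
  by apply: (@F2_eq_mod2 1); ring.
ring.
Qed.

Lemma sign_cocycle_invariant M eps : odd_on M eps ->
  invariant2 (flips M) (sign_cocycle eps).
Proof.
move=> oe x x' y y' /asboolP[Mx Mx' xx'] /asboolP[My My' yy'].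
have -> : sign_cocycle eps x y = sign_cocycle eps x' y.
  by case: xx' => ->//; rewrite (sign_cocycleN _ oe).
rewrite ![sign_cocycle eps x' _]sign_cocycleC.
by case: yy' => ->//; rewrite (sign_cocycleN _ oe).
Qed.

(** Two points within half the norm of [z] from [z] are closer to each other than to each other's
    antipode: [|x - y| < |z| < |x + y|]. *)
Lemma sign_cocycleE eps (x y z : W) : `|z - x| < `|z| / 2 -> `|z - y| < `|z| / 2 ->
  sign_cocycle eps x y = coboundary1 eps x y.
Proof.
move=> zx zy; rewrite /sign_cocycle ifT//.
have h1 : `|x - y| < `|z|.
  rewrite (_ : x - y = (z - y) - (z - x)); last by rewrite opprB [RHS]addrC addrA subrK.
  by rewrite (le_lt_trans (ler_normB _ _))// [ltRHS](splitr) ltrD.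
apply: (lt_trans h1).
have h2 : `|z + z| <= `|x + y| + (`|z - x| + `|z - y|).
  rewrite (_ : z + z = (x + y) + ((z - x) + (z - y))); last first.
    by rewrite [in RHS]addrACA !subrKC.
  by rewrite (le_trans (ler_normD _ _))// lerD2l ler_normD.
have h3 : `|z + z| = `|z| + `|z| by rewrite -mulr2n normrMn mulr2n.
by rewrite h3 in h2; lra.
Qed.

(** The sum of two odd functions is invariant, so their sign cocycles differ by the coboundary of an
    invariant function, and [transfer] corrects the primitive. *)
Lemma power_trivial_change M eps eps' m : ~ M 0 -> odd_on M eps -> odd_on M eps' ->
  power_trivial M eps m -> power_trivial M eps' m.
Proof.
move=> M0 oe oe' [b [b0 bM Hb]].
pose e x := eps x + eps' x.
pose l : seq (triple (X := W)) := nseq m (sign_cocycle eps', sign_cocycle eps, e).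
have l1 : [seq p.1.1 | p <- l] = nseq m (sign_cocycle eps') by rewrite map_nseq.
have l2 : [seq p.1.2 | p <- l] = nseq m (sign_cocycle eps) by rewrite map_nseq.
exists (fun s => b s + transfer l s); split.
- by rewrite b0 transfer_nil addr0.
- move=> s t st; rewrite (bM _ _ st); congr (_ + _).
  apply: (@transfer_invariant _ (flips M)) => // a al; rewrite (In_nseq al); split.
  + exact: sign_cocycle_invariant.
  + exact: sign_cocycle_invariant.
  + move=> x y /asboolP[Mx My [->//|->]]; rewrite /= /e oe// oe'//.
    by apply: (@F2_eq_mod2 1); ring.
move=> z Mz; have [rho r0 Hs] := Hb z Mz.
have z0 : 0 < `|z| / 2 by rewrite divr_gt0// normr_gt0; apply/eqP => z0; apply: M0; rewrite -z0.
exists (Num.min rho (`|z| / 2)); first by rewrite lt_min r0.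
move=> s ss sM.
have sz : {in s, forall x, `|z - x| < `|z| / 2}.
  by move=> x /sM[_]; rewrite lt_min => /andP[].
have E a : {in s &, forall x y, sign_cocycle a x y = coboundary1 a x y}.
  by move=> x y xs ys; apply: sign_cocycleE (sz x xs) (sz y ys).
rewrite ldiffD -Hs//; last by move=> x /sM[Mx]; rewrite lt_min => /andP[].
rewrite -(prodl_nseq_ext _ (E eps)) -(prodl_nseq_ext _ (E eps')).
rewrite -l1 -l2; apply: prodl_transfer; last by rewrite size_nseq.
move=> a al; rewrite (In_nseq al) /=; split; try exact: cocycle_on_coboundary (E _).
move=> x y xs ys; rewrite !E// /coboundary1 /e.
by apply/esym; apply: (@F2_eq_mod2 (eps x + eps y)); ring.
Qed.

Definition cont_on M (phi : W -> W) := forall z, M z -> forall e : R, 0 < e ->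
  exists2 d : R, 0 < d & forall x, M x -> `|z - x| < d -> `|phi z - phi x| < e.

(** Pulling back along [phi] gives the odd function [eps \o phi] instead of [eps], whence the
    recourse to [power_trivial_change]. *)
Lemma power_trivial_comp M M' eps (phi : W -> W) m : ~ M 0 -> ~ M' 0 ->
  odd_on M eps -> odd_on M' eps -> (forall x, M x -> M' (phi x)) ->
  (forall x, M x -> phi (- x) = - phi x) -> cont_on M phi ->
  power_trivial M' eps m -> power_trivial M eps m.
Proof.
move=> M0 M'0 oe oe' MM' phiN phiC [b [b0 bM Hb]].
apply: (@power_trivial_change M (eps \o phi)) => //.
  by move=> x Mx /=; rewrite phiN// oe'//; exact: MM'.
exists (b \o map phi); split => //.
  move=> s t st; apply: bM; elim: s t st => [|x s IH] [|y t]//= /andP[xy st].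
  rewrite IH// andbT; apply/asboolP; move: xy => /asboolP[Mx My xy].
  by split; [exact: MM'|exact: MM'|case: xy => ->; [left|right; exact: phiN]].
move=> z Mz; have [rho r0 Hs] := Hb _ (MM' _ Mz).
have [d d0 Hd] := phiC z Mz rho r0; exists d => // s ss sM.
rewrite (ldiff_map phi b) -Hs ?size_map//; first by rewrite prodl_map.
by move=> _ /mapP[x /sM[Mx zx] ->]; split; [exact: MM'|exact: Hd].
Qed.

(** A Lusternik-Schnirelmann argument: where [phi] does not vanish, its sign trivialises the double
    cover. One factor [w] is replaced for each [phi] by the cohomologous [wp phi], which vanishes
    near such points; as these sets cover [M], the new product is locally zero. *)
Lemma power_trivial_cover M eps (phis : seq (W -> R)) m : ~ M 0 -> odd_on M eps ->
  (size phis <= m)%N ->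
  (forall phi, List.In phi phis -> forall z : W, M z -> phi (- z) = - phi z /\ phi @ z --> phi z) ->
  (forall z, M z -> exists2 phi, List.In phi phis & phi z != 0) ->
  power_trivial M eps m.
Proof.
move=> M0 oe pm Hphi cov.
pose w := sign_cocycle eps.
(* [eps] corrected by the sign of [phi]: both change under the antipodal map, so the sum is
   invariant. *)
pose e (phi : W -> R) x : 'F_2 :=
  if phi x == 0 then 0 else eps x + (if 0 < phi x then 0 else 1).
pose wp phi x y := w x y + (e phi x + e phi y).
pose l : seq (triple (X := W)) :=
  [seq (w, wp phi, e phi) | phi <- phis] ++ nseq (m - size phis) (w, w, fun=> 0).
have sl : size l = m by rewrite size_cat size_map size_nseq subnKC.
have l1 : [seq p.1.1 | p <- l] = nseq m w.
  rewrite map_cat -map_comp map_nseq /=.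
  have -> : map ((fun p : triple => p.1.1) \o (fun phi => (w, wp phi, e phi))) phis =
      nseq (size phis) w by elim: (phis) => //= phi r ->.
  by rewrite -nseqD subnKC.
have inl a : List.In a l -> (exists2 phi, List.In phi phis & a = (w, wp phi, e phi)) \/ a = (w, w, fun=> 0).
  move=> /(List.in_app_or _ _ _)[al|al]; last by right; rewrite (In_nseq al).
  by have [phi [pin ->]] := in_map_iff_ex al; left; exists phi.
have ie phi : List.In phi phis -> invariant1 (flips M) (e phi).
  move=> pin x y /asboolP[Mx My [->//|->]]; have [phiN _] := Hphi _ pin _ My.
  rewrite /e phiN oppr_eq0; case: eqP => // /eqP p0; rewrite oe// oppr_gt0.
  case: (ltgtP (phi y) 0) p0 => // _ _.
    by apply: (@F2_eq_mod2 0); ring.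
  by apply: (@F2_eq_mod2 1); ring.
have iw : invariant2 (flips M) w by exact: sign_cocycle_invariant.
exists (transfer l); split; first exact: transfer_nil.
  apply: transfer_invariant => a /inl[[phi pin ->]|->] /=; split => //; last exact: ie.
  by move=> x x' y y' xx' yy'; rewrite /wp (iw _ _ _ _ xx' yy') (ie _ pin _ _ xx') (ie _ pin _ _ yy').
move=> z Mz; have [phi pin pz] := cov z Mz; have [_ pC] := Hphi _ pin _ Mz.
have z0 : 0 < `|z| / 2 by rewrite divr_gt0// normr_gt0; apply/eqP => z0; apply: M0; rewrite -z0.
have pz0 : 0 < `|phi z| by rewrite normr_gt0.
have /cvgrPdist_lt/(_ _ pz0)/nbhs_ballP[d /= d0 Hd] := pC.
exists (Num.min d (`|z| / 2)); first by rewrite lt_min d0.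
move=> s ss sM.
have sz : {in s, forall x, `|z - x| < `|z| / 2}.
  by move=> x /sM[_]; rewrite lt_min => /andP[].
have sd : {in s, forall x, `|phi z - phi x| < `|phi z|}.
  move=> x /sM[_]; rewrite lt_min => /andP[xd _]; apply: Hd.
  by rewrite -ball_normE.
have E : {in s &, forall x y, w x y = coboundary1 eps x y}.
  by move=> x y xs ys; apply: sign_cocycleE (sz x xs) (sz y ys).
rewrite -(prodl_nseq_ext _ E) -l1 prodl_transfer ?sl//.
  rewrite (@prodl_zero _ _ (wp phi)) ?add0r//; last by rewrite size_map sl.
    have := @List.in_map _ _ (fun p : triple => p.1.2) l (w, wp phi, e phi).
    apply; apply: List.in_or_app; left.
    exact: (@List.in_map _ _ (fun phi => (w, wp phi, e phi))).
  move=> x y xs ys; rewrite /wp E// /coboundary1 /e.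
  have sg u : u \in s -> (phi u == 0) = false /\ (0 < phi u) = (0 < phi z).
    move=> /sd; have [zp|zn|] := ltgtP 0 (phi z); last by move=> E0; rewrite -E0 eqxx in pz.
      rewrite (gtr0_norm zp) ltr_norml => /andP[h1 h2].
      have : 0 < phi u by lra.
      by move=> u0; rewrite gt_eqF ?u0.
    rewrite (ltr0_norm zn) ltr_norml => /andP[h1 h2].
    have : phi u < 0 by lra.
    by move=> u0; rewrite lt_eqF// ltNge ltW.
  rewrite !(sg _ xs).1 !(sg _ ys).1 (sg _ xs).2 (sg _ ys).2.
  by apply: (@F2_eq_mod2 (eps x + eps y + (if 0 < phi z then 0 else 1))); ring.
move=> a /inl[[psi _ ->]|->] /=; split.
- exact: cocycle_on_coboundary E.
- apply: (@cocycle_on_coboundary _ _ (fun x => eps x + e psi x)) => x y xs ys.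
  by rewrite /wp E// /coboundary1; ring.
- by move=> x y _ _; rewrite /wp; apply/esym; apply: (@F2_eq_mod2 (e psi x + e psi y)); ring.
- exact: cocycle_on_coboundary E.
- exact: cocycle_on_coboundary E.
- by move=> x y _ _; rewrite !addr0.
Qed.

Lemma power_nontrivial_sphere M eps k (phi : 'rV[R]_k.+1 -> W) : odd_on M eps ->
  (forall x, cross_polytope x -> [/\ M (phi x), phi (- x) = - phi x & phi @ x --> phi x]) ->
  ~ power_trivial M eps k.
Proof.
move=> oe Hphi [b [b0 bM Hb]].
apply: (@cross_polytope_nontrivial R k (eps \o phi) (b \o map phi)) => //.
- by move=> x /Hphi[Mx phiN _] /=; rewrite phiN oe.
- move=> s sS /=; apply: bM; rewrite -map_comp; apply: all2_map2 => x xs /=.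
  have [Mx phiN _] := Hphi _ (sS _ xs); rewrite phiN; apply/asboolP; split => //.
    by have [+ _ _] := Hphi _ (cross_polytope_opp (sS _ xs)); rewrite phiN.
  by right.
move=> z Sz; have [Mz _ phiC] := Hphi _ Sz; have [rho r0 Hs] := Hb _ Mz.
have /cvgrPdist_lt/(_ _ r0)/nbhs_ballP[d /= d0 Hd] := phiC.
exists d => // s ss sS; rewrite (ldiff_map phi b) -Hs ?size_map ?prodl_map//.
move=> _ /mapP[x /sS[Sx zx] ->]; have [Mx _ _] := Hphi _ Sx; split => //.
by apply: Hd; rewrite -ball_normE.
Qed.

End OddPrimitive.

Lemma all2_nth (X : Type) (r : rel X) d s t : all2 r s t -> forall i,
  (r (nth d s i) (nth d t i) : Prop) \/ nth d s i = nth d t i.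
Proof.
elim: s t => [|x s IH] [|y t]//=; first by move=> _ i; right; rewrite !nth_nil.
by move=> /andP[xy st] [|i] /=; [left|exact: IH].
Qed.

Lemma lst_map (X Y : eqType) (f : X -> Y) n (t : 'I_n -> X) :
  lst (fun i => f (t i)) = map f (lst t).
Proof. by rewrite /lst -map_comp. Qed.

Lemma bin_pullback (X Y : topologicalType) (th : X -> Y) (w : cochain Y 1) :
  bin (as_pullback th w) = fun x y => bin w (th x) (th y).
Proof.
apply/funext => x; apply/funext => y; rewrite /bin /as_pullback; congr w.
by apply/funext => i /=; case: ifP.
Qed.

Lemma cup_exp_pullback (X Y : topologicalType) (th : X -> Y) (w : cochain Y 1) m :
  cup_exp (as_pullback th w : cochain X 1) m = as_pullback th (cup_exp w m).
Proof.
apply/funext => t; rewrite /as_pullback !cup_expE -/(as_pullback th w) bin_pullback.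
by rewrite -prodl_map -lst_map.
Qed.

(** * The index in terms of invariant cochains *)

Section IndexPower.
Context {R : realType} {W : normedModType R}.
Implicit Types (M : set W) (eps : W -> 'F_2).
Local Notation S := (infinite_sphere R).
Local Notation P := (infinite_projective_space R).
Local Notation Sproj := (antipodal_proj (@sphere_val R)).

Lemma nbhs_set_typeP M (x : M) (U : set M) :
  nbhs x U <-> exists2 rho : R, 0 < rho &
    forall y : M, `|set_val x - set_val y| < rho -> U y.
Proof.
split; last first.
  move=> [rho r0 H].
  have nb : nbhs x (set_val @^-1` ball (set_val x) rho).
    exact: (@initial_continuous M W set_val x _ (nbhsx_ballx _ _ r0)).
  by apply: filterS nb => y; rewrite /= -ball_normE; exact: H.
rewrite nbhsE => -[B [[A oA <-] Ax] BU].
have : nbhs (set_val x) A by apply: open_nbhs_nbhs; split.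
move=> /nbhs_ballP[rho /= r0 H]; exists rho => // y xy; apply: BU; apply: H.
by rewrite -ball_normE.
Qed.

Variable M : set W.
Hypotheses (M_sym : symmetric_set M) (M0 : ~ M 0).

Let vinj : injective (set_val : M -> W). Proof. exact: val_inj. Qed.

Let Mval (x : M) : M (set_val x). Proof. by case: x => u uM; exact: (set_mem uM). Qed.

Let mk u (Mu : M u) : M := exist _ u (mem_set Mu).

Let opp (x : M) : M := mk (M_sym (Mval x)).

Let oppE (x : M) : set_val (opp x) = - set_val x. Proof. by []. Qed.

Let opp_cont : continuous opp.
Proof.
move=> x U /nbhs_set_typeP[rho r0 H]; apply/nbhs_set_typeP; exists rho => // y xy.
by apply: H; rewrite !oppE -opprD normrN.
Qed.

Let locally_zero_orbit n (c : cochain (orbit_space M) n) :=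
  @locally_zeroP _ _ (set_val : M -> W) opp vinj oppE opp_cont n c.

Local Notation proj := (antipodal_proj (set_val : M -> W)).

Variable x0 : M.

Let lift_pt u : M := if pselect (M u) is left Mu then mk Mu else x0.

Let lift_ptK u : M u -> set_val (lift_pt u) = u.
Proof. by rewrite /lift_pt; case: pselect. Qed.

Let lift_ptV (x : M) : lift_pt (set_val x) = x.
Proof. by apply: vinj; rewrite lift_ptK. Qed.

(** A primitive on the quotient, evaluated at the projections of the points, is an invariant cochain
    on lists. *)
Lemma as_coboundary_power_trivial (w : cochain (orbit_space M) 1) epsT m :
  sheeted (bin w) epsT ->
  as_coboundary (cup_exp w m) -> power_trivial M (epsT \o lift_pt) m.
Proof.
move=> [_ wsh]; case: m => [|k].
  (* In degree 0 the power is the constant 1, which is not locally zero at [x0]. *)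
  move=> /locally_zero_orbit/(_ x0)[U nU /(_ (fun=> x0))].
  move=> /(_ _)/wrap[]; first by move=> _; exact: nbhs_singleton nU.
  by move=> /= /eqP; rewrite oner_eq0.
move=> [b /locally_zero_orbit Hb].
pose b' (s : seq W) : 'F_2 :=
  if s is [::] then 0 else b (fun i : 'I_k.+1 => proj (lift_pt (nth 0 s i))).
have b'E x s : b' (x :: s) = b (fun i : 'I_k.+1 => proj (lift_pt (nth 0 (x :: s) i))) by [].
exists b'; split => //.
  move=> [|u s] [|u' t]// st; rewrite !b'E; congr b; apply/funext => i.
  case: (all2_nth 0 st i) => [/asboolP[Mx My xy]|->//].
  by apply/antipodal_projP; rewrite !lift_ptK.
move=> z Mz; have [U + bU] := Hb (lift_pt z).
move=> /nbhs_set_typeP[rho r0 HU].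
have [U' + wU'] := wsh (lift_pt z).
move=> /nbhs_set_typeP[rho' r0' HU'].
exists (Num.min rho rho'); first by rewrite lt_min r0.
move=> s ss sM.
pose t (i : 'I_k.+2) := lift_pt (nth 0 s i).
have sK (i : 'I_k.+2) : M (nth 0 s i) /\ `|z - nth 0 s i| < Num.min rho rho'.
  by apply: sM; apply: mem_nth; rewrite ss.
have Ut i : U (t i).
  by apply: HU; rewrite /t (lift_ptK Mz) (lift_ptK (sK i).1); have := (sK i).2; rewrite lt_min => /andP[].
have U't x : x \in s -> U' (lift_pt x).
  move=> /sM[Mx]; rewrite lt_min => /andP[_ zx].
  by apply: HU'; rewrite !lift_ptK.
have := bU t Ut; rewrite cup_expE F2_sub => /F2_addE; rewrite add0r.
have lstE : lst t = map lift_pt s.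
  by rewrite -[in RHS](@lst_nth _ k.+2 0 s)// -lst_map.
rewrite (_ : lst (proj \o t) = map (proj \o lift_pt) s); last first.
  by rewrite map_comp -lstE -lst_map.
rewrite prodl_map (@prodl_nseq_ext _ _ (coboundary1 (epsT \o lift_pt))); last first.
  by move=> x y xs ys /=; apply: wU'; exact: U't.
move=> ->; rewrite (as_diff_lst b (proj x0)).
rewrite (_ : lst (proj \o t) = map (proj \o lift_pt) s); last first.
  by rewrite map_comp -lstE -lst_map.
rewrite -ldiff_map; apply: ldiff_ext => -[|x u] su us; first by rewrite ss in su.
rewrite b'E; congr b; apply/funext => i.
by rewrite (nth_map 0)// su ss.
Qed.

(** An invariant cochain may be evaluated at arbitrary representatives of points of the quotient. *)
Lemma power_trivial_as_coboundary (w : cochain (orbit_space M) 1) epsT m :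
  sheeted (bin w) epsT ->
  power_trivial M (epsT \o lift_pt) m -> as_coboundary (cup_exp w m).
Proof.
move=> [_ wsh] [b [b0 bM Hb]].
have Hb' (z : M) : exists2 rho : R, 0 < rho & forall s, size s = m.+1 ->
     {in s, forall x, M x /\ `|set_val z - x| < rho} ->
     prodl (nseq m (coboundary1 (epsT \o lift_pt))) s = ldiff b s by exact: Hb.
case: m Hb Hb' => [|k] Hb Hb'.
  have [rho r0 /(_ [:: set_val x0] erefl)] := Hb' x0.
  move=> /(_ _)/wrap[].
    by move=> x; rewrite inE => /eqP ->; split => //; rewrite subrr normr0.
  by rewrite /= b0 addr0 => /eqP; rewrite oner_eq0.
pose b' : cochain (orbit_space M) k := fun t => b (lst (fun i => set_val (repr (t i)))).
exists b'; apply/locally_zero_orbit => z.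
have [rho r0 Hs] := Hb' z.
have [U' + wU'] := wsh z; move=> /nbhs_set_typeP[rho' r0' HU'].
exists [set y | `|set_val z - set_val y| < Num.min rho rho'].
  by apply/nbhs_set_typeP; exists (Num.min rho rho') => //; rewrite lt_min r0.
move=> t Ut; rewrite F2_sub cup_expE.
have tr i : `|set_val z - set_val (t i)| < rho by have := Ut i; rewrite /= lt_min => /andP[].
have tr' i : U' (t i) by apply: HU'; have := Ut i; rewrite /= lt_min => /andP[].
have -> : prodl (nseq k.+1 (bin w)) (lst (proj \o t)) =
    prodl (nseq k.+1 (coboundary1 (epsT \o lift_pt))) (lst (fun i => set_val (t i))).
  rewrite (_ : lst (proj \o t) = map proj (lst t)); last by rewrite -lst_map.
  rewrite (_ : lst (fun i => set_val (t i)) = map set_val (lst t)); last by rewrite -lst_map.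
  rewrite !prodl_map; apply: prodl_nseq_ext => i j _ _.
  by rewrite wU'// /coboundary1 /= !lift_ptV.
rewrite Hs ?size_lst//; last by move=> x xs; have [i ->] := mem_lst xs.
rewrite ldiff_lst.
suff -> : as_diff b' (proj \o t) =
    \sum_(i < k.+2) b (lst (fun j : 'I_k.+1 => set_val (t (lift i j)))) by rewrite F2_add.
apply: eq_bigr => i _; apply: bM; apply: all2_map2 => j _; apply/asboolP; split => //.
have /antipodal_projP := antipodal_proj_repr (v := set_val : M -> W) (proj (t (lift i j))).
by [].
Qed.

Lemma fr_index_ge_power_nontrivial eps k : odd_on M eps -> (1 <= k)%N ->
  (k%:R%:E <= fr_index M)%E -> exists2 m, (k <= m.+1)%N & ~ power_trivial M eps m.
Proof.
move=> oe k1; rewrite /fr_index; case: eqP => [E|_].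
  by exfalso; have : (set0 : set W) (set_val x0) by rewrite -E; exact: Mval.
move=> kM; apply: contrapT => H.
move: kM; apply/negP; rewrite -ltNge.
(* If all powers of exponent at least k - 1 are trivial, no m >= k belongs to the set whose supremum
   is the index. *)
apply: (@le_lt_trans _ _ ((k.-1)%:R%:E)); last by rewrite lte_fin ltr_nat; lia.
apply: ge_ereal_sup => _ [m [m1 [th [w [cth gw ncob]]]] <-].
rewrite lee_fin ler_nat leqNgt; apply/negP => km; apply: H; exists m.-1; first by lia.
move=> Mm; apply: ncob.
have [cont [f [fc fodd fth]]] := cth.
have [epsS [eodd epssh]] := generator_sheeted gw.
have sh : sheeted (bin (as_pullback th w : cochain (orbit_space M) 1)) (epsS \o f).
  split; first by move=> x y xy; apply: eodd; exact: fodd.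
  move=> z; have [U nU HU] := epssh (f z); exists (f @^-1` U); first exact: fc.
  by move=> x y Ux Uy; rewrite bin_pullback !fth HU.
have oe' : odd_on M ((epsS \o f) \o lift_pt).
  by move=> x Mx /=; apply: eodd; apply: fodd; rewrite !lift_ptK//; exact: M_sym.
have := power_trivial_as_coboundary sh (power_trivial_change M0 oe oe' Mm).
by rewrite cup_exp_pullback.
Qed.

(** The odd map [f] provides the classifying map that the index asks for, and [projective_cochain]
    the generator. *)
Lemma power_nontrivial_fr_index_ge eps m (f : M -> S) : odd_on M eps ->
  continuous f ->
  (forall x y : M, set_val y = - set_val x -> sphere_val (f y) = - sphere_val (f x)) ->
  ~ power_trivial M eps m -> (m.+1%:R%:E <= fr_index M)%E.
Proof.
move=> oe fc fodd nM; rewrite /fr_index; case: eqP => [E|_].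
  by exfalso; have : (set0 : set W) (set_val x0) by rewrite -E; exact: Mval.
apply: ereal_sup_ubound; exists m.+1 => //; split => //.
pose th (q : orbit_space M) : P := Sproj (f (repr q)).
have thE x : th (proj x) = Sproj (f x).
  have /antipodal_projP[/vinj E|E] := antipodal_proj_repr (v := set_val : M -> W) (proj x).
    by rewrite /th E.
  by apply/antipodal_projP; right; exact: fodd.
exists th, projective_cochain; split.
- split; last by exists f.
  apply/quotient_continuous.
  rewrite (_ : _ \o _ = Sproj \o f); last by apply/funext => x; exact: thE.
  by move=> x; apply: continuous_comp; [exact: fc|exact: antipodal_proj_continuous].
- exact: generates_projective_cochain.
have [eodd epssh] := @sphere_cocycle_sheeted R.
have sh : sheeted (bin (as_pullback th projective_cochain : cochain (orbit_space M) 1)) (flip \o f).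
  split; first by move=> x y xy; apply: eodd; exact: fodd.
  move=> z; have [U nU HU] := epssh (f z); exists (f @^-1` U); first exact: fc.
  by move=> x y Ux Uy; rewrite bin_pullback bin_projective_cochain !thE HU.
have oe' : odd_on M ((flip \o f) \o lift_pt).
  by move=> x Mx /=; apply: eodd; apply: fodd; rewrite !lift_ptK//; exact: M_sym.
move=> cob; apply: nM; apply: (power_trivial_change M0 oe' oe).
apply: (as_coboundary_power_trivial sh).
by rewrite cup_exp_pullback.
Qed.

End IndexPower.

(** * Reflexive spaces *)

Lemma cvgR_unique {R : realType} {T : Type} {F : set_system T} {FF : ProperFilter F}
  (a : T -> R) (x y : R) : a t @[t --> F] --> x -> a t @[t --> F] --> y -> x = y.
Proof.
move=> ax ay; have hR := @norm_hausdorff R R^o.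
exact: etrans (esym (cvg_lim hR ax)) (cvg_lim hR ay).
Qed.

Section DualBasics.
Context {R : realType} {W : normedModType R}.
Implicit Types (L : dual W) (x y : W).

Lemma dualD L x y : L (x + y) = L x + L y. Proof. exact: linearD. Qed.
Lemma dualZ L (a : R) x : L (a *: x) = a * L x. Proof. exact: linearZ. Qed.
Lemma dualN L x : L (- x) = - L x. Proof. exact: linearN. Qed.
Lemma dualB L x y : L (x - y) = L x - L y. Proof. exact: linearB. Qed.
Lemma dual0 L : L 0 = 0. Proof. exact: linear0. Qed.
Lemma dual_le L x : `|L x| <= `|L| * `|x|. Proof. exact: dual_norm_ub. Qed.
Lemma dual_sum L n (F : 'I_n -> W) : L (\sum_(i < n) F i) = \sum_(i < n) L (F i).
Proof. exact: linear_sum. Qed.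
Lemma sub_dualE L L' x : (L - L') x = L x - L' x. Proof. by []. Qed.
Lemma scale_dualE (a : R) L x : (a *: L) x = a * L x. Proof. by []. Qed.
Lemma zero_dualE x : (0 : dual W) x = 0. Proof. by []. Qed.

Lemma dual_ext L L' : (forall x, L x = L' x) -> L = L'.
Proof. by move=> E; apply/val_inj/funext. Qed.

Lemma mk_dual (l : W -> R) (C : R) :
  (forall (a : R) x y, l (a *: x + y) = a * l x + l y) ->
  (forall x, `|l x| <= C * `|x|) -> exists L : dual W, forall x, L x = l x.
Proof.
move=> lin bd.
have lP : (l : W -> R^o) \in @continuous_linear_form R W.
  apply/asboolP; split; first by move=> a x y; rewrite lin.
  have lB x y : l (x - y) = l x - l y.
    by rewrite addrC -scaleN1r lin mulN1r addrC.
  move=> x; apply/cvgrPdist_lt => e e0; near=> y.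
  rewrite -lB (le_lt_trans (bd _))//.
  have C1 : 0 < `|C| + 1 by rewrite ltr_wpDl.
  have : `|x - y| < e / (`|C| + 1).
    by near: y; apply: cvgr_dist_lt => //; rewrite divr_gt0.
  rewrite ltr_pdivlMr// => h; apply: le_lt_trans h.
  rewrite mulrC ler_wpM2l//; have := ler_norm C; lra.
by exists (Dual lP).
Unshelve. all: by end_near. Qed.

End DualBasics.

(** * The Hahn-Banach theorem *)

Section HahnBanach.
Context {R : realType} {V : lmodType R}.
Implicit Types (p q : V -> R).

Definition sublinear p := (forall x y, p (x + y) <= p x + p y) /\
  (forall (t : R) x, 0 <= t -> p (t *: x) = t * p x).

Lemma sublinear0 p : sublinear p -> p 0 = 0.
Proof. by case=> _ pZ; rewrite -(scale0r (0 : V)) pZ// mul0r. Qed.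

Lemma sublinearN p x : sublinear p -> - p (- x) <= p x.
Proof.
move=> sp; rewrite -subr_ge0 opprK addrC -(sublinear0 sp) -(addNr x).
by rewrite (le_trans (sp.1 _ _))// addrC.
Qed.

(** A sublinear minorant of [p] that is at most [- p y] at [- y] (take t = 1): it no longer
    distinguishes the two directions of the line through [y]. *)
Definition directional p y x := inf [set p (x + t *: y) - t * p y | t in [set t : R | 0 <= t]].

Let directional_lb p y x : sublinear p ->
  lbound [set p (x + t *: y) - t * p y | t in [set t : R | 0 <= t]] (- p (- x)).
Proof.
move=> sp _ [t t0 <-]; have := sp.1 (x + t *: y) (- x).
rewrite addrAC subrr add0r sp.2//; lra.
Qed.

Lemma directional_le p y x t : sublinear p -> 0 <= t ->
  directional p y x <= p (x + t *: y) - t * p y.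
Proof. by move=> sp t0; apply: ge_inf; [eexists; exact: directional_lb|exists t]. Qed.

Lemma directional_ge p y x c :
  (forall t, 0 <= t -> c <= p (x + t *: y) - t * p y) -> c <= directional p y x.
Proof.
move=> H; apply: lb_le_inf; first by exists (p (x + 0 *: y) - 0 * p y); exists 0 => /=.
by move=> _ [t t0 <-]; exact: H.
Qed.

Lemma directional_sublinear p y : sublinear p -> sublinear (directional p y).
Proof.
move=> sp; split.
  move=> x x'; rewrite -lerBlDr; apply: directional_ge => t t0.
  rewrite lerBlDl -lerBlDr; apply: directional_ge => t' t'0.
  rewrite lerBlDr; apply: (le_trans (directional_le _ _ sp (addr_ge0 t0 t'0))).
  rewrite scalerDl addrACA mulrDl.
  have := sp.1 (x + t *: y) (x' + t' *: y); lra.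
move=> s x; rewrite le_eqVlt => /orP[/eqP<-|s0].
  rewrite scale0r mul0r; apply: le_anti; apply/andP; split.
    by have := directional_le y 0 sp (lexx 0); rewrite scale0r addr0 mul0r subr0 (sublinear0 sp).
  by apply: directional_ge => t t0; rewrite add0r sp.2// subrr.
have s1 : s != 0 by rewrite gt_eqF.
apply: le_anti; apply/andP; split.
  rewrite mulrC -ler_pdivrMr//; apply: directional_ge => t t0.
  rewrite ler_pdivrMr//.
  have st : 0 <= s * t by rewrite mulr_ge0// ltW.
  apply: (le_trans (directional_le _ _ sp st)).
  rewrite -scalerA -scalerDr (sp.2 _ _ (ltW s0)) le_eqVlt; apply/orP; left; apply/eqP; ring.
apply: directional_ge => t t0.
have st : 0 <= t / s by rewrite divr_ge0// ltW.
have := directional_le y x sp st; rewrite -(ler_pM2l s0) => /le_trans; apply.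
rewrite mulrBr -(sp.2 _ _ (ltW s0)) scalerDr scalerA mulrCA divff// mulr1.
by rewrite mulrA mulrCA divff// mulr1.
Qed.

Lemma directional_le_self p y x : sublinear p -> directional p y x <= p x.
Proof.
by move=> sp; have := directional_le y x sp (lexx 0); rewrite scale0r addr0 mul0r subr0.
Qed.

(* A minimal sublinear functional is linear: it coincides with its [directional]
   minorants, hence is superadditive. *)
Theorem hahn_banach p : sublinear p -> exists l : V -> R,
  (forall (a : R) x y, l (a *: x + y) = a * l x + l y) /\ forall x, l x <= p x.
Proof.
move=> sp.
pose T := {q : V -> R | sublinear q /\ forall x, q x <= p x}.
(* The order is reversed: a maximal element for [r] is a minimal sublinear functional. *)
pose r : rel T := fun (q q' : T) => `[< forall x, sval q' x <= sval q x >].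
have [|q1 q2 q3|q1 q2|A Atot|q qmin] := @Zorn T r.
- by move=> q; apply/asboolP.
- by move=> /asboolP h1 /asboolP h2; apply/asboolP => x; exact: le_trans (h1 x).
- move=> /asboolP h1 /asboolP h2; case: q1 q2 h1 h2 => [q1 Q1] [q2 Q2] /= h1 h2.
  by apply: eq_exist; apply/funext => x; apply/le_anti; rewrite h1 h2.
- have [[a Aa]|A0] := pselect (exists a, A a); last first.
    by exists (exist _ p (conj sp (fun x => lexx _))) => s As; case: A0; exists s.
  (* The pointwise infimum of the chain, finite because every member is at least [- p (- x)]. It is
     subadditive since of two members the smaller one can be used for both arguments. *)
  pose m x := inf [set sval s x | s in A].
  have lb x : lbound [set sval s x | s in A] (- p (- x)).
    move=> _ [s As <-]; have [ss sle] := svalP s.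
    by rewrite (le_trans _ (sublinearN x ss))// lerN2.
  have mle s x : A s -> m x <= sval s x.
    by move=> As; apply: ge_inf; [eexists; exact: lb|exists s].
  have mge x c : (forall s, A s -> c <= sval s x) -> c <= m x.
    by move=> H; apply: lb_le_inf; [exists (sval a x), a|move=> _ [s As <-]; exact: H].
  have sm : sublinear m.
    split=> [x y|t x t0].
      rewrite -lerBlDr; apply: (mge _ _) => s As; rewrite lerBlDl -lerBlDr.
      apply: (mge _ _) => s' As'; rewrite lerBlDr.
      have [/asboolP h|/asboolP h] := Atot s s' As As'.
        apply: (le_trans (mle s' _ As')); have [[+ _] _] := svalP s' => /(_ x y).
        have := h x; lra.
      apply: (le_trans (mle s _ As)); have [[+ _] _] := svalP s => /(_ x y).
      have := h y; lra.
    apply: le_anti; apply/andP; split.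
      move: t0; rewrite [0 <= _]le_eqVlt => /orP[/eqP <-|t0].
        rewrite mul0r scale0r; apply: (le_trans (mle a _ Aa)).
        by rewrite (sublinear0 (svalP a).1).
      rewrite mulrC -ler_pdivrMr//; apply: (mge _ _) => s As; rewrite ler_pdivrMr//.
      by apply: (le_trans (mle s _ As)); rewrite ((svalP s).1.2 _ _ (ltW t0)) mulrC.
    apply: (mge _ _) => s As; rewrite (svalP s).1.2//; apply: ler_wpM2l => //; exact: mle.
  have mp x : m x <= p x by apply: (le_trans (mle a x Aa)); exact: (svalP a).2.
  by exists (exist _ m (conj sm mp)) => s As; apply/asboolP => x; exact: mle.
have [sq qp] := svalP q.
have dirE y : directional (sval q) y = sval q.
  have dp x : directional (sval q) y x <= p x.
    exact: le_trans (directional_le_self _ _ sq) (qp x).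
  have := qmin (exist _ _ (conj (directional_sublinear y sq) dp)).
  by move=> H; rewrite -{2}H//; apply/asboolP => x; exact: directional_le_self.
have qD x y : sval q (x + y) = sval q x + sval q y.
  apply: le_anti; rewrite sq.1 /=.
  have := directional_le y x sq (@ler01 R); rewrite dirE scale1r mul1r; lra.
have qN x : sval q (- x) = - sval q x.
  by apply/eqP; rewrite -subr_eq0 opprK -qD addNr (sublinear0 sq).
exists (sval q); split => // a x y; rewrite qD; congr (_ + _).
have [a0|a0] := leP 0 a; first exact: sq.2.
have -> : a *: x = (- a) *: (- x) by rewrite scaleNr scalerN opprK.
by rewrite sq.2 ?oppr_ge0 ?(ltW a0)// qN mulrNN.
Qed.

(** A linear functional below [directional p x0] takes at [- x0] a value of at most [- p x0], hence
    equality holds at [x0]. *)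
Lemma hahn_banach_at p x0 : sublinear p -> exists l : V -> R,
  [/\ forall (a : R) x y, l (a *: x + y) = a * l x + l y,
      forall x, l x <= p x & l x0 = p x0].
Proof.
move=> sp; have [l [lin lp]] := hahn_banach (directional_sublinear x0 sp).
exists l; split => // [x|]; first exact: le_trans (lp x) (directional_le_self _ _ sp).
have lN x : l (- x) = - l x.
  have l0 : l 0 = 0 by have := lin 1 0 0; rewrite scale1r addr0 mul1r; lra.
  by have := lin (-1) x 0; rewrite scaleN1r !addr0 mulN1r l0 addr0.
apply: le_anti; rewrite (le_trans (lp _) (directional_le_self _ _ sp))//=.
have := le_trans (lp (- x0)) (directional_le x0 (- x0) sp (@ler01 R)).
by rewrite lN scale1r addNr (sublinear0 sp) mul1r sub0r lerN2.
Qed.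

End HahnBanach.

Section NormedHahnBanach.
Context {R : realType} {W : normedModType R}.
Implicit Types (x y : W) (Y : set W).

Lemma norming_functional x : exists L : dual W, (forall y, `|L y| <= `|y|) /\ L x = `|x|.
Proof.
have sp : sublinear (fun y : W => `|y|).
  by split=> [y z|t y t0]; [exact: ler_normD|rewrite normrZ ger0_norm].
have [l [lin lp lx]] := hahn_banach_at x sp.
have lN y : l (- y) = - l y.
  have l0 : l 0 = 0 by have := lin 1 0 0; rewrite scale1r addr0 mul1r; lra.
  by have := lin (-1) y 0; rewrite scaleN1r !addr0 mulN1r l0 addr0.
have bd y : `|l y| <= `|y|.
  by rewrite ler_norml lp andbT lerNl -lN (le_trans (lp _))// normrN.
have [L LE] := mk_dual lin (C := 1) (fun y => le_trans (bd y) (eq_ind_r (fun z => _ <= z) (lexx _) (mul1r _))).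
by exists L; split => [y|]; rewrite LE.
Qed.

Definition linear_subspace Y := Y 0 /\ forall (a : R) x y, Y x -> Y y -> Y (a *: x + y).

(** Hahn-Banach for the distance to [Y], which is sublinear: a functional dominated by it is bounded
    and vanishes on [Y], and its value at [x] can be made equal to the distance of [x]. *)
Lemma separating_functional Y x : linear_subspace Y ->
  (forall e : R, 0 < e -> exists2 y, Y y & `|x - y| < e) \/
  (exists2 L : dual W, (forall y, Y y -> L y = 0) & L x != 0).
Proof.
move=> [Y0 YL].
have YN y : Y y -> Y (- y) by move=> Yy; rewrite -scaleN1r -[_ *: _]addr0; exact: YL.
have YD y z : Y y -> Y z -> Y (y + z) by move=> Yy Yz; rewrite -[y]scale1r; exact: YL.
have YZ a y : Y y -> Y (a *: y) by move=> Yy; rewrite -[_ *: _]addr0; exact: YL.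
pose p z := inf [set `|z - y| | y in Y].
have lb z : lbound [set `|z - y| | y in Y] 0 by move=> _ [y _ <-].
have ple z y : Y y -> p z <= `|z - y|.
  by move=> Yy; apply: ge_inf; [eexists; exact: lb|exists y].
have pge z c : (forall y, Y y -> c <= `|z - y|) -> c <= p z.
  by move=> H; apply: lb_le_inf; [exists `|z - 0|, 0|move=> _ [y Yy <-]; exact: H].
have sp : sublinear p.
  split=> [z w|t z t0].
    rewrite -lerBlDr; apply: (pge _ _) => y Yy; rewrite lerBlDl -lerBlDr.
    apply: (pge _ _) => y' Yy'; rewrite lerBlDr; apply: (le_trans (ple _ _ (YD _ _ Yy Yy'))).
    by rewrite opprD addrACA addrC (le_trans (ler_normD _ _))// addrC.
  apply: le_anti; apply/andP; split.
    move: t0; rewrite [0 <= _]le_eqVlt => /orP[/eqP <-|t0].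
      by rewrite scale0r mul0r (le_trans (ple 0 0 Y0))// subr0 normr0.
    rewrite mulrC -ler_pdivrMr//; apply: (pge _ _) => y Yy; rewrite ler_pdivrMr//.
    apply: (le_trans (ple _ _ (YZ t _ Yy))).
    by rewrite -scalerBr normrZ gtr0_norm// mulrC.
  move: t0; rewrite [0 <= _]le_eqVlt => /orP[/eqP <-|t0].
    by rewrite mul0r; apply: (pge _ _).
  apply: (pge _ _) => y Yy; have t0' : t != 0 by rewrite gt_eqF.
  have -> : y = t *: (t^-1 *: y) by rewrite scalerA divff// scale1r.
  by rewrite -scalerBr normrZ gtr0_norm// ler_pM2l//; apply: ple; exact: YZ.
have p0 z : 0 <= p z by apply: (pge _ _).
have pN z : p (- z) = p z.
  apply: le_anti; apply/andP; split; apply: (pge _ _) => y Yy.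
    by apply: (le_trans (ple _ _ (YN _ Yy))); rewrite -opprD normrN.
  by apply: (le_trans (ple _ _ (YN _ Yy))); rewrite -normrN opprD opprK.
have [px0|px0] := eqVneq (p x) 0.
  left=> e e0; have hi : has_inf [set `|x - y| | y in Y].
    by split; [exists `|x - 0|, 0|exists 0; exact: lb].
  have [_ [y Yy <-]] := inf_adherent e0 hi; rewrite -/(p x) px0 add0r => h.
  by exists y.
right; have [l [lin lp lx]] := hahn_banach_at x sp.
have lN y : l (- y) = - l y.
  have l0 : l 0 = 0 by have := lin 1 0 0; rewrite scale1r addr0 mul1r; lra.
  by have := lin (-1) y 0; rewrite scaleN1r !addr0 mulN1r l0 addr0.
have lpn y : `|l y| <= p y by rewrite ler_norml lp andbT lerNl -lN -(pN y) lp.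
have bd y : `|l y| <= 1 * `|y|.
  by rewrite mul1r (le_trans (lpn y))// (le_trans (ple _ _ Y0))// subr0.
have [L LE] := mk_dual lin bd; exists L; last by rewrite LE lx.
move=> y Yy; rewrite LE; apply/eqP; rewrite -normr_le0 (le_trans (lpn y))//.
by rewrite (le_trans (ple _ _ Yy))// subrr normr0.
Qed.

Definition span_of (u : nat -> W) : set W :=
  [set x | exists n (c : nat -> R), x = \sum_(i < n) c i *: u i].

Lemma span_ofE (u : nat -> W) n (c : nat -> R) m : (n <= m)%N ->
  \sum_(i < n) c i *: u i = \sum_(i < m) (if (i < n)%N then c i else 0) *: u i.
Proof.
move=> nm; rewrite (big_ord_widen m (fun i => c i *: u i) nm) big_mkcond /=.
by apply: eq_bigr => i _; case: ifP; rewrite ?scale0r.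
Qed.

Lemma span_of_subspace u : linear_subspace (span_of u).
Proof.
split; first by exists 0%N, (fun=> 0); rewrite big_ord0.
move=> a x y [n [c ->]] [m [d ->]].
exists (maxn n m), (fun i => a * (if (i < n)%N then c i else 0) + (if (i < m)%N then d i else 0)).
rewrite (span_ofE u c (leq_maxl n m)) (span_ofE u d (leq_maxr n m)) scaler_sumr -big_split /=.
by apply: eq_bigr => i _; rewrite scalerA -scalerDl.
Qed.

Lemma span_of_mem u i : span_of u (u i).
Proof.
exists i.+1, (fun j => (j == i)%:R); rewrite (bigD1 ord_max)//= eqxx scale1r big1 ?addr0//.
move=> j ji; rewrite (_ : (j == i :> nat) = false) ?scale0r//.
by apply/negbTE; apply: contra ji => /eqP E; apply/eqP/val_inj.
Qed.

Definition rat_comb (u : nat -> W) (c : seq rat) : W := \sum_(i < size c) ratr c`_i *: u i.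

Lemma rat_comb_dense u x (e : R) : span_of u x -> 0 < e ->
  exists c, `|x - rat_comb u c| < e.
Proof.
move=> [n [c ->]] e0; pose K := \sum_(i < n) `|u i| + 1.
have K0 : 0 < K by rewrite ltr_wpDl// sumr_ge0.
have /choice[q Hq] i : exists q : rat, `|c i - ratr q| < e / K.
  have h : c i < c i + e / K by rewrite ltrDl divr_gt0.
  have [q] := rat_in_itvoo h; rewrite in_itv /= => /andP[q1 q2].
  by exists q; rewrite distrC gtr0_norm ?subr_gt0// ltrBlDl.
exists (mkseq q n); rewrite /rat_comb size_mkseq -sumrB.
rewrite (le_lt_trans (ler_norm_sum _ _ _))//.
apply: (@le_lt_trans _ _ (\sum_(i < n) (e / K) * `|u i|)).
  apply: ler_sum => i _; rewrite nth_mkseq// -scalerBl normrZ ler_wpM2r//.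
  by rewrite ltW.
rewrite -mulr_sumr mulrAC ltr_pdivrMr// ltr_pM2l// /K; lra.
Qed.

End NormedHahnBanach.

(** * Weak sequential compactness through ultrafilters *)

Section Ultralimits.
Context {R : realType} {W : normedModType R}.

Lemma ultra_bounded_cvg (T : Type) (G : set_system T) (a : T -> R) (C : R) :
  UltraFilter G -> (forall t, `|a t| <= C) -> exists y : R, a t @[t --> G] --> y.
Proof.
move=> GU aC; pose A := [set s : R | G [set t | s <= a t]].
have AC : A (- C).
  by apply: filterS filterT => t _ /=; have := aC t; rewrite ler_norml => /andP[].
have Aub : ubound A C.
  move=> s As; rewrite leNgt; apply/negP => Cs.
  have [t st] := filter_ex As; have := le_trans st (le_trans (ler_norm _) (aC t)).
  by rewrite leNgt Cs.
have supA : has_sup A by split; [exists (- C)|exists C].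
exists (sup A); apply/cvgrPdist_lt => e e0.
have [s As sA] := sup_adherent e0 supA.
have [h|h] := in_ultra_setVsetC [set t | sup A + e / 2 <= a t] GU.
  exfalso; have : sup A + e / 2 <= sup A by apply: ub_le_sup; [exact: supA.2|exact: h].
  by rewrite leNgt ltrDl divr_gt0.
apply: filterS2 As h => t /= st /negP; rewrite -ltNge => ts.
rewrite ltr_norml; apply/andP; split; lra.
Qed.

Hypothesis W_reflexive : reflexive_space W.

(** The limits along an ultrafilter of all [L (u t)] depend linearly and boundedly on [L];
    reflexivity represents this functional by a point. *)
Lemma ultra_weak_cvg (T : Type) (G : set_system T) (u : T -> W) (C : R) :
  UltraFilter G -> (forall t, `|u t| <= C) ->
  exists x : W, forall L : dual W, L (u t) @[t --> G] --> L x.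
Proof.
move=> GU uC.
have /choice[X XP] (L : dual W) : exists y : R, (L (u t) : R) @[t --> G] --> y.
  apply: (ultra_bounded_cvg (C := `|L| * C) GU) => t.
  by rewrite (le_trans (dual_le _ _))// ler_wpM2l.
have lin (a : R) (L L' : dual W) : X (a *: L + L') = a * X L + X L'.
  apply: (cvgR_unique (XP (a *: L + L'))).
  apply: cvgD; last exact: XP.
  by apply: cvgM; [exact: cvg_cst|exact: XP].
have bd (L : dual W) : `|X L| <= C * `|L|.
  apply/ler_addgt0Pr => e e0; have /cvgrPdist_lt/(_ _ e0)/filter_ex[t Ht] := XP L.
  have := dual_le L (u t); have := ler_wpM2l (normr_ge0 L) (uC t).
  have := ler_distD 0 (X L) (L (u t)).
  have : `|X L| <= `|X L - L (u t)| + `|L (u t)|.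
    by rewrite -{1}(subrK (L (u t)) (X L)) ler_normD.
  rewrite [C * _]mulrC; lra.
have [XX XXE] := mk_dual lin bd.
have [x Hx] := W_reflexive XX; exists x => L.
by rewrite -Hx XXE; exact: XP.
Qed.

Lemma increasing_sequence (P : nat -> nat -> Prop) :
  (forall k N, exists n, (N < n)%N /\ P k n) ->
  exists sigma : nat -> nat, {homo sigma : m n / (m < n)%N} /\ forall k, P k (sigma k).
Proof.
move=> H; have /choice[nxt Hn] : forall kN : nat * nat, exists n, (kN.2 < n)%N /\ P kN.1 n.
  by move=> [k N]; exact: H.
pose fix sigma k := if k is k'.+1 then nxt (k'.+1, sigma k') else nxt (0%N, 0%N).
exists sigma; split.
  by apply: homo_ltn; [exact: ltn_trans|move=> k /=; exact: (Hn (k.+1, sigma k)).1].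
by case=> [|k]; [exact: (Hn (0%N, 0%N)).2|exact: (Hn (k.+1, _)).2].
Qed.

(** It is enough to make the sequence converge on countably many functionals: those norming the
    rational combinations of its terms separate the points of the closed span, and by Hahn-Banach
    this span contains every weak limit. *)
Lemma weakly_convergent_subsequence (u : nat -> W) (C : R) : (forall n, `|u n| <= C) ->
  exists sigma : nat -> nat, {homo sigma : m n / (m < n)%N} /\
    exists x, weakly_cvg (u \o sigma) x.
Proof.
move=> uC.
have /choice[lf lfP] (c : seq rat) : exists L : dual W,
    (forall y, `|L y| <= `|y|) /\ L (rat_comb u c) = `|rat_comb u c|.
  exact: norming_functional.
pose D (k : nat) : dual W := if unpickle k is Some c then lf c else 0.
(* The functional norming a rational combination close to [x] vanishes at [x], so it bounds the norm
   of the combination by its distance to [x]. *)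
have Dnorm x : (forall e : R, 0 < e -> exists2 y, span_of u y & `|x - y| < e) ->
    (forall k, D k x = 0) -> x = 0.
  move=> Hx D0; apply/eqP; rewrite -normr_le0; apply/ler_addgt0Pr => e e0; rewrite add0r.
  have e4 : 0 < e / 4 by rewrite divr_gt0.
  have [y Yy xy] := Hx _ e4; have [c yc] := rat_comb_dense Yy e4.
  have h1 : `|x - rat_comb u c| < e / 2.
    rewrite (le_lt_trans (ler_distD y _ _))//; lra.
  have h2 : `|rat_comb u c| <= `|x - rat_comb u c|.
    rewrite -(lfP c).2 distrC; apply: le_trans (ler_norm _) _.
    have := D0 (pickle c); rewrite /D pickleK => E.
    by rewrite -[lf c (rat_comb u c)]subr0 -E -dualB; exact: (lfP c).1.
  have : `|x| <= `|x - rat_comb u c| + `|rat_comb u c|.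
    by rewrite -{1}(subrK (rat_comb u c) x) ler_normD.
  lra.
have wlim_span (G : set_system nat) (v : nat -> W) x : UltraFilter G ->
    (forall n, span_of u (v n)) -> (forall L : dual W, L (v t) @[t --> G] --> L x) ->
    forall e : R, 0 < e -> exists2 y, span_of u y & `|x - y| < e.
  move=> GU vY vx; have [//|[L LY /eqP []]] := separating_functional x (span_of_subspace u).
  have := vx L; under eq_fun do rewrite LY//.
  by move=> h; apply: (cvgR_unique h); exact: cvg_cst.
have [G0 [G0U G0oo]] := ultraFilterLemma (F := \oo) _.
have [x0 Hx0] := ultra_weak_cvg G0U uC.
have [sigma [sigma_inc sigmaP]] : exists sigma : nat -> nat,
    {homo sigma : m n / (m < n)%N} /\
    forall k, forall i, (i <= k)%N -> `|D i x0 - D i (u (sigma k))| < k.+1%:R^-1.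
  apply: (@increasing_sequence
    (fun k n => forall i, (i <= k)%N -> `|D i x0 - D i (u n)| < k.+1%:R^-1)) => k N.
  have k0 : (0 : R) < k.+1%:R^-1 by rewrite invr_gt0 ltr0n.
  have : G0 [set n | forall i, (i <= k)%N -> `|D i x0 - D i (u n)| < k.+1%:R^-1].
    have HD i : G0 [set n | `|D i x0 - D i (u n)| < k.+1%:R^-1].
      by have /cvgrPdist_lt/(_ _ k0) := Hx0 (D i).
    elim: {-2}k => [|j IH].
      by apply: filterS (HD 0%N) => n Hn i; rewrite leqn0 => /eqP ->.
    apply: filterS2 IH (HD j.+1) => n H1 H2 i; rewrite leq_eqVlt ltnS => /orP[/eqP->//|].
    exact: H1.
  have : G0 [set n | (N < n)%N] by apply: G0oo; exists N.+1.
  move=> h1 h2; have [n [? ?]] := filter_ex (filterI h1 h2).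
  by exists n.
exists sigma; split => //; exists x0 => L.
have sig_ge k : (k <= sigma k)%N.
  by elim: k => // k IH; apply: (leq_ltn_trans IH); exact: sigma_inc.
have Dv i : D i (u (sigma k)) @[k --> \oo] --> D i x0.
  apply/cvgrPdist_lt => e e0.
  have [K Ke] : exists K : nat, K.+1%:R^-1 < e.
    have [K] := ltr_add_invr (y := 0) (x := e) e0; rewrite add0r => h; by exists K.
  exists (maxn i K) => // k /= kK; apply: lt_trans Ke.
  apply: (lt_le_trans (sigmaP k i _)); first by apply: leq_trans kK; exact: leq_maxl.
  rewrite lef_pV2 ?posrE ?ltr0n// ler_nat ltnS.
  by apply: leq_trans kK; exact: leq_maxr.
apply: contrapT => nL.
have [e e0 He] : exists2 e : R, 0 < e &
    forall K, exists2 k, (K <= k)%N & e <= `|L x0 - L (u (sigma k))|.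
  apply: contrapT => H; apply: nL; apply/cvgrPdist_lt => e e0.
  apply: contrapT => H'; apply: H; exists e => // K; apply: contrapT => H''.
  apply: H'; exists K => // k /= Kk; rewrite ltNge; apply/negP => h.
  by apply: H''; exists k.
pose B := [set k | e <= `|L x0 - L (u (sigma k))|].
(* An ultrafilter on the indices at which [L] stays away from [L x0] yields a second weak limit
   [x1]; all [D k] agree on [x0] and [x1], so the two coincide. *)
have FP : ProperFilter (within B \oo).
  apply: Build_ProperFilter_ex => P [K _ HK].
  by have [k Kk Bk] := He K; exists k; apply: HK.
have [G1 [G1U G1F]] := ultraFilterLemma FP.
have G1oo P : (\oo : set_system nat) P -> G1 P.
  by move=> hP; apply: G1F; rewrite /within /=; apply: filterS hP => k Pk _.
have G1B : G1 B by apply: G1F; exact: withinT.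
have [x1 Hx1] := ultra_weak_cvg G1U (fun n => uC (sigma n)).
have x01 : x1 - x0 = 0.
  apply: Dnorm.
    move=> d d0; have d2 : 0 < d / 2 by rewrite divr_gt0.
    have [y1 Y1 h1] := wlim_span _ _ _ G1U (fun n => span_of_mem u (sigma n)) Hx1 _ d2.
    have [y0 Y0 h0] := wlim_span _ _ _ G0U (span_of_mem u) Hx0 _ d2.
    exists (-1 *: y0 + y1); first exact: (span_of_subspace u).2.
    rewrite scaleN1r (_ : _ - _ = (x1 - y1) - (x0 - y0)); last first.
      by rewrite opprD opprK addrA opprB [RHS]addrA [in RHS]addrAC addrAC; congr (_ + _); rewrite addrAC.
    rewrite (le_lt_trans (ler_normB _ _))// [ltRHS]splitr ltrD//.
  move=> k; rewrite dualB; apply/eqP; rewrite subr_eq0; apply/eqP.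
  apply: (cvgR_unique (Hx1 (D k))).
  by move=> P /(Dv k); exact: G1oo.
have /cvgrPdist_lt/(_ _ e0) h := Hx1 L.
have [k [Bk hk]] := filter_ex (filterI G1B h).
move: hk; rewrite /= (_ : x1 = x0) ?ltNge ?Bk//.
by apply/eqP; rewrite -subr_eq0 x01.
Qed.

End Ultralimits.

(** * Odd maps and the index *)

Section CountableFunctionals.
Context {R : realType} {W : completeNormedModType R}.
Hypothesis W_reflexive : reflexive_space W.
Variable B : W -> dual W.
Hypothesis B_compact : weak_to_strong_continuous B.
Hypothesis B_pos : forall u, u != 0 -> 0 < B u u.

Lemma compact_image_net (N e : R) : 0 < e -> exists s : seq (dual W),
  forall u, `|u| <= N -> exists2 L, L \in s & `|B u - L| < e.
Proof.
move=> e0; apply: contrapT => H.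
have /choice[nxt Hn] (s : seq (dual W)) : exists u, `|u| <= N /\
    forall L, L \in s -> e <= `|B u - L|.
  apply: contrapT => Hs; apply: H; exists s => u uN; apply: contrapT => Hu.
  apply: Hs; exists u; split => // L Ls; rewrite leNgt; apply/negP => h.
  by apply: Hu; exists L.
pose fix l n := if n is n'.+1 then B (nxt (l n')) :: l n' else [::].
pose v n := nxt (l n).
have lmem m n : (m < n)%N -> B (v m) \in l n.
  elim: n => // n IH; rewrite ltnS leq_eqVlt /= inE => /orP[/eqP->|/IH ->].
    by rewrite eqxx.
  by rewrite orbT.
have far m n : (m < n)%N -> e <= `|B (v n) - B (v m)|.
  by move=> mn; apply: (Hn (l n)).2; exact: lmem.
have [sigma [sinc [x vx]]] := weakly_convergent_subsequence W_reflexive (fun n => (Hn (l n)).1).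
have e2 : 0 < e / 2 by rewrite divr_gt0.
have /cvgrPdist_lt/(_ _ e2)[K _ HK] := B_compact vx.
have h1 := HK K (leqnn K); have h2 := HK K.+1 (leqnSn K).
have := far _ _ (sinc _ _ (ltnSn K)); rewrite leNgt => /negP; apply.
rewrite (_ : _ - _ = (B x - B (v (sigma K))) - (B x - B (v (sigma K.+1)))); last first.
  by rewrite opprB [RHS]addrC addrA subrK.
by rewrite (le_lt_trans (ler_normB _ _))// [ltRHS]splitr ltrD.
Qed.

(** The members of finite nets of the images of balls under [B]: one close enough to [B u] cannot
    vanish at [u], where [B u] is positive. *)
Lemma total_functionals : exists D : nat -> dual W, forall u, u != 0 -> exists k, D k u != 0.
Proof.
have /choice[net netP] (n : nat) : exists s : seq (dual W),
    forall u, `|u| <= n%:R -> exists2 L, L \in s & `|B u - L| < n.+1%:R^-1.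
  by apply: compact_image_net; rewrite invr_gt0.
exists (fun k => if (unpickle k : option (nat * nat)) is Some (n, i) then nth 0 (net n) i else 0).
move=> u u0; have Bu := B_pos u0; have nu : 0 < `|u| by rewrite normr_gt0.
(* So large that [u] lies in the ball of radius n and that an error of 1/(n+1) in the functional
   changes its value at [u] by less than [B u u]. *)
pose n := (Num.truncn (`|u| + `|u| / B u u)).+1.
have hn : `|u| + `|u| / B u u < n%:R by rewrite truncnS_gt.
have q0 : 0 < `|u| / B u u by rewrite divr_gt0.
have un : `|u| <= n%:R by lra.
have [L Ls BL] := netP n u un.
exists (pickle (n, index L (net n))); rewrite pickleK nth_index// gt_eqF//.
have h1 : `|(B u - L) u| <= `|B u - L| * `|u| by exact: dual_le.
have h2 : `|B u - L| * `|u| < B u u.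
  apply: (@lt_le_trans _ _ (n.+1%:R^-1 * `|u|)); first by rewrite ltr_pM2r.
  rewrite mulrC ler_pdivrMr// mulrC -ler_pdivrMr//.
  by rewrite -natr1; lra.
have := le_lt_trans (le_trans (ler_norm _) h1) h2.
by rewrite sub_dualE; lra.
Qed.

(** By reflexivity a total sequence of functionals spans a dense subspace of the dual, so vectors
    almost norming its rational combinations almost norm every functional. What [pseudo_gradient]
    requires is a constant above 1/2. *)
Lemma norming_directions : exists w : nat -> W, (forall i, `|w i| <= 1) /\
  forall L : dual W, exists i, 3 / 4 * `|L| <= L (w i).
Proof.
have [D HD] := total_functionals.
have /choice[dir dirP] (c : seq rat) : exists x : W, `|x| <= 1 /\
    9 / 10 * `|rat_comb D c| <= rat_comb D c x.
  set L := rat_comb D c.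
  have [L0|L0] := eqVneq L 0; first by exists 0; rewrite normr0 dual0 L0 normr0 mulr0.
  have nL : 0 < `|L| by rewrite normr_gt0.
  have e0 : 0 < 1 / 10 * `|L| by rewrite mulr_gt0//; lra.
  have [_ [x x1 <-]] := sup_adherent e0 (dual_norm_has_sup L).
  rewrite -[sup _]/(dual_norm L) -[dual_norm L]/(`|L|) => h.
  have h' : 9 / 10 * `|L| <= `|L x| by lra.
  have [Lx|Lx] := leP 0 (L x); first by exists x; rewrite ger0_norm// in h'.
  by exists (- x); rewrite normrN dualN; rewrite ltr0_norm// in h'.
exists (fun k => if (unpickle k : option (seq rat)) is Some c then dir c else 0); split.
  by move=> k; case: unpickle => [c|]; [exact: (dirP c).1|rewrite normr0].
move=> L; have [->|L0] := eqVneq L 0; first by exists 0%N; rewrite normr0 mulr0 zero_dualE.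
have nL : 0 < `|L| by rewrite normr_gt0.
have [|[X XD XL]] := separating_functional L (span_of_subspace D); last first.
  have [u Hu] := W_reflexive X.
  have u0 : u = 0.
    apply/eqP; apply: contrapT => /negP/HD[k /eqP]; apply.
    by rewrite -Hu XD//; exact: span_of_mem.
  by rewrite Hu u0 dual0 eqxx in XL.
have e0 : 0 < `|L| / 40 by rewrite divr_gt0.
move=> /(_ _ e0)[Y Ysp LY]; have [c Yc] := rat_comb_dense Ysp e0.
have Lc : `|L - rat_comb D c| < `|L| / 20.
  by apply: (le_lt_trans (ler_distD Y _ _)); lra.
exists (pickle c); rewrite pickleK; have [d1 d2] := dirP c.
have h1 : `|(L - rat_comb D c) (dir c)| <= `|L| / 20.
  apply: le_trans (dual_le _ _) _; apply: le_trans (ltW Lc).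
  by rewrite ler_piMr.
have h2 : `|L| <= `|L - rat_comb D c| + `|rat_comb D c|.
  by rewrite -{1}(subrK (rat_comb D c) L) ler_normD.
move: h1; rewrite sub_dualE ler_norml => /andP[h1 _]; lra.
Qed.

(** The coordinates are those of a total sequence of functionals, cut off so that near each nonzero
    point all but finitely many vanish, as the CW topology demands. *)
Lemma odd_sphere_map : exists f : W -> infinite_sphere R, forall u, u != 0 ->
  f @ u --> f u /\ sphere_val (f (- u)) = - sphere_val (f u).
Proof.
have [D0 HD0] := total_functionals.
pose D k : dual W := (`|D0 k| + 1)^-1 *: D0 k.
have D1 k u : `|D k u| <= `|u|.
  have p : 0 < `|D0 k| + 1 by rewrite ltr_wpDl.
  rewrite scale_dualE normrM gtr0_norm ?invr_gt0// mulrC ler_pdivrMr//.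
  rewrite (le_trans (dual_le _ _))// mulrC ler_wpM2l//; lra.
have HD u : u != 0 -> exists k, D k u != 0.
  move=> /HD0[k Dk]; exists k; rewrite scale_dualE; apply: mulf_neq0 => //.
(* The threshold is 0 at the first [i] with [D i u] nonzero, so some coordinate survives; afterwards
   it is at least j times [|D i u|], which finally exceeds the bound [|u|] on all coordinates. *)
pose tau u i : R := i%:R * \sum_(j < i) `|D j u|.
(* Odd soft thresholding at level [tau]: only finitely many coordinates of [z] are
   nonzero near a given point. *)
pose z u i : R := D i u + (`|D i u - tau u i| - `|D i u + tau u i|) / 2.
have tau0 u i : 0 <= tau u i by rewrite mulr_ge0// sumr_ge0.
have z0 u i : `|D i u| <= tau u i -> z u i = 0.
  rewrite ler_norml /z => /andP[h1 h2].
  by rewrite ler0_norm ?subr_le0// ger0_norm; [lra|rewrite -lerBlDr; lra].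
have zfirst u : u != 0 -> exists i, z u i != 0 /\ D i u != 0.
  move=> /HD ex; case: (ex_minnP ex) => i Di imin; exists i; split => //.
  rewrite /z (_ : tau u i = 0) ?subr0 ?addr0 ?subrr ?mul0r ?addr0//.
  rewrite /tau big1 ?mulr0// => j _; apply/eqP; rewrite normr_eq0.
  by apply: contraT => /imin; rewrite leqNgt ltn_ord.
have Dc i u : D i v @[v --> u] --> D i u by exact: dual_continuous.
have zc u i : z v i @[v --> u] --> z u i.
  have tc : tau v i @[v --> u] --> tau u i.
    apply: cvgM; first exact: cvg_cst.
    apply: (@cvg_big _ _ _ _ _ add_continuous _ (nbhs u) _ _ _ (nbhs_filter u)) => j _.
    by apply: cvg_norm; exact: Dc.
  apply: cvgD; first exact: Dc.
  apply: cvgM; last exact: cvg_cst.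
  apply: cvgB; apply: cvg_norm; [apply: cvgB|apply: cvgD]; by [exact: Dc|exact: tc].
have zsupp u : u != 0 -> exists n, \forall v \near u, supported n (z v).
  move=> /zfirst[i [_ Di]]; pose d := `|D i u| / 2.
  have d0 : 0 < d by rewrite divr_gt0// normr_gt0.
  pose n := maxn i (Num.truncn ((`|u| + 1) / d)).
  exists n; near=> v => j nj; apply: z0.
  have vu : `|u - v| < 1 by near: v; apply: cvgr_dist_lt.
  have Dv : `|D i u - D i v| < d.
    by near: v; have /cvgrPdist_lt := Dc i u; apply.
  have v1 : `|v| <= `|u| + 1.
    rewrite -{1}(subrK u v) (le_trans (ler_normD _ _))// addrC lerD2l distrC; exact: ltW.
  have Div : d <= `|D i v|.
    have : `|D i u| <= `|D i u - D i v| + `|D i v|.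
      by rewrite -{1}(subrK (D i v) (D i u)) ler_normD.
    move: Dv; rewrite /d; lra.
  apply: le_trans (D1 j v) _; apply: (le_trans v1).
  have ij : (i < j)%N by apply: leq_ltn_trans nj; exact: leq_maxl.
  apply: (@le_trans _ _ (j%:R * d)).
    rewrite -ler_pdivrMr//; apply: ltW.
    have := truncnS_gt ((`|u| + 1) / d); move/lt_le_trans; apply.
    by rewrite ler_nat; apply: leq_ltn_trans nj; exact: leq_maxr.
  rewrite ler_wpM2l//; apply: (le_trans Div).
  by rewrite (bigD1 (Ordinal ij))//= lerDl sumr_ge0.
exists (fun u => normalize (z u)) => u u0.
have [n zn] := zsupp u u0; have [i [zi _]] := zfirst u u0.
have zun : supported n (z u) by exact: nbhs_singleton zn.
split.
  apply: (@normalize_cvg _ _ (nbhs u) _ z _ n i) => //.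
  by move=> j; exact: zc.
have zN : z (- u) = - z u.
  apply/funext => j; rewrite fctE /z dualN (_ : tau (- u) j = tau u j); last first.
    by congr (_ * _); apply: eq_bigr => k _; rewrite dualN normrN.
  rewrite -opprD normrN (_ : - D j u + tau u j = - (D j u - tau u j)) ?normrN; last by ring.
  ring.
have zNn : supported n (- z u) by move=> j nj; rewrite fctE zun ?oppr0.
have zNi : (- z u) i != 0 by rewrite fctE oppr_eq0.
rewrite zN (normalizeE zun zi) (normalizeE zNn zNi) (dotN _ zun) dotC (dotN _ zun) opprK.
by apply/funext => j; rewrite !fctE mulNr.
Unshelve. all: by end_near. Qed.

End CountableFunctionals.

(** * Monotonicity and bounds of the index *)

Section IndexProperties.
Context {R : realType} {W : normedModType R}.
Variable f : W -> infinite_sphere R.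
Hypothesis f_map : forall u, u != 0 ->
  f @ u --> f u /\ sphere_val (f (- u)) = - sphere_val (f u).
Implicit Types (M : set W).

Lemma fr_index_gt0_mem M k : (1 <= k)%N -> (k%:R%:E <= fr_index M)%E -> exists x : M, True.
Proof.
rewrite /fr_index; case: eqP => [_ k1|/eqP/set0P[u Mu] _ _].
  by rewrite lee_fin lern0 => /eqP k0; rewrite k0 in k1.
by exists (exist _ u (mem_set Mu)).
Qed.

Lemma odd_on_neq0 M (eps : W -> 'F_2) : ~ M 0 ->
  (forall x, x != 0 -> eps (- x) = eps x + 1) -> odd_on M eps.
Proof. by move=> M0 oe x Mx; apply: oe; apply/eqP => x0; apply: M0; rewrite -x0. Qed.

Lemma fr_index_ge M m (eps : W -> 'F_2) (x0 : M) : symmetric_set M -> ~ M 0 ->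
  odd_on M eps -> ~ power_trivial M eps m -> (m.+1%:R%:E <= fr_index M)%E.
Proof.
move=> Ms M0 oe nM.
have Mn0 (x : M) : set_val x != 0.
  by apply/eqP => E; apply: M0; rewrite -E; case: x {E} => u uM; exact: set_mem uM.
apply: (@power_nontrivial_fr_index_ge _ _ _ Ms M0 x0 eps m (f \o set_val)) => //.
  move=> x; apply: continuous_comp; first exact: initial_continuous.
  exact: (f_map (Mn0 x)).1.
by move=> x y E /=; rewrite E (f_map (Mn0 x)).2.
Qed.

Lemma index_image M M' k (phi : W -> W) : symmetric_set M -> symmetric_set M' ->
  ~ M 0 -> ~ M' 0 -> (forall x, M x -> M' (phi x)) ->
  (forall x, M x -> phi (- x) = - phi x) -> cont_on M phi ->
  (1 <= k)%N -> (k%:R%:E <= fr_index M)%E -> (k%:R%:E <= fr_index M')%E.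
Proof.
move=> Ms Ms' M0 M0' MM' phiN phiC k1 kM; have [x0 _] := fr_index_gt0_mem k1 kM.
have [eps oe] := @exists_odd R W.
have oM := odd_on_neq0 M0 oe; have oM' := odd_on_neq0 M0' oe.
have [m km nM] := fr_index_ge_power_nontrivial Ms M0 x0 oM k1 kM.
have Mx0 : M (set_val x0) by case: x0 => u uM; exact: set_mem uM.
apply: (@le_trans _ _ (m.+1%:R : R)%:E); first by rewrite lee_fin ler_nat.
pose y0 : M' := exist (fun u => u \in M') _ (mem_set (MM' _ Mx0)).
apply: (@fr_index_ge M' m eps y0 Ms' M0' oM').
by move=> h; apply: nM; exact: (power_trivial_comp M0 M0' oM oM' MM' phiN phiC h).
Qed.

Lemma index_le_cover M k (phis : seq (W -> R)) : symmetric_set M -> ~ M 0 ->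
  (forall phi, List.In phi phis -> forall z : W, M z -> phi (- z) = - phi z /\ phi @ z --> phi z) ->
  (forall z, M z -> exists2 phi, List.In phi phis & phi z != 0) ->
  (1 <= k)%N -> (k%:R%:E <= fr_index M)%E -> (k <= size phis)%N.
Proof.
move=> Ms M0 Hphi cov k1 kM; have [x0 _] := fr_index_gt0_mem k1 kM.
have [eps oe] := @exists_odd R W; have oM := odd_on_neq0 M0 oe.
have [m km nM] := fr_index_ge_power_nontrivial Ms M0 x0 oM k1 kM.
rewrite leqNgt; apply/negP => h; apply: nM.
by apply: (power_trivial_cover M0 oM _ Hphi cov); rewrite -ltnS (leq_trans h).
Qed.

Lemma index_sphere M k (phi : 'rV[R]_k.+1 -> W) : symmetric_set M -> ~ M 0 ->
  (forall x, cross_polytope x -> [/\ M (phi x), phi (- x) = - phi x & phi @ x --> phi x]) ->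
  (k.+1%:R%:E <= fr_index M)%E.
Proof.
move=> Ms M0 Hphi; have [eps oe] := @exists_odd R W; have oM := odd_on_neq0 M0 oe.
have [K [_ KS sK]] := @cross_polytope_face R k 0 [:: cross_vertex k 0] (leq0n k) erefl.
have /Hphi[Mx _ _] : cross_polytope (cross_vertex k 0 : 'rV[R]_k.+1).
  by apply: KS; apply: sK; rewrite inE eqxx.
pose x0 : M := exist (fun u => u \in M) _ (mem_set Mx).
apply: (@fr_index_ge M k eps x0 Ms M0 oM).
exact: power_nontrivial_sphere oM Hphi.
Qed.

End IndexProperties.

(** * Potentials *)

Section PotentialCalculus.
Context {R : realType} {W : completeNormedModType R}.
Local Notation mu := (@lebesgue_measure R).
Implicit Types (p : W -> dual W) (u v x : W).

Lemma is_derive_line (E : W -> R) (x v : W) (t : R) (L : dual W) :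
  is_diff (x + t *: v) E (L : W -> R) ->
  is_derive t (1 : R) (fun tau : R => E (x + tau *: v)) (L v).
Proof.
move=> dE.
have dl : is_diff t (fun tau : R => x + tau *: v) (fun tau : R => tau *: v).
  have -> : (fun tau : R => x + tau *: v) = cst x + ( *:%R^~ v : R -> W) by apply/funext.
  apply: (@is_diff_eq _ _ _ _ (0 + ( *:%R^~ v : R -> W))); last by rewrite add0r.
have dc := @is_diff_comp R R^o W R^o (fun tau : R => x + tau *: v) (fun tau : R => tau *: v) E L t dl dE.
have df := @ex_diff _ _ _ _ _ _ _ dc.
apply: DeriveDef; first exact: diff_derivable.
by rewrite (deriveE _ df) (@diff_val _ _ _ _ _ _ _ dc) /= scale1r.
Qed.

Lemma line_mvt (E : W -> R) (dE : W -> dual W) (x v : W) (T : R) : 0 < T ->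
  (forall t, 0 <= t <= T -> is_diff (x + t *: v) E (dE (x + t *: v) : W -> R)) ->
  exists2 t, 0 < t < T & E (x + T *: v) - E x = T * dE (x + t *: v) v.
Proof.
move=> T0 HE.
have [||t] := @MVT R (fun t => E (x + t *: v)) (fun t => dE (x + t *: v) v) 0 T T0.
- move=> t; rewrite in_itv /= => /andP[t0 tT]; apply: is_derive_line; apply: HE.
  by rewrite !ltW.
- apply: derivable_within_continuous => t; rewrite in_itv /= => t0T.
  exact: (@ex_derive _ _ _ _ _ _ _ (is_derive_line (HE t t0T))).
by rewrite in_itv /= => tT; rewrite scale0r addr0 subr0 => ->; exists t => //; rewrite mulrC.
Qed.

Variable p : W -> dual W.
Hypothesis p_pot : potential_operator p.

Let p_line_continuous u : continuous (fun tau : R => p (tau *: u) u).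
Proof.
move=> t; have [pc _] := p_pot.
have h : p (tau *: u) @[tau --> t] --> p (t *: u).
  apply: (@cvg_comp _ _ _ (fun tau : R => tau *: u) p (nbhs t) (nbhs (t *: u))); last exact: pc.
  by apply: cvgZ; [exact: cvg_id|exact: cvg_cst].
apply/cvgrPdist_lt => e e0.
have e1 : 0 < e / (`|u| + 1) by rewrite divr_gt0.
have /cvgrPdist_lt/(_ _ e1) := h; apply: filterS => tau.
rewrite ltr_pdivlMr// => h1; rewrite -sub_dualE (le_lt_trans (dual_le _ _))//.
by apply: le_lt_trans h1; rewrite ler_wpM2l// lerDl.
Qed.

Lemma potential_primitive : exists P : W -> R,
  (forall u, is_diff u P (p u : W -> R)) /\ forall u, potential p u = P u - P 0.
Proof.
have [pc [P dP]] := p_pot; exists P; split => // u.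
have dF (t : R) : is_derive t (1 : R) (fun tau : R => P (0 + tau *: u)) (p (t *: u) u).
  by have := @is_derive_line P 0 u t (p (t *: u)); rewrite add0r; apply.
have Fc : continuous (fun tau : R => P (0 + tau *: u)).
  move=> t; apply: differentiable_continuous; apply/derivable1_diffP.
  exact: (@ex_derive _ _ _ _ _ _ _ (dF t)).
rewrite /potential /Rintegral (@continuous_FTC2 R _ (fun tau : R => P (0 + tau *: u)))//.
- by rewrite -EFinB /= add0r scale1r scale0r addr0.
- by apply: continuous_subspaceT => t; exact: p_line_continuous.
- split.
  + by move=> t _; exact: (@ex_derive _ _ _ _ _ _ _ (dF t)).
  + by apply: cvg_at_right_filter; exact: Fc.
  + by apply: cvg_at_left_filter; exact: Fc.
- by move=> t _; rewrite derive1E; exact: (@derive_val _ _ _ _ _ _ _ (dF t)).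
Qed.

Lemma is_diff_potential u : is_diff u (potential p) (p u : W -> R).
Proof.
have [P [dP E]] := potential_primitive.
have -> : potential p = P - cst (P 0) by apply/funext => x; rewrite E.
apply: (@is_diff_eq _ _ _ _ ((p u : W -> R) - 0)); last by rewrite subr0.
Qed.

Lemma potential_continuous : continuous (potential p).
Proof. by move=> u; apply: differentiable_continuous; exact: (@ex_diff _ _ _ _ _ _ _ (is_diff_potential u)). Qed.

Lemma potential0 : potential p 0 = 0.
Proof. by have [P [_ ->]] := potential_primitive; rewrite subrr. Qed.

Lemma potential_mvt u v : exists2 t : R, 0 < t < 1 &
  potential p v - potential p u = p (u + t *: (v - u)) (v - u).
Proof.
have [t t01] := @line_mvt (potential p) p u (v - u) 1 ltr01 (fun t _ => is_diff_potential _).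
by rewrite scale1r mul1r [u + (v - u)]addrC subrK => E; exists t.
Qed.

Lemma potential_gt0 : (forall u, u != 0 -> 0 < p u u) -> forall u, u != 0 -> 0 < potential p u.
Proof.
move=> ppos u u0; have [t /andP[t0 _]] := potential_mvt 0 u.
rewrite potential0 !subr0 add0r => ->.
have : 0 < p (t *: u) (t *: u) by apply: ppos; rewrite scaler_eq0 negb_or gt_eqF.
by rewrite dualZ pmulr_rgt0.
Qed.

Lemma potentialN u : odd_operator p -> potential p (- u) = potential p u.
Proof.
move=> po; congr (Rintegral _ _ _); apply/funext => t.
by rewrite scalerN po dualN opprK.
Qed.

Lemma potential_homogeneous scl s d u t : is_scaling scl s -> homogeneous scl d p ->
  0 <= t -> potential p (scl u t) = t `^ d * potential p u.
Proof.
move=> Hs Hd t0; rewrite /potential -RintegralZl//; last first.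
  apply: continuous_compact_integrable; first exact: segment_compact.
  by apply: continuous_subspaceT; exact: p_line_continuous.
congr (Rintegral _ _ _); apply/funext => tau.
by rewrite -(sclZ Hs)// Hd.
Qed.

Lemma weakly_cvg_segment (u_ : nat -> W) u (t_ : nat -> R) :
  (forall n, 0 < t_ n < 1) -> weakly_cvg u_ u ->
  weakly_cvg (fun n => u + t_ n *: (u_ n - u)) u.
Proof.
move=> t01 uu L; apply/cvgrPdist_lt => e e0.
have /cvgrPdist_lt/(_ _ e0) := uu L; apply: filterS => n h.
rewrite dualD dualZ dualB opprD addrA subrr add0r normrN normrM.
apply: le_lt_trans h; rewrite [leRHS]distrC ler_piMl//.
by have /andP[t0 t1] := t01 n; rewrite gtr0_norm// ltW.
Qed.

Lemma weak_pairing (L_ : nat -> dual W) (L : dual W) (u_ : nat -> W) u (C : R) :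
  (forall n, `|u_ n| <= C) -> weakly_cvg u_ u -> L_ n @[n --> \oo] --> L ->
  L_ n (u_ n) @[n --> \oo] --> L u.
Proof.
move=> uC uu LL; apply/cvgrPdist_lt => e e0.
have C0 : 0 <= C by exact: le_trans (uC 0%N).
have e2 : 0 < e / 2 by rewrite divr_gt0.
have e3 : 0 < e / 2 / (C + 1) by rewrite divr_gt0// ltr_wpDl.
have /cvgrPdist_lt/(_ _ e2) h1 := uu L; have /cvgrPdist_lt/(_ _ e3) h2 := LL.
apply: filterS2 h1 h2 => n h1 h2.
have -> : L u - L_ n (u_ n) = (L u - L (u_ n)) + (L - L_ n) (u_ n).
  by rewrite sub_dualE addrA subrK.
rewrite (le_lt_trans (ler_normD _ _))// [ltRHS]splitr ltrD//.
apply: le_lt_trans (dual_le _ _) _; move: h2; rewrite ltr_pdivlMr ?ltr_wpDl// => h2.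
by apply: le_lt_trans h2; rewrite ler_wpM2l// (le_trans (uC n))// lerDl.
Qed.

Lemma weakly_cvg_subr (u_ : nat -> W) u : weakly_cvg u_ u -> weakly_cvg (fun n => u_ n - u) 0.
Proof.
move=> uu L; rewrite dual0 -(subrr (L u)); under eq_fun do rewrite dualB.
by apply: cvgB; [exact: uu|exact: cvg_cst].
Qed.

(** By the mean value theorem the difference is the value of a strongly convergent sequence of
    functionals on the weakly null sequence [u_ n - u]. *)
Lemma potential_weakly_continuous (u_ : nat -> W) u (C : R) :
  weak_to_strong_continuous p -> (forall n, `|u_ n| <= C) -> weakly_cvg u_ u ->
  potential p (u_ n) @[n --> \oo] --> potential p u.
Proof.
move=> pw uC uu.
have /choice[t_ tP] n : exists t : R, 0 < t < 1 /\
    potential p (u_ n) - potential p u = p (u + t *: (u_ n - u)) (u_ n - u).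
  by have [t ? ?] := potential_mvt u (u_ n); exists t.
have pc := pw _ _ (weakly_cvg_segment (fun n => (tP n).1) uu).
have := weak_pairing (C := C + `|u|) _ (weakly_cvg_subr uu) pc.
rewrite dual0 => /(_ _)/wrap[].
  by move=> n; rewrite (le_trans (ler_normB _ _))// lerD2r.
move=> h; have : potential p (u_ n) - potential p u + potential p u @[n --> \oo] --> 0 + potential p u.
  by apply: cvgD; [under eq_fun do rewrite (tP _).2|exact: cvg_cst].
by rewrite add0r; under eq_fun do rewrite subrK.
Qed.

End PotentialCalculus.

(** * The scaled Nehari set *)

(** Young's inequality with equality at t = 1: the form of convexity that [nehari_min] uses. *)
Lemma powR_young {R : realType} (a b t : R) : 0 < a -> a < b -> 0 < t ->
  b * t `^ a <= a * t `^ b + (b - a).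
Proof.
move=> a0 ab t0; have b0 : 0 < b by exact: lt_trans ab.
have ba : 0 < b - a by rewrite subr_gt0.
have := @conjugate_powR R (t `^ a) 1 (b / a) (b / (b - a)) (powR_ge0 _ _) ler01
  (divr_gt0 b0 a0) (divr_gt0 b0 ba).
have e : (b / a)^-1 + (b / (b - a))^-1 = 1.
  by field; rewrite !gt_eqF.
move=> /(_ e); rewrite mulr1 powR1 -powRrM mulrCA divff ?gt_eqF// mulr1 => h.
have := ler_wpM2l (ltW b0) h; move=> /le_trans; apply.
rewrite le_eqVlt; apply/orP; left; apply/eqP.
by field; rewrite !gt_eqF.
Qed.

(** * Derivatives of lambda_c and Phi_lambda *)

Section Dlam.
Context {R : realType} {W : completeNormedModType R}.
Variables (A B f g : W -> dual W).
Hypotheses (A_pot : potential_operator A) (B_pot : potential_operator B)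
  (f_pot : potential_operator f) (g_pot : potential_operator g).
Hypothesis B_pos : forall u, u != 0 -> 0 < B u u.

Local Notation lam := (lambda_fun A B f g).

Let J_gt0 u : u != 0 -> 0 < potential B u.
Proof. exact: potential_gt0. Qed.

Definition dlam c u : dual W :=
  (potential B u)^-1 *: (A u - f u - g u - lam c u *: B u).

Lemma is_diff_lambda_fun c u : u != 0 -> is_diff u (lam c) (dlam c u : W -> R).
Proof.
move=> u0; have J0 := J_gt0 u0; have J1 : potential B u != 0 by rewrite gt_eqF.
have dI := is_diff_potential A_pot u; have dJ := is_diff_potential B_pot u.
have dF := is_diff_potential f_pot u; have dG := is_diff_potential g_pot u.
have dN : is_diff u (potential A - potential f - potential g - cst c)
   ((A u : W -> R) - (f u : W -> R) - (g u : W -> R) - 0) by exact: is_diffB.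
have dV : is_diff u (fun y => (potential B y)^-1)
    (- (potential B u) ^- 2 \*: (B u : W -> R)).
  have dJ' := @ex_diff _ _ _ _ _ _ _ dJ.
  split; first exact: differentiableV.
  by rewrite diffV// (@diff_val _ _ _ _ _ _ _ dJ).
have -> : lam c = (potential A - potential f - potential g - cst c) * (fun y => (potential B y)^-1).
  by apply/funext.
apply: is_diff_eq; apply/funext => v.
rewrite /dlam scale_dualE !sub_dualE scale_dualE /lambda_fun !fctE /= subr0.
rewrite /GRing.scale /=; field; exact/J1.
Qed.

Lemma lambda_fun_continuous c u : u != 0 -> lam c @ u --> lam c u.
Proof.
move=> u0; have := @ex_diff _ _ _ _ _ _ _ (is_diff_lambda_fun c u0).
exact: differentiable_continuous.
Qed.

Lemma dlam_continuous c u : u != 0 -> dlam c @ u --> dlam c u.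
Proof.
move=> u0; apply: cvgZ.
  by apply: cvgV; [rewrite gt_eqF// J_gt0|exact: potential_continuous].
have [Ac _] := A_pot; have [Bc _] := B_pot; have [fc _] := f_pot; have [gc _] := g_pot.
apply: cvgB; last by apply: cvgZ; [exact: lambda_fun_continuous|exact: Bc].
by apply: cvgB; [apply: cvgB; [exact: Ac|exact: fc]|exact: gc].
Qed.

Lemma critical_lambda_fun c u : u != 0 -> critical_point (lam c) u <-> dlam c u = 0.
Proof.
move=> u0; have D := is_diff_lambda_fun c u0; split.
  move=> [_ H]; apply: dual_ext => v.
  by rewrite -[dlam c u v]/((dlam c u : W -> R) v) -(@diff_val _ _ _ _ _ _ _ D) H.
move=> E; split; first exact: (@ex_diff _ _ _ _ _ _ _ D).
by move=> v; rewrite (@diff_val _ _ _ _ _ _ _ D) E.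
Qed.

Lemma dlam_eq0 c u : u != 0 -> dlam c u = 0 <->
  A u = lam c u *: B u + f u + g u.
Proof.
move=> u0; have J1 : potential B u != 0 by rewrite gt_eqF// J_gt0.
split=> E; apply: dual_ext => v; last first.
  have Ev : A u v = lam c u * B u v + f u v + g u v by rewrite E.
  by rewrite /dlam scale_dualE !sub_dualE scale_dualE zero_dualE Ev; ring.
have /eqP := congr1 (fun L : dual W => L v) E.
rewrite /dlam scale_dualE !sub_dualE scale_dualE zero_dualE mulf_eq0 invr_eq0 (negbTE J1) /=.
move=> /eqP h; rewrite -[RHS]/(lam c u * B u v + f u v + g u v); move: h; lra.
Qed.

Lemma is_diff_Phi l u : is_diff u (Phi A B f g l) ((A u - l *: B u - f u - g u : dual W) : W -> R).
Proof.
have dI := is_diff_potential A_pot u; have dJ := is_diff_potential B_pot u.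
have dF := is_diff_potential f_pot u; have dG := is_diff_potential g_pot u.
have -> : Phi A B f g l = potential A - l \*: potential B - potential f - potential g.
  by apply/funext.
exact: is_diff_eq.
Qed.

Lemma critical_Phi l u : critical_point (Phi A B f g l) u <-> A u = l *: B u + f u + g u.
Proof.
have D := is_diff_Phi l u; split.
  move=> [_ H]; apply: dual_ext => v; have := H v; rewrite (@diff_val _ _ _ _ _ _ _ D).
  rewrite !sub_dualE scale_dualE => E.
  rewrite -[RHS]/(l * B u v + f u v + g u v); move: E; lra.
move=> E; split; first exact: (@ex_diff _ _ _ _ _ _ _ D).
move=> v; have Ev : A u v = l * B u v + f u v + g u v by rewrite E.
by rewrite (@diff_val _ _ _ _ _ _ _ D) !sub_dualE scale_dualE Ev; ring.
Qed.

Lemma lambda_fun_Phi c l u : u != 0 -> lam c u = l <-> Phi A B f g l u = c.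
Proof.
move=> u0; have J1 : potential B u != 0 by rewrite gt_eqF// J_gt0.
rewrite /lambda_fun /Phi; split.
  by move=> <-; field.
by move=> <-; field.
Qed.

End Dlam.

Record framework {R : realType} {W : completeNormedModType R}
    (scl : W -> R -> W) (q s r : R) (A B f g : W -> dual W) : Prop := Framework {
  fw_reflexive : reflexive_space W ;
  fw_scaling : is_scaling scl s ;
  fw_A : scaled_operator scl s A ;
  fw_B : scaled_operator scl s B ;
  fw_f_odd : odd_operator f ;
  fw_f_potential : potential_operator f ;
  fw_g_odd : odd_operator g ;
  fw_g_potential : potential_operator g ;
  fw_A_gt0 : forall u, u != 0 -> 0 < A u u ;
  fw_A_compact : forall (u_ : nat -> W) u, weakly_cvg u_ u ->
    A (u_ j) (u_ j - u) @[j --> \oo] --> (0 : R) ->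
    exists sigma : nat -> nat, {homo sigma : m n / (m < n)%N} /\
      u_ (sigma j) @[j --> \oo] --> u ;
  fw_B_gt0 : forall u, u != 0 -> 0 < B u u ;
  fw_B_weak : weak_to_strong_continuous B ;
  fw_coercive : forall K : R, exists rho : R, forall u, rho <= `|u| -> K <= potential A u ;
  fw_q_gt0 : 0 < q ;
  fw_q_lt_s : q < s ;
  fw_s_lt_r : s < r ;
  fw_f_homogeneous : homogeneous scl q f ;
  fw_g_homogeneous : homogeneous scl r g ;
  fw_f_weak : weak_to_strong_continuous f ;
  fw_g_weak : weak_to_strong_continuous g ;
  fw_H3 : forall (alpha beta gamma delta : R) u,
    alpha *: A u = beta *: B u + gamma *: f u + delta *: g u ->
    s * alpha * potential A u =
      s * beta * potential B u + q * gamma * potential f u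
      + r * delta * potential g u ;
  fw_F_gt0 : forall u, u != 0 -> 0 < potential f u ;
  fw_G_lt0 : forall u, u != 0 -> potential g u < 0 }.

Section Nehari.
Context {R : realType} {W : completeNormedModType R}
  {scl : W -> R -> W} {q s r : R} {A B f g : W -> dual W}.
Hypothesis FW : framework scl q s r A B f g.

Let A1_5 : is_scaling scl s. Proof. exact: fw_scaling FW. Qed.
Let A_scaled : scaled_operator scl s A. Proof. exact: fw_A FW. Qed.
Let B_scaled : scaled_operator scl s B. Proof. exact: fw_B FW. Qed.
Let f_odd : odd_operator f. Proof. exact: fw_f_odd FW. Qed.
Let f_pot : potential_operator f. Proof. exact: fw_f_potential FW. Qed.
Let g_odd : odd_operator g. Proof. exact: fw_g_odd FW. Qed.
Let g_pot : potential_operator g. Proof. exact: fw_g_potential FW. Qed.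
Let A6 : forall u, u != 0 -> 0 < A u u. Proof. exact: fw_A_gt0 FW. Qed.
Let A8 : forall u, u != 0 -> 0 < B u u. Proof. exact: fw_B_gt0 FW. Qed.
Let q_gt0 : 0 < q. Proof. exact: fw_q_gt0 FW. Qed.
Let q_lt_s : q < s. Proof. exact: fw_q_lt_s FW. Qed.
Let s_lt_r : s < r. Proof. exact: fw_s_lt_r FW. Qed.
Let H1f : homogeneous scl q f. Proof. exact: fw_f_homogeneous FW. Qed.
Let H1g : homogeneous scl r g. Proof. exact: fw_g_homogeneous FW. Qed.
Let F_gt0 : forall u, u != 0 -> 0 < potential f u. Proof. exact: fw_F_gt0 FW. Qed.
Let G_lt0 : forall u, u != 0 -> potential g u < 0. Proof. exact: fw_G_lt0 FW. Qed.

Local Notation I := (potential A).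
Local Notation J := (potential B).
Local Notation F := (potential f).
Local Notation G := (potential g).
Local Notation lam := (lambda_fun A B f g).
Local Notation N := (nehari scl A B f g).

Let s_gt0 : 0 < s. Proof. exact: lt_trans q_lt_s. Qed.
Let r_gt0 : 0 < r. Proof. exact: lt_trans s_lt_r. Qed.

Lemma A_potential : potential_operator A. Proof. by case: A_scaled. Qed.
Lemma B_potential : potential_operator B. Proof. by case: B_scaled. Qed.
Let A_odd : odd_operator A. Proof. by case: A_scaled. Qed.
Let B_odd : odd_operator B. Proof. by case: B_scaled. Qed.

Lemma I_gt0 u : u != 0 -> 0 < I u. Proof. exact: (potential_gt0 A_potential). Qed.
Lemma J_gt0 u : u != 0 -> 0 < J u. Proof. exact: (potential_gt0 B_potential). Qed.

Lemma I_scl u t : 0 <= t -> I (scl u t) = t `^ s * I u.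
Proof. by move=> t0; case: A_scaled => _ hp _ hh; exact: (potential_homogeneous hp u A1_5 hh t0). Qed.
Lemma J_scl u t : 0 <= t -> J (scl u t) = t `^ s * J u.
Proof. by move=> t0; case: B_scaled => _ hp _ hh; exact: (potential_homogeneous hp u A1_5 hh t0). Qed.
Lemma F_scl u t : 0 <= t -> F (scl u t) = t `^ q * F u.
Proof. by move=> t0; exact: (potential_homogeneous f_pot u A1_5 H1f t0). Qed.
Lemma G_scl u t : 0 <= t -> G (scl u t) = t `^ r * G u.
Proof. by move=> t0; exact: (potential_homogeneous g_pot u A1_5 H1g t0). Qed.

Lemma sclN u t : 0 <= t -> scl (- u) t = - scl u t.
Proof. by move=> t0; rewrite -scaleN1r (sclZ A1_5)// scaleN1r. Qed.

Lemma scl0v t : 0 <= t -> scl 0 t = 0.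
Proof. by move=> t0; have := sclZ A1_5 0 0 t0; rewrite !scale0r. Qed.

Lemma sclK u t : 0 < t -> scl (scl u t) t^-1 = u.
Proof.
by move=> t0; rewrite (sclA A1_5) ?invr_ge0 ?ltW// divff ?gt_eqF// (scl1 A1_5).
Qed.

Lemma scl_neq0 u t : u != 0 -> 0 < t -> scl u t != 0.
Proof.
move=> u0 t0; apply: contra u0 => /eqP E; rewrite -(sclK u t0) E scl0v//.
by rewrite invr_ge0 ltW.
Qed.

Lemma lam_opp c u : lam c (- u) = lam c u.
Proof.
by rewrite /lambda_fun !potentialN.
Qed.

(* Up to a positive factor, the derivative along the ray through u of lambda_c. *)
Definition nehari_fun (u : W) : R := (s - q) * F u - (r - s) * G u.

Lemma nehari_fun_gt0 u : u != 0 -> 0 < nehari_fun u.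
Proof.
move=> u0; rewrite /nehari_fun subr_gt0; apply: (@lt_trans _ _ 0).
  by rewrite pmulr_rlt0 ?subr_gt0// G_lt0.
by rewrite mulr_gt0 ?subr_gt0 ?F_gt0.
Qed.

Lemma nehari_fun_continuous : continuous nehari_fun.
Proof.
by move=> u; apply: cvgB; apply: cvgM; try exact: cvg_cst; exact: potential_continuous.
Qed.

Lemma is_derive_ray (c : R) (u : W) (t : R) : u != 0 -> 0 < t ->
  is_derive t (1 : R) (fun tau : R => lam c (scl u tau))
    (t `^ (- s - 1) / J u * (nehari_fun (scl u t) + c * s)).
Proof.
move=> u0 t0; have J0 := J_gt0 u0; have J1 : J u != 0 by rewrite gt_eqF.
pose h := cst (I u / J u) + ((- (F u / J u)) \*: (powR (R:=R))^~ (q - s)) +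
   ((- (G u / J u)) \*: (powR (R:=R))^~ (r - s)) + ((- (c / J u)) \*: (powR (R:=R))^~ (- s)).
have dh : is_derive t (1 : R) h
   (0 + (- (F u / J u)) *: ((q - s) * t `^ (q - s - 1)) +
   (- (G u / J u)) *: ((r - s) * t `^ (r - s - 1)) + (- (c / J u)) *: (- s * t `^ (- s - 1))).
  have d1 := is_derive1_powR (q - s) t0; have d2 := is_derive1_powR (r - s) t0.
  have d3 := is_derive1_powR (- s) t0.
  by rewrite /h; do 3!apply: is_deriveD.
apply: (@near_eq_is_derive _ _ _ h).
  near=> tau; have tau0 : 0 < tau by near: tau; exact: lt_nbhsr.
  have ts0 : tau `^ s != 0 by rewrite gt_eqF// powR_gt0.
  rewrite /h /lambda_fun I_scl ?J_scl ?F_scl ?G_scl ?ltW// !fctE /=.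
  rewrite !powRB ?(gt_eqF tau0) ?implybT// (powRN tau s) /GRing.scale /=.
  by field; rewrite J1 ts0.
apply: (is_derive_eq dh); rewrite /nehari_fun F_scl ?G_scl ?ltW//.
have -> : q - s - 1 = q + (- s - 1) by ring.
have -> : r - s - 1 = r + (- s - 1) by ring.
rewrite !(@powRD _ t _ (- s - 1)) ?(gt_eqF t0) ?implybT// /GRing.scale /=.
by field; exact/J1.
Unshelve. all: by end_near. Qed.

Lemma nehariP c u : N c u <-> u != 0 /\ nehari_fun u + c * s = 0.
Proof.
split.
  move=> [v [t [Mv t0 dv ->]]].
  have v0 : v != 0.
    by apply/eqP => v0; move: Mv; rewrite /Ms /= v0 (potential0 A_potential) => /eqP; rewrite eq_sym oner_eq0.
  split; first exact: scl_neq0.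
  have dv' := is_derive_ray c v0 t0.
  have := @derive_val _ _ _ _ _ _ _ dv; rewrite (@derive_val _ _ _ _ _ _ _ dv') => /eqP.
  by rewrite !mulf_eq0 invr_eq0 (gt_eqF (J_gt0 v0)) (gt_eqF (powR_gt0 _ t0)) /= => /eqP.
(* By homogeneity, the time at which the ray that starts on [Ms] arrives at [u]. *)
move=> [u0 E]; pose t := I u `^ s^-1.
have t0 : 0 < t by apply: powR_gt0; exact: I_gt0.
have ts : t `^ s = I u.
  by rewrite /t -powRrM mulVf ?gt_eqF// powRr1// ltW// I_gt0.
have v0 : scl u t^-1 != 0 by apply: scl_neq0 => //; rewrite invr_gt0.
have uE : scl (scl u t^-1) t = u by rewrite -{2}(invrK t) sclK// invr_gt0.
exists (scl u t^-1), t; split => //.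
- rewrite /Ms /= I_scl ?invr_ge0 ?ltW// -ts -powRM ?invr_ge0 ?ltW//.
  by rewrite mulVf ?gt_eqF// powR1.
- by apply: is_derive_eq (is_derive_ray c v0 t0) _; rewrite uE E mulr0.
Qed.

Lemma nehari_neq0 c u : N c u -> u != 0. Proof. by move=> /nehariP[]. Qed.

Lemma nehari_not0 c : ~ N c 0. Proof. by move=> /nehari_neq0; rewrite eqxx. Qed.

Lemma nehari_funN u : nehari_fun (- u) = nehari_fun u.
Proof. by rewrite /nehari_fun !potentialN. Qed.

Lemma nehari_fun_scl u t : 0 <= t ->
  nehari_fun (scl u t) = (s - q) * F u * t `^ q - (r - s) * G u * t `^ r.
Proof. by move=> t0; rewrite /nehari_fun F_scl// G_scl//; ring. Qed.

(** Both terms increase because F > 0 > G. Each ray therefore meets the Nehari set at most once. *)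
Lemma nehari_fun_scl_lt u t t' : u != 0 -> 0 <= t -> t < t' ->
  nehari_fun (scl u t) < nehari_fun (scl u t').
Proof.
move=> u0 t0 tt'; have t'0 : 0 < t' by exact: le_lt_trans tt'.
rewrite !nehari_fun_scl ?(ltW t'0)//.
have h1 : t `^ q < t' `^ q by apply: gt0_ltr_powR => //; rewrite nnegrE ?(ltW t'0).
have h2 : t `^ r < t' `^ r by apply: gt0_ltr_powR => //; rewrite nnegrE ?(ltW t'0).
rewrite ltrD// ?ltrN2.
  by rewrite ltr_pM2l// mulr_gt0 ?subr_gt0 ?F_gt0.
by rewrite ltr_nM2l// pmulr_rlt0 ?subr_gt0// G_lt0.
Qed.

(** Once the denominators are cleared and c is eliminated through the Nehari equation, I cancels;
    what is left is the sum of two instances of [powR_young], for q < s with weight F and for s < r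
    with weight -G. *)
Lemma nehari_min c u t : N c u -> 0 < t -> lam c u <= lam c (scl u t).
Proof.
move=> /nehariP[u0 E] t0; have J0 := J_gt0 u0; have ts0 : 0 < t `^ s by exact: powR_gt0.
rewrite /lambda_fun I_scl ?J_scl ?F_scl ?G_scl ?(ltW t0)//.
rewrite ler_pdivrMr// [leRHS](_ : _ =
  (t `^ s * I u - t `^ q * F u - t `^ r * G u - c) / t `^ s); last first.
  by field; rewrite !gt_eqF.
rewrite ler_pdivlMr// -(ler_pM2l s_gt0).
have h1 := powR_young q_gt0 q_lt_s t0; have h2 := powR_young s_gt0 s_lt_r t0.
have F0 := F_gt0 u0; have G0 : 0 < - G u by rewrite oppr_gt0 G_lt0.
have k1 := ler_wpM2r (ltW F0) h1; have k2 := ler_wpM2r (ltW G0) h2.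
have cs : c * s = - ((s - q) * F u - (r - s) * G u) by apply/eqP; rewrite -addr_eq0 addrC; exact/eqP.
have -> : s * ((I u - F u - G u - c) * t `^ s) =
  s * t `^ s * I u - (s * F u + s * G u) * t `^ s - (c * s) * t `^ s by ring.
have -> : s * (t `^ s * I u - t `^ q * F u - t `^ r * G u - c) =
  s * t `^ s * I u - s * (t `^ q * F u) - s * (t `^ r * G u) - c * s by ring.
rewrite cs; move: k1 k2; lra.
Qed.

Lemma nehari_time_exists c u : c < 0 -> u != 0 ->
  exists t, 0 < t /\ nehari_fun (scl u t) + c * s = 0.
Proof.
move=> c0 u0; have F0 := F_gt0 u0; have G0 : 0 < - G u by rewrite oppr_gt0 G_lt0.
pose K := - c * s; have K0 : 0 < K by rewrite mulr_gt0 ?oppr_gt0.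
pose a := (s - q) * F u; pose b := (r - s) * - G u.
have a0 : 0 < a by rewrite mulr_gt0 ?subr_gt0.
have b0 : 0 < b by rewrite mulr_gt0 ?subr_gt0.
have pinv (x d : R) : 0 < x -> 0 < d -> (x `^ d^-1) `^ d = x.
  by move=> x0 d0; rewrite -powRrM mulVf ?gt_eqF// powRr1// ltW.
(* At [T] the term in t^q alone equals [K]; up to [x1] and [x2] each of the two terms is at most
   [K / 2]. *)
pose T := (K / a) `^ q^-1.
have T0 : 0 < T by rewrite powR_gt0// divr_gt0.
pose x1 := (K / a / 2) `^ q^-1; pose x2 := (K / b / 2) `^ r^-1.
have x10 : 0 < x1 by rewrite powR_gt0// !divr_gt0.
have x20 : 0 < x2 by rewrite powR_gt0// !divr_gt0.
pose t1 : R := Num.min T (Num.min x1 x2).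
have t10 : 0 < t1 by rewrite !lt_min T0 x10 x20.
have t1T : t1 <= T by rewrite /t1 ge_min lexx.
pose h t := a * t `^ q + b * t `^ r.
have hE (t : R) : 0 <= t -> nehari_fun (scl u t) = h t.
  by move=> t0; rewrite nehari_fun_scl// /h /a /b; ring.
have h1 : h t1 <= K.
  have e1 : t1 `^ q <= K / a / 2.
    rewrite -(pinv (K / a / 2) q) ?divr_gt0//; apply: ge0_ler_powR; rewrite ?nnegrE ?(ltW t10) ?(ltW x10) ?(ltW q_gt0)//.
    by rewrite /t1 !ge_min lexx orbT.
  have e2 : t1 `^ r <= K / b / 2.
    rewrite -(pinv (K / b / 2) r) ?divr_gt0//; apply: ge0_ler_powR; rewrite ?nnegrE ?(ltW t10) ?(ltW x20) ?(ltW r_gt0)//.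
    by rewrite /t1 !ge_min lexx !orbT.
  have := ler_wpM2l (ltW a0) e1; have := ler_wpM2l (ltW b0) e2.
  have -> : a * (K / a / 2) = K / 2 by field; rewrite gt_eqF.
  have -> : b * (K / b / 2) = K / 2 by field; rewrite gt_eqF.
  rewrite /h; lra.
have h2 : K <= h T.
  rewrite /h pinv ?divr_gt0// mulrCA divff ?gt_eqF// mulr1 lerDl mulr_ge0 ?powR_ge0// ltW//.
have hc : {within `[t1, T], continuous h}.
  apply: derivable_within_continuous => t; rewrite in_itv /= => /andP[tt _].
  have t0 : 0 < t by exact: lt_le_trans tt.
  have d1 := is_derive1_powR q t0; have d2 := is_derive1_powR r t0.
  have -> : h = (a \*: (powR (R:=R))^~ q) + (b \*: (powR (R:=R))^~ r) by apply/funext.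
  exact: ex_derive.
have [|t] := @IVT R h t1 T K t1T hc.
  by rewrite ge_min h1 /= le_max h2 orbT.
rewrite in_itv /= => /andP[tt _] htK; have t0 : 0 < t by exact: lt_le_trans tt.
by exists t; split => //; rewrite hE ?ltW// htK /K; ring.
Qed.

Definition nehari_time c u : R :=
  xget 1 [set t | 0 < t /\ nehari_fun (scl u t) + c * s = 0].

Lemma nehari_timeP c u : c < 0 -> u != 0 ->
  0 < nehari_time c u /\ nehari_fun (scl u (nehari_time c u)) + c * s = 0.
Proof.
move=> c0 u0; have [t Ht] := nehari_time_exists c0 u0.
exact: (@xgetPex _ (1 : R) [set t | 0 < t /\ nehari_fun (scl u t) + c * s = 0] (ex_intro _ t Ht)).
Qed.

Lemma nehari_timeN c u : nehari_time c (- u) = nehari_time c u.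
Proof.
rewrite /nehari_time; congr (xget _ _); apply/seteqP; split => t [t0 E]; split => //.
  by rewrite sclN ?ltW// nehari_funN in E.
by rewrite sclN ?ltW// nehari_funN.
Qed.

(** The signs at times t - d and t + d persist for [v] near [u], and strict monotonicity along the
    ray of [v] traps its time between them. *)
Lemma nehari_time_continuous c u : c < 0 -> u != 0 -> nehari_time c @ u --> nehari_time c u.
Proof.
move=> c0 u0; have [t0 E] := nehari_timeP c0 u0; set t := nehari_time c u in t0 E *.
have Kc (tau : R) : 0 <= tau -> nehari_fun (scl v tau) @[v --> u] --> nehari_fun (scl u tau).
  move=> tau0; under eq_fun do rewrite nehari_fun_scl//.
  rewrite nehari_fun_scl//; apply: cvgB; apply: cvgM; try exact: cvg_cst;
  by apply: cvgM; [exact: cvg_cst|exact: potential_continuous].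
apply/cvgrPdist_lt => e e0.
pose d := Num.min e (t / 2).
have d0 : 0 < d by rewrite lt_min e0 divr_gt0.
have de : d <= e by rewrite /d ge_min lexx.
have dt : d <= t / 2 by rewrite /d ge_min lexx orbT.
have td : 0 <= t - d by lra.
have td' : 0 <= t + d by lra.
have h1 : nehari_fun (scl u (t - d)) < - (c * s).
  have <- : nehari_fun (scl u t) = - (c * s) by lra.
  by apply: nehari_fun_scl_lt => //; lra.
have h2 : - (c * s) < nehari_fun (scl u (t + d)).
  have <- : nehari_fun (scl u t) = - (c * s) by lra.
  by apply: nehari_fun_scl_lt => //; lra.
have un0 : \forall v \near u, v != 0.
  have : 0 < `|u| by rewrite normr_gt0.
  move=> nu; near=> v; apply/eqP => v0.
  have : `|u - v| < `|u| by near: v; exact: cvgr_dist_lt.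
  by rewrite v0 subr0 ltxx.
near=> v; have v0 : v != 0 by near: v.
have [tv Ev] := nehari_timeP c0 v0; set tau := nehari_time c v in tv Ev *.
have k1 : nehari_fun (scl v (t - d)) < - (c * s).
  by near: v; exact: (cvgr_lt _ (Kc _ td)).
have k2 : - (c * s) < nehari_fun (scl v (t + d)).
  by near: v; exact: (cvgr_gt _ (Kc _ td')).
have {}Ev : nehari_fun (scl v tau) = - (c * s) by apply/eqP; rewrite -addr_eq0 Ev.
have l1 : t - d < tau.
  rewrite ltNge; apply/negP; rewrite le_eqVlt => /orP[/eqP E1|h].
    by move: k1; rewrite -E1 Ev ltxx.
  by have := lt_trans (nehari_fun_scl_lt v0 (ltW tv) h) k1; rewrite Ev ltxx.
have l2 : tau < t + d.
  rewrite ltNge; apply/negP; rewrite le_eqVlt => /orP[/eqP E1|h].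
    by move: k2; rewrite E1 Ev ltxx.
  by have := lt_trans k2 (nehari_fun_scl_lt v0 td' h); rewrite Ev ltxx.
move: l1 l2 de; generalize tau => x l1 l2 de.
rewrite distrC ltr_distl; apply/andP; split.
  by apply: le_lt_trans l1; rewrite lerD2l lerN2.
by apply: (lt_le_trans l2); rewrite lerD2l.
Unshelve. all: by end_near. Qed.

Lemma scl_continuous_pos u (t : R) : 0 < t -> (fun p : W * R => scl p.1 p.2) @ (u, t) --> scl u t.
Proof.
move=> t0; have o : open [set p : W * R | 0 < p.2].
  have -> : [set p : W * R | 0 < p.2] = snd @^-1` [set x : R | 0 < x] by [].
  by apply: open_comp; [move=> x _; exact: cvg_snd|exact: open_gt].
have sub : [set p : W * R | 0 < p.2] `<=` [set p : W * R | 0 <= p.2] by move=> p /ltW.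
have := continuous_subspaceW sub (scl_continuous A1_5).
by rewrite (continuous_open_subspace _ o) => /(_ (u, t)); apply; rewrite inE.
Qed.

Definition nehari_proj c u : W := scl u (nehari_time c u).

Lemma nehari_projP c u : c < 0 -> u != 0 -> N c (nehari_proj c u).
Proof.
move=> c0 u0; have [t0 E] := nehari_timeP c0 u0.
by apply/nehariP; split => //; exact: scl_neq0.
Qed.

Lemma nehari_projN c u : c < 0 -> u != 0 -> nehari_proj c (- u) = - nehari_proj c u.
Proof.
move=> c0 u0; have [t0 _] := nehari_timeP c0 u0.
by rewrite /nehari_proj nehari_timeN sclN// ltW.
Qed.

Lemma nehari_proj_continuous c u : c < 0 -> u != 0 -> nehari_proj c @ u --> nehari_proj c u.
Proof.
move=> c0 u0; have [t0 _] := nehari_timeP c0 u0.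
apply: (@cvg_comp _ _ _ (fun v => (v, nehari_time c v)) (fun p : W * R => scl p.1 p.2)
  (nbhs u) (nbhs (u, nehari_time c u))); last exact: scl_continuous_pos.
apply: (@cvg_pair _ _ _ (nbhs u) (nbhs u) (nbhs (nehari_time c u))); [exact: cvg_id|exact: nehari_time_continuous].
Qed.

Lemma nehari_proj_le c u : c < 0 -> u != 0 -> lam c (nehari_proj c u) <= lam c u.
Proof.
move=> c0 u0; have [t0 _] := nehari_timeP c0 u0.
have ti : 0 < (nehari_time c u)^-1 by rewrite invr_gt0.
by have := nehari_min (nehari_projP c0 u0) ti; rewrite /nehari_proj sclK.
Qed.

End Nehari.

(** * Weak compactness *)

Section Sequences.
Context {R : realType}.

(** The frame of the compactness proofs: if every n had a counterexample, choice would give a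
    sequence of them, to be refuted by a weak limit. *)
Lemma by_sequence (T : Type) (P : nat -> T -> Prop) :
  (forall x : nat -> T, (forall n, P n (x n)) -> False) -> exists n, forall x, ~ P n x.
Proof.
move=> H; apply: contrapT => nH.
have /choice[x Px] : forall n, exists x, P n x.
  by move=> n; apply: contrapT => nx; apply: nH; exists n => x Px; apply: nx; exists x.
exact: (H x Px).
Qed.

Lemma homo_ltn_ge (sigma : nat -> nat) :
  {homo sigma : m n / (m < n)%N} -> forall n, (n <= sigma n)%N.
Proof. by move=> h; elim=> // n IH; apply: leq_ltn_trans IH _; exact: h. Qed.

Lemma subseq_cvg (T : topologicalType) (u : nat -> T) (l : T) (sigma : nat -> nat) :
  {homo sigma : m n / (m < n)%N} -> u n @[n --> \oo] --> l -> u (sigma n) @[n --> \oo] --> l.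
Proof.
move=> h; apply: cvg_comp => S [N _ SN]; exists N => //= n /= Nn.
by apply: SN => /=; apply: leq_trans Nn (homo_ltn_ge h n).
Qed.

Lemma cvg_ler (a b : nat -> R) (la lb : R) : a n @[n --> \oo] --> la ->
  b n @[n --> \oo] --> lb -> (forall n, a n <= b n) -> la <= lb.
Proof. by move=> ha hb ab; apply: (ler_cvg_to ha hb); exact: nearW. Qed.

Lemma cvg_gec (c : R) (a : nat -> R) (l : R) :
  a n @[n --> \oo] --> l -> (forall n, c <= a n) -> c <= l.
Proof. by move=> ha h; apply: (cvg_ler (a := fun=> c) _ ha h); exact: cvg_cst. Qed.

Lemma cvg_lec (c : R) (a : nat -> R) (l : R) :
  a n @[n --> \oo] --> l -> (forall n, a n <= c) -> l <= c.
Proof. by move=> ha h; apply: (cvg_ler (b := fun=> c) ha _ h); exact: cvg_cst. Qed.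

Lemma cvg_mull (c : R) (a : nat -> R) (l : R) :
  a n @[n --> \oo] --> l -> c * a n @[n --> \oo] --> c * l.
Proof. exact: cvgMl_tmp. Qed.
Arguments cvg_mull c {a l} _.

Lemma cvg_addr (a b : nat -> R) (la lb : R) : a n @[n --> \oo] --> la ->
  b n @[n --> \oo] --> lb -> a n + b n @[n --> \oo] --> la + lb.
Proof. exact: cvgD. Qed.

Lemma cvg_mulr (a b : nat -> R) (la lb : R) : a n @[n --> \oo] --> la ->
  b n @[n --> \oo] --> lb -> a n * b n @[n --> \oo] --> la * lb.
Proof. exact: cvgM. Qed.

Lemma cvg_oppr (a : nat -> R) (la : R) : a n @[n --> \oo] --> la ->
  - a n @[n --> \oo] --> - la.
Proof. exact: cvgN. Qed.

Lemma cvg_dominated0 (V : normedModType R) (v : nat -> V) (b : nat -> R) :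
  b n @[n --> \oo] --> (0 : R) -> (forall n, `|v n| <= b n) -> v n @[n --> \oo] --> (0 : V).
Proof.
move=> hb vb; apply: norm_cvg0; apply: (@squeeze_cvgr _ _ _ _ (cst 0) b) => //; last exact: cvg_cst.
by apply: nearW => n; rewrite normr_ge0 vb.
Qed.

Lemma seq_cvg_unique (V : normedModType R) (v : nat -> V) (l l' : V) :
  v n @[n --> \oo] --> l -> v n @[n --> \oo] --> l' -> l = l'.
Proof. by apply: cvg_unique; exact: norm_hausdorff. Qed.

Lemma cvg_invS : (n.+1%:R^-1 : R) @[n --> \oo] --> (0 : R).
Proof. exact: cvg_harmonic. Qed.

Lemma cvg_powR_inv (t : nat -> R) (a : R) : 0 < a -> (forall n, n%:R <= t n) ->
  (t n `^ a)^-1 @[n --> \oo] --> (0 : R).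
Proof.
move=> a0 tn; apply/cvgrPdist_lt => e e0.
have [N hN] : exists N : nat, e^-1 `^ a^-1 < N%:R.
  by exists (Num.truncn (e^-1 `^ a^-1)).+1; exact: truncnS_gt.
exists N => //= n /= Nn; rewrite sub0r normrN ger0_norm ?invr_ge0 ?powR_ge0//.
have h : e^-1 `^ a^-1 < t n by apply: (lt_le_trans hN); apply: le_trans (tn n); rewrite ler_nat.
have h2 : e^-1 < t n `^ a.
  rewrite -(@powRr1 _ e^-1) ?invr_ge0 ?ltW// -(mulVf (_ : a != 0)) ?gt_eqF// powRrM.
  by apply: gt0_ltr_powR => //; rewrite nnegrE ?powR_ge0// (le_trans (powR_ge0 _ _) (ltW h)).
by rewrite -(invrK e) ltf_pV2// posrE ?invr_gt0//; apply: lt_trans h2; rewrite invr_gt0.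
Qed.

Lemma unbounded_not_cvg (a : nat -> R) (l : R) : (forall n, n%:R <= a n) ->
  ~ (a n @[n --> \oo] --> l).
Proof.
move=> an h; have : \forall n \near \oo, (Num.truncn (l + 1)).+1%:R <= a n.
  by exists (Num.truncn (l + 1)).+1 => // n /= Nn; apply: le_trans (an n); rewrite ler_nat.
move=> hn; have h' : (Num.truncn (l + 1)).+1%:R <= l by apply: (ler_cvg_to (cvg_cst _) h hn).
by have := lt_le_trans (truncnS_gt (l + 1)) h'; rewrite gtrDl ltr10.
Qed.

End Sequences.

Arguments cvg_mull {R} c {a l} _.

Section Compactness.
Context {R : realType} {W : completeNormedModType R}
  {scl : W -> R -> W} {q s r : R} {A B f g : W -> dual W}.
Hypothesis FW : framework scl q s r A B f g.

Local Notation I := (potential A).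
Local Notation J := (potential B).
Local Notation F := (potential f).
Local Notation G := (potential g).
Local Notation lam := (lambda_fun A B f g).
Local Notation N := (nehari scl A B f g).
Local Notation nf := (@nehari_fun R W q s r f g).

Let q_gt0 : 0 < q. Proof. exact: fw_q_gt0 FW. Qed.
Let q_lt_s : q < s. Proof. exact: fw_q_lt_s FW. Qed.
Let s_lt_r : s < r. Proof. exact: fw_s_lt_r FW. Qed.
Let s_gt0 : 0 < s. Proof. exact: lt_trans q_lt_s. Qed.
Let sq_gt0 : 0 < s - q. Proof. by rewrite subr_gt0. Qed.
Let rs_gt0 : 0 < r - s. Proof. by rewrite subr_gt0. Qed.

Let r_div_s : 0 < r / s. Proof. by rewrite divr_gt0// (lt_trans s_gt0). Qed.

Lemma G_le0 u : G u <= 0.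
Proof.
have [->|u0] := eqVneq u 0; first by rewrite (potential0 (fw_g_potential FW)).
exact: (ltW (fw_G_lt0 FW u0)).
Qed.

Lemma J_eq0 u : J u <= 0 -> u = 0.
Proof. by move=> h; apply/eqP; apply: contraPT h => u0; apply/negP; rewrite -ltNge (J_gt0 FW). Qed.

Lemma F_eq0 u : F u <= 0 -> u = 0.
Proof. by move=> h; apply/eqP; apply: contraPT h => u0; apply/negP; rewrite -ltNge (fw_F_gt0 FW). Qed.

Lemma G_eq0 u : 0 <= G u -> u = 0.
Proof. by move=> h; apply/eqP; apply: contraPT h => u0; apply/negP; rewrite -ltNge (fw_G_lt0 FW). Qed.

Lemma bounded_extract (u_ : nat -> W) (C : R) : (forall n, `|u_ n| <= C) ->
  exists sigma : nat -> nat, {homo sigma : m n / (m < n)%N} /\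
  exists u, [/\ weakly_cvg (fun n => u_ (sigma n)) u,
    J (u_ (sigma n)) @[n --> \oo] --> J u, F (u_ (sigma n)) @[n --> \oo] --> F u &
    G (u_ (sigma n)) @[n --> \oo] --> G u].
Proof.
move=> uC; have [sg [hs [u wu]]] := weakly_convergent_subsequence (fw_reflexive FW) uC.
have uC' n : `|u_ (sg n)| <= C by [].
exists sg; split => //; exists u; split => //.
- exact: (potential_weakly_continuous (B_potential FW) (fw_B_weak FW) uC').
- exact: (potential_weakly_continuous (fw_f_potential FW) (fw_f_weak FW) uC').
- exact: (potential_weakly_continuous (fw_g_potential FW) (fw_g_weak FW) uC').
Qed.

Lemma J_bounded (rho : R) : exists M : R, forall u, `|u| <= rho -> J u <= M.
Proof.
have [|n Hn] := @by_sequence W (fun n u => `|u| <= rho /\ n%:R <= J u).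
  move=> u_ H; have [sg [hs [u [_ hJ _ _]]]] := bounded_extract (fun n => (H n).1).
  apply: (unbounded_not_cvg _ hJ) => n; have [_] := H (sg n); apply: le_trans.
  by rewrite ler_nat; exact: homo_ltn_ge.
exists n%:R => u uC; rewrite leNgt; apply/negP => h; apply: (Hn u); split => //; exact: ltW.
Qed.

Lemma nehari_fun_bounded (rho : R) : exists M : R, forall u, `|u| <= rho -> nf u <= M.
Proof.
have [|n Hn] := @by_sequence W (fun n u => `|u| <= rho /\ n%:R <= nf u).
  move=> u_ H; have [sg [hs [u [_ _ hF hG]]]] := bounded_extract (fun n => (H n).1).
  have h : nf (u_ (sg n)) @[n --> \oo] --> nf u by apply: cvgB; apply: cvg_mull.
  apply: (unbounded_not_cvg _ h) => n; have [_] := H (sg n); apply: le_trans.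
  by rewrite ler_nat; exact: homo_ltn_ge.
exists n%:R => u uC; rewrite leNgt; apply/negP => h; apply: (Hn u); split => //; exact: ltW.
Qed.

Lemma polar u : u != 0 -> exists x t, [/\ I x = 1, 0 < t & u = scl x t].
Proof.
move=> u0; pose t := I u `^ s^-1.
have t0 : 0 < t by apply: powR_gt0; exact: (I_gt0 FW).
have ts : t `^ s = I u.
  by rewrite /t -powRrM mulVf ?gt_eqF// powRr1// ltW// (I_gt0 FW).
exists (scl u t^-1), t; split => //.
  rewrite (I_scl FW) ?invr_ge0 ?ltW// -ts -powRM ?invr_ge0 ?ltW//.
  by rewrite mulVf ?gt_eqF// powR1.
by rewrite -{2}(invrK t) (sclK FW)// invr_gt0.
Qed.

Lemma Ms_bounded : exists rho : R, forall x, I x = 1 -> `|x| <= rho.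
Proof.
have [rho h] := fw_coercive FW 2; exists rho => x Ix.
by rewrite leNgt; apply/negP => /ltW /h; rewrite Ix; lra.
Qed.

Lemma nehari_F_le (c : R) u : N c u -> F u <= - c * s / (s - q).
Proof.
move=> /(nehariP FW)[_ E]; rewrite ler_pdivlMr//.
have := G_le0 u; have := ler_wpM2l (ltW rs_gt0) (G_le0 u); rewrite mulr0.
by move: E; rewrite /nehari_fun; nra.
Qed.

(** With c eliminated, estimates of the level become uniform in c. *)
Lemma nehari_lam (c : R) u : N c u -> lam c u * J u = I u - q / s * F u - r / s * G u.
Proof.
move=> /(nehariP FW)[u0 E]; have J0 := J_gt0 FW u0.
rewrite /lambda_fun divfK ?gt_eqF//.
have -> : c = - ((s - q) * F u - (r - s) * G u) / s.
  by rewrite -[X in - X](addrK (c * s)) -/(nf u) E sub0r opprK mulfK// gt_eqF.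
by field; rewrite gt_eqF.
Qed.

(* If t tended to infinity, dividing by t^r would give G = 0 at a weak limit of the x,
   which is thus 0, and dividing by t^s would then give 1 <= 0. *)
Lemma nehari_time_bounded (C : R) : exists n : nat, forall (c : R) x t,
  I x = 1 -> 0 < t -> N c (scl x t) -> lam c (scl x t) <= C -> t <= n%:R.
Proof.
have [|n Hn] := @by_sequence (R * W * R) (fun n p => [/\
   I p.1.2 = 1, n%:R <= p.2 /\ 0 < p.2, N p.1.1 (scl p.1.2 p.2) & lam p.1.1 (scl p.1.2 p.2) <= C]).
  move=> p H; have [rho hrho] := Ms_bounded.
  have pb n : `|(p n).1.2| <= rho by have [? _ _ _] := H n; exact: hrho.
  have [sg [hs [x [_ hJ hF hG]]]] := bounded_extract pb.
  pose t n := (p (sg n)).2; pose y n := (p (sg n)).1.2.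
  have tn n : n%:R <= t n.
    by have [_ [h _] _ _] := H (sg n); apply: le_trans h; rewrite ler_nat homo_ltn_ge.
  have tp n : 0 < t n by have [_ [_ ?] _ _] := H (sg n).
  have key n : t n `^ s - q / s * (t n `^ q * F (y n)) - r / s * (t n `^ r * G (y n)) <=
      C * (t n `^ s * J (y n)).
    have [I1 _ h1 h2] := H (sg n); have J0 := J_gt0 FW (nehari_neq0 FW h1).
    have := ler_wpM2r (ltW J0) h2; rewrite (nehari_lam h1).
    rewrite (I_scl FW) ?(J_scl FW) ?(F_scl FW) ?(G_scl FW) ?(ltW (tp n))//.
    by rewrite I1 mulr1.
  have pD n (a b : R) : t n `^ (a + b) = t n `^ a * t n `^ b.
    by rewrite powRD// (gt_eqF (tp n)) implybT.
  have sE n : t n `^ s = t n `^ q * t n `^ (s - q) by rewrite -pD; congr (_ `^ _); ring.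
  have rE n : t n `^ r = t n `^ s * t n `^ (r - s) by rewrite -pD; congr (_ `^ _); ring.
  have qE n : t n `^ (r - q) = t n `^ (s - q) * t n `^ (r - s).
    by rewrite -pD; congr (_ `^ _); ring.
  have rq0 : 0 < r - q by rewrite subr_gt0; exact: lt_trans s_lt_r.
  have h1 := cvg_powR_inv rs_gt0 tn; have h2 := cvg_powR_inv rq0 tn; have h3 := cvg_powR_inv sq_gt0 tn.
  have x0 : x = 0.
    apply: G_eq0; have k n : r / s * - G (y n) <=
        C * (J (y n) * (t n `^ (r - s))^-1) + q / s * (F (y n) * (t n `^ (r - q))^-1).
      rewrite -(ler_pM2r (powR_gt0 r (tp n))); have := key n; rewrite qE rE sE.
      have a0 := powR_gt0 q (tp n); have b0 := powR_gt0 (s - q) (tp n).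
      have c0 := powR_gt0 (r - s) (tp n).
      move: (t n `^ q) (t n `^ (s - q)) (t n `^ (r - s)) a0 b0 c0 => a b d a0 b0 d0 kk.
      have -> : (C * (J (y n) * d^-1) + q / s * (F (y n) * (b * d)^-1)) * (a * b * d) =
        C * (a * b * J (y n)) + q / s * (a * F (y n)).
        by field; rewrite !gt_eqF.
      by have := mulr_gt0 a0 b0; lra.
    have := cvg_ler (cvg_mull (r / s) (cvg_oppr hG)) (cvg_addr (cvg_mull C (cvg_mulr hJ h1))
      (cvg_mull (q / s) (cvg_mulr hF h2))) k.
    by rewrite !mulr0 addr0 (pmulr_rle0 _ r_div_s) oppr_le0.
  have k n : 1 <= C * J (y n) + q / s * (F (y n) * (t n `^ (s - q))^-1).
    rewrite -(ler_pM2r (powR_gt0 s (tp n))); have := key n.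
    have : 0 <= r / s * (t n `^ r * - G (y n)).
      by rewrite mulr_ge0 ?(ltW r_div_s)// mulr_ge0 ?powR_ge0// oppr_ge0 G_le0.
    move: (t n `^ r) => z; rewrite sE.
    have a0 := powR_gt0 q (tp n); have b0 := powR_gt0 (s - q) (tp n).
    move: (t n `^ q) (t n `^ (s - q)) a0 b0 => a b a0 b0 k1 k2.
    have -> : (C * J (y n) + q / s * (F (y n) * b^-1)) * (a * b) =
       C * (a * b * J (y n)) + q / s * (a * F (y n)) by field; rewrite !gt_eqF.
    lra.
  have := cvg_gec (cvg_addr (cvg_mull C hJ) (cvg_mull (q / s) (cvg_mulr hF h3))) k.
  by rewrite x0 (potential0 (B_potential FW)) (potential0 (fw_f_potential FW)) mul0r !mulr0 addr0 ler10.
exists n => c x t I1 t0 h1 h2; rewrite leNgt; apply/negP => /ltW tn.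
by apply: (Hn (c, x, t)); split.
Qed.

Lemma nehari_sublevel_bounded (C : R) : exists rho : R, forall (c : R) u,
  N c u -> lam c u <= C -> `|u| <= rho.
Proof.
have [n Hn] := nehari_time_bounded C; have [b hb] := Ms_bounded.
have [rho Hr] := scl_bounded (fw_scaling FW) b n%:R.
exists rho => c u Nu lu; have [x [t [I1 t0 E]]] := polar (nehari_neq0 FW Nu).
rewrite E in Nu lu *; apply: Hr; first exact: hb.
by rewrite (ltW t0) (Hn c x).
Qed.

(* [nehari_fun] is weakly continuous and at least - c2 * s > 0 along the sequence. *)
Lemma nehari_fun_weak_limit (c2 : R) (c_ : nat -> R) (u_ : nat -> W) u : c2 < 0 ->
  (forall n, c_ n <= c2) -> (forall n, N (c_ n) (u_ n)) ->
  F (u_ n) @[n --> \oo] --> F u -> G (u_ n) @[n --> \oo] --> G u -> u != 0.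
Proof.
move=> c20 cc2 Nu hF hG; apply/eqP => u0.
have h : nf (u_ n) @[n --> \oo] --> nf u by apply: cvgB; apply: cvg_mull.
have : - (c2 * s) <= nf u.
  apply: (cvg_gec h) => n; have /(nehariP FW)[_ E] := Nu n.
  have := cc2 n; rewrite -(ler_pM2r s_gt0); move: E; lra.
rewrite u0 /nehari_fun (potential0 (fw_f_potential FW)) (potential0 (fw_g_potential FW)).
by rewrite !mulr0 subrr oppr_le0 leNgt pmulr_llt0// c20.
Qed.

(** Otherwise J would vanish at a weak limit, which would then be 0; [nehari_fun_weak_limit]
    excludes this as long as c stays below a negative [c2]. *)
Lemma nehari_J_ge (c2 rho : R) : c2 < 0 -> exists2 m : R, 0 < m & forall (c : R) u,
  c <= c2 -> N c u -> `|u| <= rho -> m <= J u.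
Proof.
move=> c20; have [|n Hn] := @by_sequence (R * W) (fun n p =>
    [/\ p.1 <= c2, N p.1 p.2, `|p.2| <= rho & J p.2 <= n.+1%:R^-1]).
  move=> p H; have pb n : `|(p n).2| <= rho by have [] := H n.
  have [sg [hs [x [_ hJ hF hG]]]] := bounded_extract pb.
  have := @nehari_fun_weak_limit c2 (fun n => (p (sg n)).1) (fun n => (p (sg n)).2) x c20.
  move=> /(_ _ _ hF hG) x0; have {x0} : x != 0 by apply: x0 => n; have [] := H (sg n).
  rewrite (J_eq0 (u := x)) ?eqxx//.
  apply: (cvg_ler hJ (subseq_cvg hs cvg_invS)) => n; by have [] := H (sg n).
exists n.+1%:R^-1 => // c u cc2 Nu ur; rewrite leNgt; apply/negP => /ltW h.
by apply: (Hn (c, u)).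
Qed.

Lemma nehari_lower_bound (c : R) : c < 0 -> exists L : R, forall u, N c u -> L <= lam c u.
Proof.
move=> c0; have [rho Hr] := nehari_sublevel_bounded 0.
have [m m0 Hm] := nehari_J_ge rho c0; pose K := - c * s / (s - q).
have K0 : 0 <= K by rewrite /K !mulr_ge0 ?invr_ge0 ?oppr_ge0 ?ltW.
(* Only points of level at most 0 matter; they are bounded, so J is at least [m] there, while F is
   at most [K] by the Nehari equation. *)
exists (- K / m) => u Nu; have u0 := nehari_neq0 FW Nu.
have [l0|l0] := leP (lam c u) 0; last first.
  by apply: le_trans (ltW l0); rewrite mulNr oppr_le0 divr_ge0// ltW.
have J0 := J_gt0 FW u0; have mJ := Hm _ _ (lexx c) Nu (Hr _ _ Nu l0).
apply: (@le_trans _ _ (- K / J u)).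
  by rewrite !mulNr lerN2 ler_wpM2l// lef_pV2.
rewrite ler_pM2r ?invr_gt0//.
have := nehari_F_le Nu; rewrite -/K; have := G_le0 u; have := I_gt0 FW u0; lra.
Qed.

Lemma nehari_not_near0 (c : R) : c < 0 -> exists2 r0 : R, 0 < r0 & forall u, N c u -> r0 <= `|u|.
Proof.
move=> c0; have : nf x @[x --> (0 : W)] --> nf 0 by exact: (nehari_fun_continuous FW).
have n0 : nf 0 = 0.
  by rewrite /nehari_fun (potential0 (fw_f_potential FW)) (potential0 (fw_g_potential FW)); ring.
rewrite n0 => /cvgrPdist_lt/(_ (- c * s)); rewrite mulr_gt0 ?oppr_gt0// => /(_ isT).
move=> /nbhs_ballP[d /= d0 hd]; exists d => // u Nu; rewrite leNgt; apply/negP => ud.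
have := hd u; rewrite -ball_normE /= sub0r normrN => /(_ ud).
have [u0 E] := (nehariP FW _ _).1 Nu.
by rewrite sub0r normrN gtr0_norm ?(nehari_fun_gt0 FW)//; lra.
Qed.

Lemma weakly_cvg_close (x_ u_ : nat -> W) x : weakly_cvg x_ x ->
  u_ n - x_ n @[n --> \oo] --> (0 : W) -> weakly_cvg u_ x.
Proof.
move=> wx h L; have hL : L (u_ n - x_ n) @[n --> \oo] --> L 0.
  by apply: (cvg_comp _ _ h); exact: dual_continuous.
have := cvg_addr hL (wx L); rewrite dual0 add0r.
by under eq_fun do rewrite dualB subrK.
Qed.

(** Strong convergence of the values [A (u_ n)] makes their pairing with the weakly null [u_ n - u]
    tend to 0, as (A7) demands. *)
Lemma A_strong_cvg (L_ : nat -> dual W) (L : dual W) (u_ : nat -> W) u (C : R) :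
  (forall n, `|u_ n| <= C) -> weakly_cvg u_ u -> L_ n @[n --> \oo] --> L ->
  (forall n, A (u_ n) = L_ n) -> exists sigma : nat -> nat,
  {homo sigma : m n / (m < n)%N} /\ u_ (sigma j) @[j --> \oo] --> u.
Proof.
move=> uC wu hL E; apply: (fw_A_compact FW) => //.
have vC n : `|u_ n - u| <= C + `|u| by apply: le_trans (ler_normB _ _) _; rewrite lerD2r.
have := weak_pairing vC (weakly_cvg_subr wu) hL; rewrite dual0.
by under eq_fun do rewrite -E.
Qed.

(** A quantitative Palais-Smale condition. It is stated on a neighbourhood of a sublevel set of the
    Nehari set because descent trajectories leave that set. *)
Lemma dlam_bounded_below (c a : R) : c < 0 -> ~ lambda_critical_value A B f g c a ->
  exists2 d : R, 0 < d & forall x u, N c x -> lam c x <= a + 1 -> `|u - x| <= d ->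
    u != 0 /\ (`|lam c u - a| <= d -> d <= `|dlam A B f g c u|).
Proof.
move=> c0 ncrit; have [rho Hr] := nehari_sublevel_bounded (a + 1).
have [|n Hn] := @by_sequence (W * W) (fun n p => [/\ N c p.1, lam c p.1 <= a + 1,
  `|p.2 - p.1| <= n.+1%:R^-1, `|lam c p.2 - a| <= n.+1%:R^-1 & p.2 != 0 /\
  `|dlam A B f g c p.2| <= n.+1%:R^-1]).
  move=> p H; apply: ncrit.
  have pb n : `|(p n).1| <= rho by have [h1 h2 _ _ _] := H n; exact: Hr h1 h2.
  have [sg [hs [x [wx _ hF hG]]]] := bounded_extract pb.
  have x0 : x != 0.
    apply: (@nehari_fun_weak_limit c (fun=> c) _ x c0 _ _ hF hG) => // n.
    by have [] := H (sg n).
  pose u n := (p (sg n)).2; have inv0 := subseq_cvg hs (@cvg_invS R).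
  have wu : weakly_cvg u x.
    apply: (weakly_cvg_close wx); apply: (cvg_dominated0 inv0) => n.
    by have [] := H (sg n).
  have uC n : `|u n| <= rho + 1.
    rewrite -(subrK (p (sg n)).1 (u n)); apply: le_trans (ler_normD _ _) _.
    rewrite addrC lerD//; have [_ _ h _ _] := H (sg n); apply: le_trans h _.
    by rewrite invf_le1 ?ler1n.
  have hJ : J (u n) @[n --> \oo] --> J x.
    exact: (potential_weakly_continuous (B_potential FW) (fw_B_weak FW) uC wu).
  have hd : dlam A B f g c (u n) @[n --> \oo] --> (0 : dual W).
    by apply: (cvg_dominated0 inv0) => n; have [_ _ _ _ []] := H (sg n).
  have hl : lam c (u n) @[n --> \oo] --> a.
    have : lam c (u n) - a @[n --> \oo] --> 0.
      by apply: (cvg_dominated0 inv0) => n; have [] := H (sg n).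
    move=> h; have ha : (fun=> a : R) n @[n --> \oo] --> a by exact: cvg_cst.
    have := cvg_addr h ha; rewrite add0r.
    by under eq_fun do rewrite subrK.
  (* The definition of [dlam] solved for [A (u n)]; every term converges strongly. *)
  pose L n : dual W := J (u n) *: dlam A B f g c (u n) + f (u n) + g (u n) + lam c (u n) *: B (u n).
  have hL : L n @[n --> \oo] --> J x *: 0 + f x + g x + a *: B x.
    apply: cvgD; last by apply: cvgZ => //; exact: (fw_B_weak FW).
    apply: cvgD; last exact: (fw_g_weak FW).
    by apply: cvgD; [exact: cvgZ|exact: (fw_f_weak FW)].
  have AL n : A (u n) = L n.
    have [_ _ _ _ [un0 _]] := H (sg n); have J0 := J_gt0 FW un0.
    rewrite /L /dlam scalerA divff ?gt_eqF// scale1r.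
    by rewrite [_ + g _ + _]addrAC [_ + f _ + _]addrAC subrK [_ + f _ + _]addrAC !subrK.
  have [tau [ht hu]] := A_strong_cvg uC wu hL AL.
  exists x; split => //.
    apply/(critical_lambda_fun (A_potential FW) (B_potential FW) (fw_f_potential FW)
      (fw_g_potential FW) (fw_B_gt0 FW)) => //.
    have h1 : dlam A B f g c (u (tau n)) @[n --> \oo] --> dlam A B f g c x.
      apply: (cvg_comp _ _ hu); exact: (dlam_continuous (A_potential FW) (B_potential FW)
        (fw_f_potential FW) (fw_g_potential FW) (fw_B_gt0 FW)).
    exact: (cvg_unique _ h1 (subseq_cvg ht hd)).
  have h1 : lam c (u (tau n)) @[n --> \oo] --> lam c x.
    apply: (cvg_comp _ _ hu); exact: (lambda_fun_continuous (A_potential FW) (B_potential FW)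
        (fw_f_potential FW) (fw_g_potential FW) (fw_B_gt0 FW)).
  exact: (cvg_unique _ h1 (subseq_cvg ht hl)).
have [r0 r00 Hr0] := nehari_not_near0 c0.
pose d : R := Num.min n.+1%:R^-1 (r0 / 2).
have dn : d <= n.+1%:R^-1 by rewrite /d ge_min lexx.
have dr : d <= r0 / 2 by rewrite /d ge_min lexx orbT.
exists d; first by rewrite lt_min invr_gt0 ltr0n divr_gt0.
move=> x u Nx lx ux; have u0 : u != 0.
  apply/eqP => u0; have := Hr0 _ Nx; move: ux; rewrite u0 sub0r normrN; lra.
split => // lu; rewrite leNgt; apply/negP => /ltW h.
by apply: (Hn (x, u)); split => //=; [apply: le_trans dn|apply: le_trans dn|split => //; apply: le_trans dn].
Qed.

(** If more and more of the [D i] vanished along a sequence, all of them would vanish at a weak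
    limit, which is nevertheless nonzero. *)
Lemma nehari_finite_functionals (D : nat -> dual W) (c a : R) : c < 0 ->
  (forall u, u != 0 -> exists k, D k u != 0) ->
  exists n, forall u, N c u -> lam c u <= a -> exists2 i, (i < n)%N & D i u != 0.
Proof.
move=> c0 HD; have [rho Hr] := nehari_sublevel_bounded a.
have [|n Hn] := @by_sequence W (fun n u => [/\ N c u, lam c u <= a &
  forall i, (i < n)%N -> D i u = 0]).
  move=> u H; have ub n : `|u n| <= rho by have [h1 h2 _] := H n; exact: Hr h1 h2.
  have [sg [hs [x [wx _ hF hG]]]] := bounded_extract ub.
  have x0 : x != 0.
    apply: (@nehari_fun_weak_limit c (fun=> c) _ x c0 _ _ hF hG) => // n.
    by have [] := H (sg n).
  have [k /eqP] := HD _ x0; apply; apply: (cvg_unique _ (wx (D k))) => //.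
  apply: cvg_near_cst; exists k.+1 => // n /= kn; have [_ _ h] := H (sg n).
  by apply: h; apply: leq_trans kn (homo_ltn_ge hs n).
exists n => u Nu lu; apply: contrapT => h; apply: (Hn u); split => // i iN.
by apply/eqP; apply: contrapT => /negP Di; apply: h; exists i.
Qed.

(** Points of level at most [C] are bounded uniformly in c, so [nehari_fun] is bounded on them; but
    on the Nehari set it equals - c s. *)
Lemma nehari_lam_large (C : R) : exists2 c0 : R, c0 < 0 & forall (c : R) u,
  c < c0 -> N c u -> C < lam c u.
Proof.
have [rho Hr] := nehari_sublevel_bounded C; have [M HM] := nehari_fun_bounded rho.
exists (- (`|M| + 1) / s).
  by rewrite mulNr oppr_lt0 divr_gt0// ltr_wpDl.
move=> c u cc0 Nu; rewrite ltNge; apply/negP => lu.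
have [u0 E] := (nehariP FW _ _).1 Nu; have := HM _ (Hr _ _ Nu lu).
move: cc0; rewrite ltr_pdivlMr//; have := ler_norm M; lra.
Qed.

(** (H3) with coefficients 1, l, 1, 1 is the Nehari equation for c = Phi u, and positivity of
    [nehari_fun] then gives the sign of c. *)
Lemma critical_nehari (l : R) u : u != 0 -> A u = l *: B u + f u + g u ->
  N (Phi A B f g l u) u /\ Phi A B f g l u < 0.
Proof.
move=> u0 E; have e := @fw_H3 _ _ _ _ _ _ _ _ _ _ FW 1 l 1 1 u.
have {}e := e (_ : 1 *: A u = l *: B u + 1 *: f u + 1 *: g u); rewrite !scale1r in e.
have {}e := e E.
have n0 := nehari_fun_gt0 FW u0.
have h : nf u + Phi A B f g l u * s = 0 by rewrite /nehari_fun /Phi; lra.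
split; first by apply/(nehariP FW).
have : Phi A B f g l u * s < 0 by lra.
by rewrite pmulr_llt0.
Qed.

(** As the critical value tends to 0, [nehari_F_le] forces F to 0, so a weak limit is 0; the
    equation makes the convergence strong. *)
Lemma critical_small (l e : R) : 0 < e -> exists2 c0 : R, c0 < 0 & forall u,
  u != 0 -> A u = l *: B u + f u + g u -> c0 < Phi A B f g l u -> `|u| < e.
Proof.
move=> e0; have [rho Hr] := nehari_sublevel_bounded l.
have [|n Hn] := @by_sequence W (fun n u => [/\ u != 0, A u = l *: B u + f u + g u,
  - n.+1%:R^-1 <= Phi A B f g l u & e <= `|u|]).
  move=> u H; have Nu n : N (Phi A B f g l (u n)) (u n).
    by have [h1 h2 _ _] := H n; exact: (critical_nehari h1 h2).1.
  have ub n : `|u n| <= rho.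
    apply: (Hr _ _ (Nu n)); have [h1 _ _ _] := H n.
    by rewrite (lambda_fun_Phi A f g (B_potential FW) (fw_B_gt0 FW) _ l h1).2.
  have [sg [hs [x [wx _ hF _]]]] := bounded_extract ub.
  have x0 : x = 0.
    apply: F_eq0; have inv0 := subseq_cvg hs (@cvg_invS R).
    rewrite -(mulr0 (s / (s - q))); apply: (cvg_ler hF (cvg_mull (s / (s - q)) inv0)) => n.
    apply: le_trans (nehari_F_le (Nu (sg n))) _; rewrite -mulrA mulrC ler_wpM2l//.
      by rewrite divr_ge0 ?ltW.
    by have [_ _ h _] := H (sg n); rewrite lerNl.
  have uC n : `|u (sg n)| <= rho by [].
  have hL : l *: B (u (sg n)) + f (u (sg n)) + g (u (sg n)) @[n --> \oo] --> l *: B x + f x + g x.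
    apply: cvgD; last exact: (fw_g_weak FW).
    by apply: cvgD; [apply: cvgZ; [exact: cvg_cst|exact: (fw_B_weak FW)]|exact: (fw_f_weak FW)].
  have AL n : A (u (sg n)) = l *: B (u (sg n)) + f (u (sg n)) + g (u (sg n)) by have [] := H (sg n).
  have [tau [ht hu]] := A_strong_cvg uC wx hL AL.
  have hn : `|u (sg (tau n))| @[n --> \oo] --> `|x| by exact: cvg_norm.
  have : e <= `|x| by apply: (cvg_gec hn) => n; have [] := H (sg (tau n)).
  by rewrite x0 normr0 leNgt e0.
exists (- n.+1%:R^-1); first by rewrite oppr_lt0 invr_gt0.
move=> u u0 E h; rewrite ltNge; apply/negP => eu; apply: (Hn u); split => //; exact: ltW.
Qed.

End Compactness.

(** * Deformation *)

Definition soft_threshold {R : realType} (x h : R) : R := Num.max 0 (x - h) - Num.max 0 (- x - h).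

Section SoftThreshold.
Context {R : realType}.
Implicit Types x y h k : R.

Lemma soft_thresholdN x h : soft_threshold (- x) h = - soft_threshold x h.
Proof. by rewrite /soft_threshold opprB opprK. Qed.

Let max0P (x : R) : (x <= 0 /\ Num.max 0 x = 0) \/ (0 <= x /\ Num.max 0 x = x).
Proof. by case: (leP 0 x) => h; [right|left; split=> //; exact: ltW]. Qed.

Lemma soft_threshold_lip x y h k :
  `|soft_threshold x h - soft_threshold y k| <= 2 * `|x - y| + 2 * `|h - k|.
Proof.
rewrite /soft_threshold.
have [] := max0P (x - h) => -[]; have [] := max0P (- x - h) => -[];
have [] := max0P (y - k) => -[]; have [] := max0P (- y - k) => -[];
move: (Num.max 0 (x - h)) (Num.max 0 (- x - h)) (Num.max 0 (y - k)) (Num.max 0 (- y - k));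
move=> z1 z2 z3 z4 ? -> ? -> ? -> ? ->;
rewrite ler_norml; have := ler_norm (x - y); have := ler_norm (h - k);
have := lerNnormlW (lexx `|x - y|); have := lerNnormlW (lexx `|h - k|);
lra.
Qed.

Lemma soft_threshold_pairing x h : 0 <= h ->
  `|soft_threshold x h| * h <= soft_threshold x h * x.
Proof.
move=> h0; rewrite /soft_threshold.
have [] := max0P (x - h) => -[]; have [] := max0P (- x - h) => -[] e1 -> e2 ->;
rewrite ?subr0 ?sub0r.
- by rewrite normr0 !mul0r.
- by rewrite normrN ger0_norm//; nra.
- by rewrite ger0_norm//; nra.
- have -> : x = 0 by lra.
  have -> : h = 0 by lra.
  by rewrite !mulr0.
Qed.

Lemma soft_threshold_le x h : 0 <= h -> `|soft_threshold x h| <= `|x|.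
Proof.
move=> h0; rewrite /soft_threshold.
have [] := max0P (x - h) => -[]; have [] := max0P (- x - h) => -[] e1 -> e2 ->;
rewrite ?subr0 ?sub0r ?oppr0 ?normr0 ?normrN//.
- by rewrite ger0_norm//; have := lerNnormlW (lexx `|x|); lra.
- by rewrite ger0_norm//; have := ler_norm x; lra.
- have -> : x = 0 by lra.
  have -> : h = 0 by lra.
  by rewrite !(oppr0, subr0) normr0.
Qed.

End SoftThreshold.

(* A continuous substitute for a direction almost norming L: a sum, over a countable
   family [w] of almost norming vectors, weighted by the part of L (w i) above |L| / 2. *)
Section PseudoGradient.
Context {R : realType} {W : completeNormedModType R}.
Variable w : nat -> W.
Hypotheses (w1 : forall i, `|w i| <= 1)
  (w_norming : forall L : dual W, exists i, 3 / 4 * `|L| <= L (w i)).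

Implicit Types L M : dual W.
Let a (i : nat) (L : dual W) : R := (2^-1) ^+ i * soft_threshold (L (w i)) (`|L| / 2).
Let p (L : dual W) : nat -> W := series (fun i => a i L *: w i).

Let half_sum (k : nat) : \sum_(0 <= i < k) (2^-1 : R) ^+ i <= 2.
Proof.
suff -> : \sum_(0 <= i < k) (2^-1 : R) ^+ i = 2 - 2 * 2^-1 ^+ k.
  by rewrite gerBl mulr_ge0// exprn_ge0// invr_ge0.
elim: k => [|k IH]; first by rewrite big_nil expr0 mulr1 subrr.
by rewrite big_nat_recr//= IH exprS; field.
Qed.

Let half_ge0 i : 0 <= (2^-1 : R) ^+ i. Proof. by rewrite exprn_ge0// invr_ge0. Qed.

Let a_lip i L M : `|a i L - a i M| <= 2^-1 ^+ i * (3 * `|L - M|).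
Proof.
rewrite /a -mulrBr normrM (ger0_norm (half_ge0 i)) ler_wpM2l//.
apply: le_trans (soft_threshold_lip _ _ _ _) _.
have h1 : `|L (w i) - M (w i)| <= `|L - M|.
  rewrite -sub_dualE; apply: le_trans (dual_le _ _) _.
  by rewrite ler_piMr.
have h2 : `|(`|L| / 2) - (`|M| / 2)| <= `|L - M| / 2.
  by rewrite -mulrBl normrM (ger0_norm (_ : 0 <= 2^-1))// ler_wpM2r// ler_dist_dist.
lra.
Qed.

Let a_le i L : `|a i L| <= 2^-1 ^+ i * `|L|.
Proof.
rewrite /a normrM (ger0_norm (half_ge0 i)) ler_wpM2l//.
apply: le_trans (soft_threshold_le _ _) _; first by rewrite divr_ge0.
by apply: le_trans (dual_le _ _) _; rewrite ler_piMr.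
Qed.

Let p_lip k L M : `|p L k - p M k| <= 6 * `|L - M|.
Proof.
rewrite /p /series /= -sumrB; apply: le_trans (ler_norm_sum _ _ _) _.
apply: (@le_trans _ _ (\sum_(0 <= i < k) 2^-1 ^+ i * (3 * `|L - M|))).
  apply: ler_sum => i _; rewrite -scalerBl normrZ.
  by apply: le_trans (a_lip i L M); rewrite ler_piMr.
rewrite -mulr_suml; have := half_sum k; have := normr_ge0 (L - M); nra.
Qed.

Let pN k L : p (- L) k = - p L k.
Proof.
rewrite /p /series /= -sumrN; apply: eq_bigr => i _.
by rewrite /a (_ : (- L) (w i) = - L (w i))// normrN soft_thresholdN mulrN scaleNr.
Qed.

Let p_pairing k L : L (p L k) = \sum_(0 <= i < k) a i L * L (w i).
Proof. by rewrite /p /series /= !big_mkord dual_sum; apply: eq_bigr => i _; rewrite dualZ. Qed.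

Let a_pairing i L : `|a i L| * (`|L| / 2) <= a i L * L (w i).
Proof.
rewrite /a normrM (ger0_norm (half_ge0 i)) -!mulrA ler_wpM2l//.
by rewrite soft_threshold_pairing// divr_ge0.
Qed.

Let p_descent k L : `|L| / 2 * `|p L k| <= L (p L k).
Proof.
rewrite p_pairing; apply: (@le_trans _ _ (\sum_(0 <= i < k) `|a i L| * (`|L| / 2))).
  rewrite -mulr_suml mulrC ler_wpM2r ?divr_ge0// /p /series /=.
  apply: le_trans (ler_norm_sum _ _ _) _; apply: ler_sum => i _.
  by rewrite normrZ ler_piMr.
by apply: ler_sum => i _; exact: a_pairing.
Qed.

Let p_cvg L : cvgn (p L).
Proof.
apply: normed_cvg; apply: (@series_le_cvg _ _ (geometric `|L| 2^-1)) => [n|n|n|].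
- by rewrite normr_ge0.
- by rewrite /geometric /= mulr_ge0.
- rewrite /= normrZ mulrC; apply: le_trans (_ : 1 * `|a n L| <= _); first by rewrite ler_wpM2r.
  by rewrite mul1r mulrC a_le.
- by apply: is_cvg_geometric_series; rewrite ger0_norm ?invf_lt1 ?ltr1n.
Qed.

Definition pseudo_gradient (L : dual W) : W := limn (p L).

Let p_lim L : p L k @[k --> \oo] --> pseudo_gradient L. Proof. exact: p_cvg. Qed.

Lemma pseudo_gradient_lip L M : `|pseudo_gradient L - pseudo_gradient M| <= 6 * `|L - M|.
Proof.
have h : `|p L k - p M k| @[k --> \oo] --> `|pseudo_gradient L - pseudo_gradient M|.
  by apply: cvg_norm; apply: cvgB.
by apply: (cvg_lec h) => k; exact: p_lip.
Qed.

Lemma pseudo_gradient_cvg (T : Type) (E : set_system T) (EE : Filter E) (h : T -> dual W) L :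
  h @ E --> L -> pseudo_gradient (h x) @[x --> E] --> pseudo_gradient L.
Proof.
move=> /cvgrPdist_lt hL; apply/cvgrPdist_lt => e e0.
apply: filterS (hL (e / 6) (divr_gt0 e0 _)) => // x /= hx.
by apply: le_lt_trans (pseudo_gradient_lip _ _) _; rewrite mulrC -ltr_pdivlMr.
Qed.

Lemma pseudo_gradientN L : pseudo_gradient (- L) = - pseudo_gradient L.
Proof.
have h : p (- L) k @[k --> \oo] --> - pseudo_gradient L.
  by under eq_fun do rewrite pN; apply: cvgN.
apply: (@seq_cvg_unique R W (p (- L))); [exact: p_lim|exact: h].
Qed.

Let pairing_lim L : L (p L k) @[k --> \oo] --> L (pseudo_gradient L).
Proof.
apply: (@cvg_comp _ _ _ (p L) (dual_fun L) _ (nbhs (pseudo_gradient L))); first exact: p_lim.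
exact: dual_continuous.
Qed.

(** A vector has a nonzero weight only if [L] or [- L] is at least half its norm there, and the sign
    of the weight agrees; the estimate holds term by term. *)
Lemma pseudo_gradient_descent L : `|L| / 2 * `|pseudo_gradient L| <= L (pseudo_gradient L).
Proof.
have h : `|L| / 2 * `|p L k| @[k --> \oo] --> `|L| / 2 * `|pseudo_gradient L|.
  by apply: cvg_mull; apply: cvg_norm.
exact: (cvg_ler h (@pairing_lim L) (p_descent^~ L)).
Qed.

(** All terms of [L (p L k)] are nonnegative, and that of an almost norming vector is positive. *)
Lemma pseudo_gradient_neq0 L : L != 0 -> pseudo_gradient L != 0.
Proof.
move=> L0; have L1 : 0 < `|L| by rewrite normr_gt0.
have [i wi] := w_norming L; pose d := a i L * L (w i).
have d0 : 0 < d.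
  rewrite /d /a /soft_threshold mulr_gt0//; last by apply: lt_le_trans wi; rewrite mulr_gt0.
  have h1 : 0 <= L (w i) - `|L| / 2 by lra.
  have h2 : - L (w i) - `|L| / 2 <= 0 by lra.
  by rewrite mulr_gt0 ?exprn_gt0 ?invr_gt0// (max_r h1) (max_l h2); lra.
suff h : d <= L (pseudo_gradient L).
  by apply/eqP => e; move: h; rewrite e dual0 leNgt d0.
have h : forall k, d <= L (p L (k + i.+1)%N).
  move=> k; rewrite p_pairing (bigD1_seq i) ?mem_index_iota ?iota_uniq//=; last by lia.
  rewrite lerDl sumr_ge0// => j _; apply: le_trans (a_pairing j L).
  by rewrite mulr_ge0// divr_ge0.
apply: (cvg_gec _ h); rewrite (cvg_shiftn i.+1 (fun k => L (p L k))).
exact: pairing_lim.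
Qed.

End PseudoGradient.

(** * Descent field and discrete flow *)

Section Descent.
Context {R : realType} {W : completeNormedModType R}.
Variable w : nat -> W.
Hypotheses (w1 : forall i, `|w i| <= 1)
  (w_norming : forall L : dual W, exists i, 3 / 4 * `|L| <= L (w i)).
Variables (E : W -> R) (dE : W -> dual W).
Hypotheses (E_diff : forall u, u != 0 -> is_diff u E (dE u : W -> R))
  (dE_continuous : forall u, u != 0 -> dE @ u --> dE u)
  (E_even : forall u, E (- u) = E u) (dE_odd : forall u, dE (- u) = - dE u).
Variables (a d : R).
Hypothesis d_gt0 : 0 < d.

Let E_continuous u : u != 0 -> E @ u --> E u.
Proof.
move=> u0; have := @ex_diff _ _ _ _ _ _ _ (E_diff u0).
exact: differentiable_continuous.
Qed.

Let band u := [/\ u != 0, d / 2 < `|dE u| & `|E u - a| < d].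

(** In the band the pairing with the direction is at least half of d/2 times its norm; an
    oscillation of [dE] of at most d/8 leaves the slope d/8 during the whole step. *)
Let radius_prop u (rho : R) := forall v v', `|v - u| < rho -> `|v' - u| < rho ->
  band v /\ `|dE v - dE v'| <= d / 8.

Let radius := sup_radius radius_prop.

Let near_neq0 (u : W) : u != 0 -> \forall v \near u, v != 0.
Proof.
move=> u0; have nu : 0 < `|u| by rewrite normr_gt0.
near=> v; apply/eqP => v0.
have : `|u - v| < `|u| by near: v; exact: cvgr_dist_lt.
by rewrite v0 subr0 ltxx.
Unshelve. all: by end_near. Qed.

Let near_band u : band u -> \forall v \near u, band v.
Proof.
move=> [u0 du eu]; near=> v; split.
- by near: v; exact: near_neq0.
- near: v; have h : `|dE v| @[v --> u] --> `|dE u| by apply: cvg_norm; exact: dE_continuous.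
  exact: (cvgr_gt _ h).
- near: v; have h : `|E v - a| @[v --> u] --> `|E u - a|.
    by apply: cvg_norm; apply: cvgB; [exact: E_continuous|exact: cvg_cst].
  exact: (cvgr_lt _ h).
Unshelve. all: by end_near. Qed.

Let radius_shift u v (rho : R) : radius_prop u rho -> `|u - v| < rho ->
  radius_prop v (rho - `|u - v|).
Proof.
move=> P uv z z' zv z'v.
have tri (y : W) : `|y - v| < rho - `|u - v| -> `|y - u| < rho.
  move=> h; have -> : y - u = (y - v) - (u - v) by rewrite opprB addrA subrK.
  by apply: le_lt_trans (ler_normB _ _) _; rewrite -ltrBrDr.
by apply: P; exact: tri.
Qed.

Let radius_gt0 u : band u -> 0 < radius u.
Proof.
move=> ou; have [u0 _ _] := ou.
have [r1 /= r10 h1] := (nbhs_ballP _ _).1 (near_band ou).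
have d0 : 0 < d / 16 by rewrite divr_gt0.
have hn : \forall v \near u, `|dE u - dE v| < d / 16.
  by have /cvgrPdist_lt := dE_continuous u0; apply.
have [r2 /= r20 h2] := (nbhs_ballP _ _).1 hn.
pose rho : R := Num.min 1 (Num.min r1 r2).
have rho0 : 0 < rho by rewrite !lt_min ltr01 r10 r20.
apply: lt_le_trans rho0 _; apply: sup_radius_ge.
  by rewrite !lt_min ltr01 r10 r20 /= ge_min lexx.
move=> v v' hv hv'.
have b1 (y : W) : `|y - u| < rho -> ball u r1 y /\ ball u r2 y.
  by rewrite -ball_normE /= distrC /rho !lt_min => /and3P[_ -> ->].
split; first by apply: h1; exact: (b1 _ hv).1.
have k1 : `|dE u - dE v| < d / 16 by apply: h2; exact: (b1 _ hv).2.
have k2 : `|dE u - dE v'| < d / 16 by apply: h2; exact: (b1 _ hv').2.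
have -> : dE v - dE v' = (dE u - dE v') - (dE u - dE v) by rewrite opprB [RHS]addrC addrA subrK.
by apply: le_trans (ler_normB _ _) _; lra.
Qed.

Let radius0 u : ~ band u -> radius u = 0.
Proof.
move=> nou; apply/eqP; rewrite eq_le sup_radius_ge0 andbT leNgt; apply/negP.
move=> /(sup_radius_gt (lexx _))[rho [r0 _ P]]; apply: nou.
by have [] := P u u; rewrite ?subrr ?normr0.
Qed.

Let bandN u : band u -> band (- u).
Proof. by move=> [h1 h2 h3]; split; rewrite ?oppr_eq0 ?dE_odd ?normrN ?E_even. Qed.

Let radiusN u : radius (- u) = radius u.
Proof.
suff h v rho : radius_prop v rho -> radius_prop (- v) rho.
  rewrite /radius /sup_radius; congr (sup _); apply/seteqP; split => x [->|[h1 h2]].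
  - by left.
  - by right; split => //; rewrite -(opprK u); exact: h.
  - by left.
  - by right; split => //; exact: h.
move=> P z z' hz hz'.
have e (y : W) : `|- y - v| = `|y - - v| by rewrite -opprD normrN opprK.
have [||b1 b2] := P (- z) (- z'); rewrite ?e//.
split; first by rewrite -(opprK z); exact: bandN.
by move: b2; rewrite !dE_odd -opprD normrN.
Qed.

Let dir u := pseudo_gradient w (dE u).
(** Keeps a unit step within half the radius, and makes the field vanish continuously at the edge of
    the band. *)
Let speed u := radius u / 2 * (1 + `|dir u|)^-1.

Definition descent_field u : W := speed u *: dir u.

Let dirN u : dir (- u) = - dir u.
Proof. by rewrite /dir dE_odd pseudo_gradientN. Qed.

Lemma descent_fieldN u : descent_field (- u) = - descent_field u.
Proof. by rewrite /descent_field /speed radiusN dirN normrN scalerN. Qed.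

Let den_gt0 u : 0 < 1 + `|dir u|. Proof. by rewrite ltr_wpDr. Qed.

Let radius_ge0 u : 0 <= radius u. Proof. exact: sup_radius_ge0. Qed.

Let speed_ge0 u : 0 <= speed u.
Proof. by rewrite mulr_ge0 ?divr_ge0 ?invr_ge0// ltW. Qed.

Lemma descent_field_le u : `|descent_field u| <= radius u / 2.
Proof.
rewrite normrZ (ger0_norm (speed_ge0 u)) /speed -[leLHS]mulrA ler_piMr ?divr_ge0//.
by rewrite mulrC ler_pdivrMr// mul1r lerDr.
Qed.

Let descent_field0 u : ~ band u -> descent_field u = 0.
Proof. by move=> /radius0 r0; rewrite /descent_field /speed r0 !mul0r scale0r. Qed.

Let descent_field_neq0 u : band u -> descent_field u != 0.
Proof.
move=> ou; rewrite scaler_eq0 negb_or; apply/andP; split.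
  by rewrite /speed mulf_neq0 ?invr_eq0 ?gt_eqF ?divr_gt0 ?radius_gt0.
apply: pseudo_gradient_neq0 => //; have [_ h _] := ou.
by rewrite -normr_gt0; apply: lt_trans h; rewrite divr_gt0.
Qed.

(** Off the band nothing is known of [dir], at 0 for instance; there the field is dominated by the
    continuous [radius], which vanishes. *)
Lemma descent_field_continuous : continuous descent_field.
Proof.
have rc : continuous radius by exact: (sup_radius_continuous radius_shift).
move=> u; have [ou|nou] := pselect (band u); last first.
  apply/cvgrPdist_lt => e e0; rewrite (descent_field0 nou).
  have hr : \forall v \near u, `|radius u - radius v| < e.
    by have /cvgrPdist_lt := rc u; apply.
  apply: filterS hr => v; rewrite (radius0 nou) !sub0r !normrN => h.
  apply: le_lt_trans (descent_field_le v) _.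
  by apply: le_lt_trans h; rewrite (ger0_norm (radius_ge0 v)) ler_pdivrMr// ler_peMr ?ler1n.
have [u0 _ _] := ou.
have hd : dir v @[v --> u] --> dir u.
  by apply: pseudo_gradient_cvg => //; exact: dE_continuous.
apply: cvgZ => //; apply: cvgM; first by apply: cvgM; [exact: rc|exact: cvg_cst].
apply: cvgV; first by rewrite gt_eqF.
by apply: cvgD; [exact: cvg_cst|exact: cvg_norm].
Qed.

Lemma descent_step u (t : R) : u != 0 -> 0 <= t <= 1 ->
  u - t *: descent_field u != 0 /\
  E (u - t *: descent_field u) <= E u - d / 8 * (t * `|descent_field u|).
Proof.
move=> u0 /andP[t0 t1]; have [ou|nou] := pselect (band u); last first.
  by rewrite (descent_field0 nou) scaler0 subr0 normr0 !mulr0 subr0.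
have rhalf : 0 <= radius u / 2 < radius u.
  by rewrite divr_ge0//= ltr_pdivrMr// ltr_pMr ?radius_gt0// ltr1n.
have [rho [r1 _ P]] := @sup_radius_gt _ _ radius_prop u _ (andP rhalf).1 (andP rhalf).2.
have rho0 : 0 < rho by apply: le_lt_trans r1; rewrite divr_ge0.
pose T := t * speed u; have T0 : 0 <= T by rewrite mulr_ge0.
have uE (x : R) : x * speed u *: dir u = x *: descent_field u by rewrite scalerA.
have hT : T * `|dir u| < rho.
  apply: le_lt_trans r1; apply: le_trans (descent_field_le u).
  rewrite /descent_field normrZ (ger0_norm (speed_ge0 u)) /T -[leLHS]mulrA ler_piMl//.
  by rewrite mulr_ge0.
have inball (x : R) : 0 <= x <= T -> `|u + x *: - dir u - u| < rho.
  move=> /andP[x0 xT]; rewrite addrAC subrr add0r normrZ normrN (ger0_norm x0).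
  by apply: le_lt_trans hT; rewrite ler_wpM2r.
have uu : `|u - u| < rho by rewrite subrr normr0.
have -> : u - t *: descent_field u = u + T *: - dir u by rewrite scalerN uE.
have TT : 0 <= T <= T by rewrite T0 lexx.
split; first by have [[]] := P _ _ (inball T TT) uu.
have -> : t * `|descent_field u| = T * `|dir u|.
  by rewrite normrZ (ger0_norm (speed_ge0 u)) mulrA.
move: T0; rewrite le_eqVlt => /orP[/eqP <-|T0].
  by rewrite scale0r addr0 mul0r mulr0 subr0.
have seg (x : R) : 0 <= x <= T -> is_diff (u + x *: - dir u) E (dE (u + x *: - dir u) : W -> R).
  by move=> xT; apply: E_diff; have [[]] := P _ _ (inball x xT) uu.
have [x /andP[x0 xT] h] := line_mvt T0 seg.
have xx : 0 <= x <= T by rewrite !ltW.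
have [_ osc] := P _ _ uu (inball x xx).
have [_ du _] := ou; have k := pseudo_gradient_descent w1 (dE u).
rewrite -/(dir u) in k.
have k2 : dE u (dir u) - dE (u + x *: - dir u) (dir u) <= d / 8 * `|dir u|.
  rewrite -sub_dualE; apply: le_trans (ler_norm _) _; apply: le_trans (dual_le _ _) _.
  by rewrite ler_wpM2r.
move: h; rewrite dualN => h.
have k3 : d / 8 * `|dir u| <= dE (u + x *: - dir u) (dir u).
  have := normr_ge0 (dir u); nra.
have := ler_wpM2l (ltW T0) k3; lra.
Qed.

Variable X : set W.
Hypothesis X_band : forall x u, X x -> `|u - x| <= d ->
  u != 0 /\ (`|E u - a| <= d -> d <= `|dE u|).

(** A trajectory that stays between the levels a + eps and a - eps has length at most 2 eps / (d/8)
    = 16 eps / d, hence at most d: it does not leave the region that [X_band] controls. *)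
Let eps : R := Num.min (d / 2) (d * d / 16).

Let eps_gt0 : 0 < eps. Proof. by rewrite lt_min !divr_gt0 ?mulr_gt0. Qed.
Let eps_le1 : eps <= d / 2. Proof. by rewrite /eps ge_min lexx. Qed.
Let eps_le2 : eps <= d * d / 16. Proof. by rewrite /eps ge_min lexx orbT. Qed.

Let Z n u := iter n (fun v => v - descent_field v) u.

Let Z_continuous n : continuous (Z n).
Proof.
elim: n => [|n IH] u; first exact: cvg_id.
apply: (@cvg_comp _ _ _ (Z n) (fun v => v - descent_field v) _ (nbhs (Z n u))); first exact: IH.
by apply: cvgB; [exact: cvg_id|exact: descent_field_continuous].
Qed.

Let ZN n u : Z n (- u) = - Z n u.
Proof. by elim: n => //= n IH; rewrite /Z /= -/(Z n _) IH descent_fieldN -opprD. Qed.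

Let step1 u : u != 0 -> u - descent_field u != 0 /\
  E (u - descent_field u) <= E u - d / 8 * `|descent_field u|.
Proof.
move=> u0; have := @descent_step u 1 u0; rewrite scale1r mul1r; apply.
by rewrite ler01 lexx.
Qed.

Let Z_neq0 n u : u != 0 -> Z n u != 0.
Proof. by move=> u0; elim: n => //= n /step1[]. Qed.

Let Z_descent n u : u != 0 ->
  E (Z n u) + d / 8 * \sum_(0 <= i < n) `|descent_field (Z i u)| <= E u.
Proof.
move=> u0; elim: n => [|n IH]; first by rewrite big_nil mulr0 addr0.
rewrite big_nat_recr//= mulrDr; apply: le_trans IH.
have [_] := step1 (Z_neq0 n u0); rewrite /Z /=; lra.
Qed.

Let Z_sum n u : Z n u = u - series (fun i => descent_field (Z i u)) n.
Proof.
rewrite /series /=; elim: n => [|n IH]; first by rewrite big_nil subr0.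
by rewrite big_nat_recr//= opprD addrA -IH.
Qed.

Let entered n u := u != 0 /\ E (Z n u) < a - eps.

Let X_neq0 x : X x -> x != 0.
Proof.
move=> Xx; have xx : `|x - x| <= d by rewrite subrr normr0 ltW.
by have [] := X_band Xx xx.
Qed.

Let reach x : X x -> E x <= a + eps -> exists n, entered n x.
Proof.
move=> Xx Ex; have x0 := X_neq0 Xx.
apply: contrapT => nent.
have lowE n : a - eps <= E (Z n x).
  by rewrite leNgt; apply/negP => h; apply: nent; exists n.
have sum_le n : \sum_(0 <= i < n) `|descent_field (Z i x)| <= d.
  have := Z_descent n x0; have := lowE n; move: (\sum_(0 <= i < n) _) => S h1 h2.
  have h3 : d / 8 * S <= d / 8 * d by move: eps_le2; lra.
  by move: h3; rewrite ler_pM2l// divr_gt0.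
have cv : cvgn (series (fun i => descent_field (Z i x))).
  apply: normed_cvg; apply: nondecreasing_is_cvgn.
    by apply: nondecreasing_series => n _ _; rewrite normr_ge0.
  by exists d => _ [n _ <-]; exact: sum_le.
set S := limn _ in cv.
have hZ : Z n x @[n --> \oo] --> x - S.
  under eq_fun do rewrite Z_sum; apply: cvgB; [exact: cvg_cst|exact: cv].
set u := x - S in hZ.
have ux : `|u - x| <= d.
  have h : `|Z n x - x| @[n --> \oo] --> `|u - x|.
    by apply: cvg_norm; apply: cvgB => //; exact: cvg_cst.
  apply: (cvg_lec h) => n; rewrite Z_sum addrAC subrr add0r normrN /series /=.
  exact: le_trans (ler_norm_sum _ _ _) (sum_le n).
have [u0 hu] := X_band Xx ux.
have hE : E (Z n x) @[n --> \oo] --> E u.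
  by apply: (cvg_comp _ _ hZ); exact: E_continuous.
have Eu1 : a - eps <= E u by exact: cvg_gec hE lowE.
have Eu2 : E u <= a + eps.
  apply: (cvg_lec hE) => n; apply: le_trans Ex; apply: le_trans (Z_descent n x0).
  by rewrite lerDl; apply: mulr_ge0; [rewrite divr_ge0 ?(ltW d_gt0)|apply: sumr_ge0].
have Ea : `|E u - a| <= eps by rewrite ler_norml; apply/andP; split; lra.
have bu : band u.
  have ed : eps < d by apply: (le_lt_trans eps_le1); rewrite ltr_pdivrMr// ltr_pMr// ltr1n.
  split => //; last exact: le_lt_trans ed.
  have := hu (le_trans Ea (ltW ed)); apply: lt_le_trans.
  by rewrite ltr_pdivrMr// ltr_pMr// ltr1n.
have /eqP := descent_field_neq0 bu; apply.
have h1 : descent_field (Z n x) @[n --> \oo] --> descent_field u.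
  by apply: (cvg_comp _ _ hZ); exact: descent_field_continuous.
have h2 : descent_field (Z n x) @[n --> \oo] --> (0 : W).
  by apply: cvg_series_cvg_0; exact: cv.
exact: seq_cvg_unique h1 h2.
Qed.

Let entered_open n u : entered n u -> \forall v \near u, entered n v.
Proof.
move=> [u0 h]; near=> v; split; first by near: v; exact: near_neq0.
near: v; have hE : E (Z n v) @[v --> u] --> E (Z n u).
  apply: (@cvg_comp _ _ _ (Z n) E _ (nbhs (Z n u))); first exact: Z_continuous.
  by apply: E_continuous; exact: Z_neq0.
exact: (cvgr_lt _ hE).
Unshelve. all: by end_near. Qed.

(* The bound [k * rho <= 1] makes [2 / er u] exceed an entrance time of u. *)
Let enter_prop u (rho : R) := exists k : nat, k%:R * rho <= 1 /\
  forall v, `|v - u| < rho -> entered k v.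

Let er := sup_radius enter_prop.

Let er_shift u v (rho : R) : enter_prop u rho -> `|u - v| < rho ->
  enter_prop v (rho - `|u - v|).
Proof.
move=> [k [k1 P]] uv; exists k; split.
  by apply: le_trans k1; rewrite ler_wpM2l// gerBl.
move=> y h; apply: P; have -> : y - u = (y - v) - (u - v) by rewrite opprB addrA subrK.
by apply: le_lt_trans (ler_normB _ _) _; rewrite -ltrBrDr.
Qed.

Let er_continuous : continuous er. Proof. exact: (sup_radius_continuous er_shift). Qed.

Let er_gt0 x : X x -> E x <= a + eps -> 0 < er x.
Proof.
move=> Xx Ex; have [n en] := reach Xx Ex.
have [r1 /= r10 h1] := (nbhs_ballP _ _).1 (entered_open en).
pose rho : R := Num.min n.+1%:R^-1 r1.
have rho0 : 0 < rho by rewrite lt_min r10 invr_gt0 ltr0n.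
have rhon : rho <= n.+1%:R^-1 by rewrite /rho ge_min lexx.
apply: lt_le_trans rho0 _; apply: sup_radius_ge.
  rewrite lt_min r10 invr_gt0 ltr0n/=; apply: le_trans rhon _.
  by rewrite invf_le1 ?ler1n.
exists n; split.
  apply: (@le_trans _ _ (n%:R * n.+1%:R^-1)); first by rewrite ler_wpM2l.
  by rewrite ler_pdivrMr// mul1r ler_nat.
move=> v hv; apply: h1; rewrite -ball_normE /= distrC.
by apply: lt_le_trans hv _; rewrite /rho ge_min lexx orbT.
Qed.

Let erN u : er (- u) = er u.
Proof.
suff h v rho : enter_prop v rho -> enter_prop (- v) rho.
  rewrite /er /sup_radius; congr (sup _); apply/seteqP; split => x [->|[h1 h2]].
  - by left.
  - by right; split => //; rewrite -(opprK u); exact: h.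
  - by left.
  - by right; split => //; exact: h.
move=> [k [k1 P]]; exists k; split => // z hz.
have [] := P (- z); first by rewrite -opprD normrN -[X in _ + X]opprK.
by rewrite oppr_eq0 ZN E_even.
Qed.

Let clamp (t : R) : R := Num.max 0 (Num.min 1 t).

Let clamp01 t : 0 <= clamp t <= 1.
Proof. by rewrite /clamp le_max lexx ge_max ler01 ge_min lexx. Qed.

Let clamp0 t : t <= 0 -> clamp t = 0.
Proof.
by move=> t0; rewrite /clamp max_l// ge_min t0 orbT.
Qed.

Let clamp1 t : 1 <= t -> clamp t = 1.
Proof. by move=> t1; rewrite /clamp min_l// max_r// ler01. Qed.

(* The second component counts down the time left before the point stops. *)
Let flow (p : W * R) : W * R := (p.1 - clamp p.2 *: descent_field p.1, p.2 - 1).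

Let flow_continuous : continuous flow.
Proof.
move=> p; apply: (@cvg_pair _ _ _ (nbhs p) (nbhs (flow p).1) (nbhs (flow p).2)).
  have h1 : q.1 @[q --> p] --> p.1 by exact: cvg_fst.
  have h2 : q.2 @[q --> p] --> p.2 by exact: cvg_snd.
  apply: cvgB => //; apply: cvgZ; last first.
    by apply: (@cvg_comp _ _ _ fst descent_field _ (nbhs p.1)) => //; exact: descent_field_continuous.
  apply: (@cvg_comp _ _ _ snd clamp _ (nbhs p.2)) => //.
  by apply: continuous_max; [exact: cvg_cst|apply: continuous_min; [exact: cvg_cst|exact: cvg_id]].
by apply: cvgB; [exact: cvg_snd|exact: cvg_cst].
Qed.

Let iter_flow_continuous n : continuous (iter n flow).
Proof.
elim: n => [|n IH] p; first exact: cvg_id.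
by apply: (@cvg_comp _ _ _ (iter n flow) flow _ (nbhs (iter n flow p))); [exact: IH|exact: flow_continuous].
Qed.

Let iter_flow2 n p : (iter n flow p).2 = p.2 - n%:R.
Proof. by elim: n => [|n IH]; rewrite ?subr0//= IH -natr1 opprD addrA. Qed.

Let iter_flow_stop m n p : p.2 <= m%:R -> (m <= n)%N -> (iter n flow p).1 = (iter m flow p).1.
Proof.
move=> pm /subnK <-; elim: (n - m)%N => // j IH.
rewrite addSn iterS /flow /= clamp0 ?scale0r ?subr0//.
by rewrite iter_flow2 natrD; have : 0 <= j%:R :> R by []; lra.
Qed.

Let iter_flow_full n p : n%:R <= p.2 -> (iter n flow p).1 = Z n p.1.
Proof.
elim: n => // n IH h; rewrite iterS /flow /= clamp1 ?scale1r ?IH//.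
  by apply: le_trans h; rewrite ler_nat.
by rewrite iter_flow2; move: h; rewrite -natr1; lra.
Qed.

Let iter_flowN n u t : iter n flow (- u, t) = (- (iter n flow (u, t)).1, (iter n flow (u, t)).2).
Proof. by elim: n => // n IH; rewrite !iterS IH /flow /= descent_fieldN scalerN opprD. Qed.

Let iter_flow_descent m n p : p.1 != 0 -> (m <= n)%N ->
  (iter n flow p).1 != 0 /\ E (iter n flow p).1 <= E (iter m flow p).1.
Proof.
move=> p0; have nz j : (iter j flow p).1 != 0.
  elim: j => // j h; rewrite iterS /flow /=.
  by have [] := descent_step h (clamp01 (iter j flow p).2).
move=> /subnK <-; split => //; elim: (n - m)%N => // j IH.
apply: le_trans IH; rewrite addSn iterS /flow /=; set v := iter _ _ _.
have [_] := descent_step (nz (j + m)%N) (clamp01 v.2); move=> /le_trans; apply.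
have /andP[c0 _] := clamp01 v.2.
by rewrite gerBl !mulr_ge0 ?divr_ge0 ?(ltW d_gt0).
Qed.

Let duration u : R := 2 / er u.

Lemma deformation : exists2 e : R, 0 < e & exists eta : W -> W,
  forall x, X x -> E x <= a + e ->
  [/\ eta @ x --> eta x, eta (- x) = - eta x, eta x != 0 & E (eta x) <= a - e].
Proof.
exists eps => //.
(* The number of iterations jumps with [u], but by [iter_flow_stop] additional ones change nothing,
   so that near [x] one fixed number serves. *)
pose eta u := (iter (Num.truncn (duration u)).+1 flow (u, duration u)).1.
have etaE u m : duration u <= m%:R -> eta u = (iter m flow (u, duration u)).1.
  move=> um; have [h|/ltnW h] := leqP (Num.truncn (duration u)).+1 m.
    by rewrite /eta -(iter_flow_stop _ h)//= ltW// truncnS_gt.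
  by rewrite /eta (iter_flow_stop (m := m)).
exists eta => x Xx Ex; have r0 := er_gt0 Xx Ex.
have x0 := X_neq0 Xx.
have dc : duration v @[v --> x] --> duration x.
  apply: cvgM; first exact: cvg_cst.
  by apply: cvgV; [rewrite gt_eqF|exact: er_continuous].
split.
- pose m := (Num.truncn (duration x + 1)).+1.
  have xm : duration x < m%:R by apply: lt_trans (truncnS_gt _); rewrite ltrDl.
  rewrite (etaE x m) ?ltW//.
  have hc : (iter m flow (v, duration v)).1 @[v --> x] --> (iter m flow (x, duration x)).1.
    apply: (@cvg_comp _ _ _ (fun v => iter m flow (v, duration v)) fst _
      (nbhs (iter m flow (x, duration x)))); last exact: cvg_fst.
    apply: (@cvg_comp _ _ _ (fun v => (v, duration v)) (iter m flow) _
      (nbhs (x, duration x))); last exact: iter_flow_continuous.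
    by apply: (@cvg_pair _ _ _ (nbhs x) (nbhs x) (nbhs (duration x))); [exact: cvg_id|exact: dc].
  apply: cvg_trans hc; apply: near_eq_cvg; near=> v.
  rewrite -etaE// ltW//; near: v; exact: (cvgr_lt _ dc).
- by rewrite /eta /duration erN iter_flowN.
- by have [] := @iter_flow_descent 0 (Num.truncn (duration x)).+1 (x, duration x) x0.
- have h2 : er x / 2 < er x by rewrite ltr_pdivrMr// ltr_pMr// ltr1n.
  have [rho [r1 _ [k [k1 P]]]] := sup_radius_gt (divr_ge0 (ltW r0) (ler0n _ 2)) h2.
  have rho0 : 0 < rho by apply: lt_trans r1; rewrite divr_gt0.
  have xx : `|x - x| < rho by rewrite subrr normr0.
  have [_ Ek] := P x xx.
  have kd : k%:R <= duration x.
    rewrite /duration ler_pdivlMr//; apply: le_trans (_ : k%:R * (rho * 2) <= _).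
      by rewrite ler_wpM2l// -ler_pdivrMr// ltW.
    by rewrite mulrA; move: k1; lra.
  have km : (k <= (Num.truncn (duration x)).+1)%N.
    by rewrite -(ler_nat R) ltW// (le_lt_trans kd)// truncnS_gt.
  have [_] := @iter_flow_descent k _ (x, duration x) x0 km.
  rewrite (@iter_flow_full k)//= => /le_trans; apply; exact: ltW.
Unshelve. all: by end_near. Qed.

End Descent.

(** * The minimax values *)

Section Spheres.
Context {R : realType} {W : completeNormedModType R}.
Hypothesis W_infinite : infinite_dimensional W.

Lemma independent_family n : exists e : 'I_n -> W,
  forall a : 'I_n -> R, \sum_i a i *: e i = 0 -> forall i, a i = 0.
Proof.
elim: n => [|n [e IH]]; first by exists (fun=> 0) => a _ [].
have [u hu] := W_infinite e.
exists (fun i => oapp e u (unlift ord_max i)) => a.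
rewrite (bigD1_ord ord_max)//= unlift_none /=.
under eq_bigr do rewrite liftK /=.
move=> E; have am : a ord_max = 0.
  apply/eqP; apply: contrapT => /negP am.
  apply: (hu (fun i => - (a ord_max)^-1 * a (lift ord_max i))).
  under eq_bigr do rewrite -scalerA; rewrite -scaler_sumr.
  move/eqP: E; rewrite addrC addr_eq0 => /eqP ->.
  by rewrite scalerN scaleNr opprK scalerA mulVf// scale1r.
rewrite am scale0r add0r in E; move=> i.
case: (unliftP ord_max i) => [j|] ->; last exact: am.
exact: (IH (fun i => a (lift ord_max i)) E).
Qed.

Lemma sphere_embedding k : exists phi : 'rV[R]_k.+1 -> W,
  [/\ continuous phi, forall x, phi (- x) = - phi x & forall x, x != 0 -> phi x != 0].
Proof.
have [e he] := independent_family k.+1.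
exists (fun x => \sum_i x ord0 i *: e i); split.
- move=> z; apply: (@cvg_big _ _ _ _ _ add_continuous _ (nbhs z) _ _ _ (nbhs_filter z)) => i _.
  by apply: cvgZ; [exact: coord_continuous|exact: cvg_cst].
- by move=> x; rewrite -sumrN; apply: eq_bigr => i _; rewrite mxE scaleNr.
- move=> x; apply: contra => /eqP E; apply/eqP/rowP => i.
  by rewrite mxE (he (fun i => x ord0 i) E).
Qed.

Lemma cross_polytope_neq0 n (x : 'rV[R]_n.+1) : cross_polytope x -> x != 0.
Proof.
apply: contraPneq => ->; rewrite /cross_polytope /= big1 => [/eqP|i _].
  by rewrite eq_sym oner_eq0.
by rewrite mxE normr0.
Qed.

Lemma cross_polytope_bounded n (h : 'rV[R]_n.+1 -> R) : continuous h ->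
  exists M : R, forall x, cross_polytope x -> h x <= M.
Proof.
move=> hc; have [S0|S0] := pselect (@cross_polytope R n !=set0); last first.
  by exists 0 => x xS; exfalso; apply: S0; exists x.
have [z _ hz] := EVT_max_rV S0 (@cross_polytope_compact R n) (continuous_subspaceT hc).
by exists (h z) => x xS; apply: hz; rewrite inE.
Qed.

Lemma cross_polytope_positive n (h : 'rV[R]_n.+1 -> R) : continuous h ->
  (forall x, cross_polytope x -> 0 < h x) ->
  exists2 m : R, 0 < m & forall x, cross_polytope x -> m <= h x.
Proof.
move=> hc hp; have [S0|S0] := pselect (@cross_polytope R n !=set0); last first.
  by exists 1 => // x xS; exfalso; apply: S0; exists x.
have [z zS hz] := EVT_min_rV S0 (@cross_polytope_compact R n) (continuous_subspaceT hc).
rewrite inE in zS; exists (h z); first exact: hp.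
by move=> x xS; apply: hz; rewrite inE.
Qed.

Lemma cont_on_cvg (M : set W) (phi : W -> W) :
  (forall x, M x -> phi @ x --> phi x) -> cont_on M phi.
Proof.
move=> h z Mz e e0; have /cvgrPdist_lt/(_ e e0)/nbhs_ballP[d /= d0 hd] := h z Mz.
exists d => // x _ zx; apply: hd; by rewrite -ball_normE.
Qed.

End Spheres.

(** * Criticality of the minimax values and their dependence on c *)

Section Minimax.
Context {R : realType} {W : completeNormedModType R}
  {scl : W -> R -> W} {q s r : R} {A B f g : W -> dual W}.
Hypothesis FW : framework scl q s r A B f g.
Hypothesis W_infinite : infinite_dimensional W.

Local Notation I := (potential A).
Local Notation J := (potential B).
Local Notation F := (potential f).
Local Notation G := (potential g).
Local Notation lam := (lambda_fun A B f g).
Local Notation N := (nehari scl A B f g).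
Local Notation minimax := (minimax scl A B f g).
Local Notation proj := (@nehari_proj R W scl q s r f g).

Let q_gt0 : 0 < q. Proof. exact: fw_q_gt0 FW. Qed.
Let q_lt_s : q < s. Proof. exact: fw_q_lt_s FW. Qed.
Let s_lt_r : s < r. Proof. exact: fw_s_lt_r FW. Qed.

Let admissible c k (M : set W) :=
  [/\ M `<=` N c, symmetric_set M & (k%:R%:E <= fr_index M)%E].

Lemma minimax_le (c b : R) (k : nat) (M : set W) : admissible c k M ->
  (forall u, M u -> lam c u <= b) -> (minimax c k <= b%:E)%E.
Proof.
move=> adm Mb; apply: ge_ereal_inf; exists (ereal_sup [set (lam c u)%:E | u in M]).
  by exists M.
by apply/ereal_supP => _ [u Mu <-]; rewrite lee_fin Mb.
Qed.

Lemma minimax_lt (c b : R) (k : nat) : (minimax c k < b%:E)%E ->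
  exists2 M, admissible c k M & forall u, M u -> lam c u <= b.
Proof.
move=> /ereal_inf_lt[_ [M adm <-] h]; exists M => // u Mu.
rewrite -lee_fin; apply: ltW; apply: le_lt_trans h.
by apply: ereal_sup_ubound; exists u.
Qed.

Lemma minimax_ge (c b : R) (k : nat) :
  (forall M, admissible c k M -> exists2 u, M u & b <= lam c u) -> (b%:E <= minimax c k)%E.
Proof.
move=> h; apply/ereal_infP => _ [M adm <-]; have [u Mu bu] := h M adm.
by apply: le_ereal_sup_tmp; exists (lam c u)%:E; [exists u|rewrite lee_fin].
Qed.

Lemma minimax_nondecreasing (c : R) (j k : nat) : (j <= k)%N -> (minimax c j <= minimax c k)%E.
Proof.
move=> jk; apply: ereal_inf_le_tmp => _ [M [h1 h2 h3] <-]; exists M => //; split => //.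
by apply: le_trans h3; rewrite lee_fin ler_nat.
Qed.

Lemma minimax_image (c c' b : R) (k : nat) (M : set W) (phi : W -> W) : (1 <= k)%N ->
  admissible c k M ->
  (forall x, M x -> [/\ phi @ x --> phi x, phi (- x) = - phi x, N c' (phi x) & lam c' (phi x) <= b]) ->
  (minimax c' k <= b%:E)%E.
Proof.
move=> k1 [MN Ms Mk] H; have [h h_map] := odd_sphere_map (fw_reflexive FW) (fw_B_weak FW) (fw_B_gt0 FW).
have sym : symmetric_set (phi @` M).
  by move=> _ [x Mx <-]; exists (- x); [exact: Ms|have [] := H x Mx].
have sub : phi @` M `<=` N c' by move=> _ [x Mx <-]; have [] := H x Mx.
apply: (@minimax_le _ _ _ (phi @` M)); last by move=> _ [x Mx <-]; have [] := H x Mx.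
split => //; apply: (index_image h_map (phi := phi) Ms sym) => //.
- by move=> /MN; exact: (nehari_not0 FW).
- by move=> /sub; exact: (nehari_not0 FW).
- by move=> x Mx; have [] := H x Mx.
- by apply: cont_on_cvg => x Mx; have [] := H x Mx.
Qed.

Lemma minimax_proj (c c' b : R) (k : nat) (M : set W) (phi : W -> W) : (1 <= k)%N ->
  c' < 0 -> admissible c k M ->
  (forall x, M x -> [/\ phi @ x --> phi x, phi (- x) = - phi x, phi x != 0 & lam c' (phi x) <= b]) ->
  (minimax c' k <= b%:E)%E.
Proof.
move=> k1 c0 adm H; apply: (minimax_image (phi := proj c' \o phi) k1 adm) => x Mx.
have [h1 h2 h3 h4] := H x Mx; split.
- by apply: (cvg_comp _ _ h1); exact: (nehari_proj_continuous FW).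
- by rewrite /= h2 (nehari_projN FW).
- exact: (nehari_projP FW).
- by apply: le_trans h4; exact: (nehari_proj_le FW).
Qed.

Lemma nehari_proj_le_ray (c t : R) u : c < 0 -> u != 0 -> 0 < t ->
  lam c (proj c u) <= lam c (scl u t).
Proof.
move=> c0 u0 t0; have [tau0 _] := nehari_timeP FW c0 u0.
have tt : 0 < t / @nehari_time R W scl q s r f g c u by rewrite divr_gt0.
have := nehari_min FW (nehari_projP FW c0 u0) tt.
rewrite {2}/nehari_proj (sclA (fw_scaling FW)) ?(ltW tt) ?(ltW tau0)//.
by rewrite mulrCA divff ?gt_eqF// mulr1.
Qed.

(** The projected image of the polytope has index at least k + 1, and since the projection minimises
    along rays, the level may be estimated at any time on each ray. *)
Lemma minimax_le_sphere (k : nat) (phi : 'rV[R]_k.+1 -> W) (c b : R) : c < 0 ->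
  continuous phi -> (forall x, phi (- x) = - phi x) ->
  (forall x, cross_polytope x -> phi x != 0) ->
  (forall x, cross_polytope x -> exists2 t : R, 0 < t & lam c (scl (phi x) t) <= b) ->
  (minimax c k.+1 <= b%:E)%E.
Proof.
move=> c0 phic phiN phi0 H.
have [h h_map] := odd_sphere_map (fw_reflexive FW) (fw_B_weak FW) (fw_B_gt0 FW).
pose M := [set u | exists2 x, cross_polytope x & u = proj c (phi x)].
have MN : M `<=` N c by move=> _ [x xS ->]; apply: (nehari_projP FW) => //; exact: phi0.
have Ms : symmetric_set M.
  move=> _ [x xS ->]; exists (- x); first exact: cross_polytope_opp.
  by rewrite phiN (nehari_projN FW) ?phi0.
apply: (@minimax_le _ _ _ M); last first.
  move=> _ [x xS ->]; have [t t0 ht] := H x xS; apply: le_trans ht.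
  by apply: nehari_proj_le_ray => //; exact: phi0.
split => //; apply: (index_sphere h_map (phi := proj c \o phi) Ms).
  by move=> /MN; exact: (nehari_not0 FW).
move=> x xS; split; first by exists x.
  by rewrite /= phiN (nehari_projN FW) ?phi0.
apply: (@cvg_comp _ _ _ phi (proj c) _ (nbhs (phi x))); first exact: phic.
by apply: (nehari_proj_continuous FW) => //; exact: phi0.
Qed.

Lemma minimax_lt_pinfty (c : R) (k : nat) : c < 0 -> (1 <= k)%N ->
  exists b : R, (minimax c k <= b%:E)%E.
Proof.
move=> c0; case: k => // k _; have [phi [phic phiN phi0]] := sphere_embedding W_infinite k.
have nz x : cross_polytope x -> phi x != 0 by move=> /cross_polytope_neq0; exact: phi0.
have pc (p : W -> R) : continuous p -> continuous (p \o phi).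
  by move=> hp x; apply: (@cvg_comp _ _ _ phi p _ (nbhs (phi x))); [exact: phic|exact: hp].
have [m m0 hm] := cross_polytope_positive (pc _ (potential_continuous (B_potential FW)))
  (fun x xS => J_gt0 FW (nz x xS)).
have num_c : continuous (fun u => `|I u - F u - G u - c|).
  move=> u; apply: cvg_norm; apply: cvgB; last exact: cvg_cst.
  apply: cvgB; [apply: cvgB|]; apply: potential_continuous.
  - exact: (A_potential FW).
  - exact: (fw_f_potential FW).
  - exact: (fw_g_potential FW).
have [K hK] := cross_polytope_bounded (pc _ num_c).
exists (K / m); apply: (minimax_le_sphere (phi := phi)) => // x xS; exists 1 => //.
rewrite (scl1 (fw_scaling FW)) /lambda_fun.
have J0 := J_gt0 FW (nz x xS); have := hK x xS; have := hm x xS; rewrite /= => h1 h2.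
have K0 : 0 <= K := le_trans (normr_ge0 _) h2.
rewrite ler_pdivrMr//; apply: le_trans (ler_norm _) _; apply: le_trans h2 _.
by rewrite mulrAC ler_pdivlMr// ler_wpM2l.
Qed.

Lemma minimax_fin_num (c : R) (k : nat) : c < 0 -> (1 <= k)%N -> minimax c k \is a fin_num.
Proof.
move=> c0 k1; have [b hb] := minimax_lt_pinfty c0 k1.
have [L hL] := nehari_lower_bound FW c0.
have hl : (L%:E <= minimax c k)%E.
  apply: minimax_ge => M [MN _ Mk]; have [x _] := fr_index_gt0_mem k1 Mk.
  by exists (set_val x); [exact: set_valP|apply/hL/MN/set_valP].
by rewrite fin_numElt (lt_le_trans (ltNyr _) hl) (le_lt_trans hb (ltry _)).
Qed.

Local Notation Lam k := (fun c : R => fine (minimax c k)).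

Lemma minimaxK (c : R) k : c < 0 -> (1 <= k)%N -> minimax c k = (fine (minimax c k))%:E.
Proof. by move=> c0 k1; rewrite fineK// minimax_fin_num. Qed.

Lemma dlamN (c : R) u : dlam A B f g c (- u) = - dlam A B f g c u.
Proof.
have [oA _ _ _] := fw_A FW; have [oB _ _ _] := fw_B FW.
rewrite /dlam (lam_opp FW) oA oB (fw_f_odd FW) (fw_g_odd FW) (potentialN _ oB).
by rewrite -!opprD !scalerN.
Qed.

Lemma minimax_critical (c : R) (k : nat) : c < 0 -> (1 <= k)%N ->
  lambda_critical_value A B f g c (fine (minimax c k)).
Proof.
move=> c0 k1; set a := fine _; apply: contrapT => ncrit.
have aE : minimax c k = a%:E by exact: minimaxK.
have [d d0 hd] := dlam_bounded_below FW c0 ncrit.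
have [w [w1 w2]] := norming_directions (fw_reflexive FW) (fw_B_weak FW) (fw_B_gt0 FW).
pose X : set W := [set u | N c u /\ lam c u <= a + 1].
have Xd x u : X x -> `|u - x| <= d ->
    u != 0 /\ (`|lam c u - a| <= d -> d <= `|dlam A B f g c u|).
  by move=> [h1 h2] h3; exact: hd h1 h2 h3.
have H1 u : u != 0 -> is_diff u (lam c) (dlam A B f g c u : W -> R).
  exact: (is_diff_lambda_fun (A_potential FW) (B_potential FW)
    (fw_f_potential FW) (fw_g_potential FW) (fw_B_gt0 FW)).
have H2 u : u != 0 -> dlam A B f g c @ u --> dlam A B f g c u.
  exact: (dlam_continuous (A_potential FW) (B_potential FW)
    (fw_f_potential FW) (fw_g_potential FW) (fw_B_gt0 FW)).
have [e e0 [eta Heta]] := deformation w1 w2 H1 H2 (lam_opp FW c) (dlamN c) d0 Xd.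
(* Below a + e for the deformation to apply, and below a + 1 to stay in [X]. *)
have [|M adm hM] := @minimax_lt c (a + Num.min e 1) k.
  by rewrite aE lte_fin ltrDl lt_min e0 ltr01.
have [MN _ _] := adm.
have : (minimax c k <= (a - e)%:E)%E.
  apply: (minimax_proj (phi := eta) k1 c0 adm) => x Mx.
  have lx := hM x Mx; apply: Heta.
    by split; [exact: MN|apply: le_trans lx _; rewrite lerD2l ge_min lexx orbT].
  by apply: le_trans lx _; rewrite lerD2l ge_min lexx.
by rewrite aE lee_fin lerDl oppr_ge0 leNgt e0.
Qed.

(** A set of low level is covered by the nonvanishing of [n] functionals, so its index is at most
    [n]. *)
Lemma minimax_large_index (c a : R) : c < 0 ->
  exists n : nat, forall k, (n < k)%N -> (a%:E <= minimax c k)%E.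
Proof.
move=> c0; have [D HD] := total_functionals (fw_reflexive FW) (fw_B_weak FW) (fw_B_gt0 FW).
have [n Hn] := nehari_finite_functionals FW a c0 HD.
exists n => k nk; apply: minimax_ge => M [MN Ms Mk]; apply: contrapT => h.
have low u : M u -> lam c u <= a.
  by move=> Mu; rewrite leNgt; apply/negP => /ltW au; apply: h; exists u.
have M0 : ~ M 0 by move=> /MN; exact: (nehari_not0 FW).
pose phis := [seq (D i : W -> R) | i <- iota 0 n].
have inP i : (i < n)%N -> List.In (D i : W -> R) phis.
  move=> iN; have : i \in iota 0 n by rewrite mem_iota.
  by rewrite /phis; elim: (iota 0 n) => //= x l IH; rewrite inE => /orP[/eqP ->|/IH]; [left|right].
have c1 (p : W -> R) : List.In p phis -> forall z, M z -> p (- z) = - p z /\ p @ z --> p z.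
  move=> pin z _; have [i [_ ->]] := @in_map_iff_ex _ _ (fun i => D i : W -> R) _ _ pin; split; first exact: dualN.
  exact: dual_continuous.
have c2 z : M z -> exists2 p : W -> R, List.In p phis & p z != 0.
  move=> Mz; have [i iN Di] := Hn z (MN _ Mz) (low _ Mz).
  by exists (D i) => //; exact: inP.
have := index_le_cover Ms M0 c1 c2 (leq_ltn_trans (leq0n n) nk) Mk.
by rewrite size_map size_iota leqNgt nk.
Qed.

Lemma lam_shift (c d : R) u : u != 0 -> lam d u = lam c u + (c - d) / J u.
Proof.
by move=> u0; have := J_gt0 FW u0 => J0; rewrite /lambda_fun; field; rewrite gt_eqF.
Qed.

Lemma minimax_shift (c d b e : R) k : (1 <= k)%N -> d < 0 -> (minimax c k < b%:E)%E ->
  (forall u, N c u -> lam c u <= b -> (c - d) / J u <= e) -> (minimax d k <= (b + e)%:E)%E.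
Proof.
move=> k1 d0 /minimax_lt[M adm hM] H; have [MN _ _] := adm.
apply: (minimax_proj (phi := id) k1 d0 adm) => u Mu; have u0 := nehari_neq0 FW (MN _ Mu).
split => //.
by rewrite (lam_shift c d u0) lerD ?hM// H ?hM//; exact: MN.
Qed.

(** An upper bound [M] for J on nearly optimal sets makes the level drop by at least (d - c) / M
    under projection; the slack [e] is half of that at most. *)
Lemma minimax_decreasing k (c d : R) : (1 <= k)%N -> d < 0 -> c < d -> Lam k d < Lam k c.
Proof.
move=> k1 d0 cd; have c0 : c < 0 by exact: lt_trans d0.
have [rho Hr] := nehari_sublevel_bounded FW (Lam k c + 1).
have [M0 HM0] := J_bounded FW rho; pose M := `|M0| + 1.
have M_gt0 : 0 < M by rewrite /M ltr_wpDl.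
pose dl := (d - c) / M; have dl0 : 0 < dl by rewrite divr_gt0// subr_gt0.
pose e : R := Num.min 1 (dl / 2).
have e0 : 0 < e by rewrite lt_min ltr01 divr_gt0.
have e1 : e <= 1 by rewrite /e ge_min lexx.
have e2 : e <= dl / 2 by rewrite /e ge_min lexx orbT.
have h : (minimax d k <= (Lam k c + e - dl)%:E)%E.
  apply: (minimax_shift (c := c) k1 d0).
    by rewrite minimaxK// lte_fin ltrDl.
  move=> u Nu lu; have J0 := J_gt0 FW (nehari_neq0 FW Nu).
  have JM : J u <= M.
    apply: le_trans (HM0 u _) _; last by rewrite /M; have := ler_norm M0; lra.
    by apply: (Hr _ _ Nu); apply: le_trans lu _; rewrite lerD2l.
  rewrite -opprB mulNr lerN2 /dl ler_pM2l ?subr_gt0// lef_pV2//.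
by move: h; rewrite minimaxK// lee_fin; lra.
Qed.

(** The complementary estimate rests on a lower bound [m] for J, uniform as long as c stays away
    from 0 and the level below [C]. *)
Lemma minimax_lipschitz k (c2 C : R) : (1 <= k)%N -> c2 < 0 -> exists2 m : R, 0 < m &
  forall c d : R, c <= c2 -> d <= c -> Lam k c < C -> Lam k d <= Lam k c + (c - d) / m.
Proof.
move=> k1 c20; have [rho Hr] := nehari_sublevel_bounded FW C.
have [m m0 Hm] := nehari_J_ge FW rho c20; exists m => // c d cc2 dc lC.
have c0 : c < 0 by exact: le_lt_trans c20.
have d0 : d < 0 by exact: le_lt_trans c0.
apply/ler_addgt0Pl => e e0; pose e' : R := Num.min e (C - Lam k c).
have e'0 : 0 < e' by rewrite lt_min e0 subr_gt0.
have e'1 : e' <= e by rewrite /e' ge_min lexx.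
have e'2 : e' <= C - Lam k c by rewrite /e' ge_min lexx orbT.
have : (minimax d k <= (Lam k c + e' + (c - d) / m)%:E)%E.
  apply: (minimax_shift (c := c) k1 d0).
    by rewrite minimaxK// lte_fin ltrDl.
  move=> u Nu lu; have J0 := J_gt0 FW (nehari_neq0 FW Nu).
  rewrite ler_wpM2l ?subr_ge0// lef_pV2//; apply: (Hm c) => //.
  by apply: (Hr _ _ Nu); apply: le_trans lu _; move: e'2; lra.
by rewrite minimaxK// lee_fin; lra.
Qed.

Lemma minimax_continuous k (c : R) : (1 <= k)%N -> c < 0 -> Lam k @ c --> Lam k c.
Proof.
move=> k1 c0; have h1 : c * (3 / 2) < c by rewrite gtr_nMr//; lra.
have h2 : c < c / 2 by lra.
have c20 : c / 2 < 0 by lra.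
have [m m0 Hm] := minimax_lipschitz (Lam k (c * (3 / 2)) + 1) k1 c20.
have bound (x : R) : c * (3 / 2) < x -> x < c / 2 -> Lam k x < Lam k (c * (3 / 2)) + 1.
  move=> h3 h4; have := minimax_decreasing k1 (lt_trans h4 c20) h3; lra.
apply/cvgrPdist_lt => e e0; near=> d.
have d1 : c * (3 / 2) < d by near: d; exact: lt_nbhsr.
have d2 : d < c / 2 by near: d; exact: lt_nbhsl.
have d3 : `|c - d| < e * m.
  by near: d; apply/nbhs_ballP; exists (e * m) => //=; exact: mulr_gt0.
have d0 : d < 0 by exact: lt_trans c20.
have [cd|dc|<-] := ltgtP c d.
- have := minimax_decreasing k1 d0 cd; have := Hm d c (ltW d2) (ltW cd) (bound d d1 d2).
  move: d3; rewrite distrC gtr0_norm ?subr_gt0// -ltr_pdivrMr// => d3 k2 k3.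
  by rewrite gtr0_norm ?subr_gt0//; lra.
- have := minimax_decreasing k1 c0 dc; have := Hm c d (ltW h2) (ltW dc) (bound c h1 h2).
  move: d3; rewrite gtr0_norm ?subr_gt0// -ltr_pdivrMr// => d3 k2 k3.
  by rewrite ltr0_norm ?subr_lt0//; lra.
- by rewrite subrr normr0.
Unshelve. all: by end_near. Qed.

Lemma minimax_ninfty k (C : R) : (1 <= k)%N -> exists2 c0 : R, c0 < 0 &
  forall c : R, c < c0 -> C <= Lam k c.
Proof.
move=> k1; have [c0 c00 H] := nehari_lam_large FW C; exists c0 => // c cc0.
have cn : c < 0 by exact: lt_trans c00.
rewrite -lee_fin -minimaxK//; apply: minimax_ge => M [MN _ Mk].
have [x _] := fr_index_gt0_mem k1 Mk; exists (set_val x); first exact: set_valP.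
by apply: ltW; apply: H cc0 _; apply/MN/set_valP.
Qed.

(** At a small time t the term - t^q F dominates, as q < s < r. Half of t^q m absorbs the terms of
    order s and r as well as K, by the choice of [x0] = t^(s-q); the other half absorbs - c. *)
Lemma minimax_at0 k (K : R) : (1 <= k)%N -> exists2 c0 : R, c0 < 0 &
  forall c : R, c0 < c -> c < 0 -> Lam k c <= K.
Proof.
case: k => // k k1; have [phi [phic phiN phi0]] := sphere_embedding W_infinite k.
have nz x : cross_polytope x -> phi x != 0 by move=> /cross_polytope_neq0; exact: phi0.
have pc (p : W -> R) : continuous p -> continuous (p \o phi).
  by move=> hp x; apply: (@cvg_comp _ _ _ phi p _ (nbhs (phi x))); [exact: phic|exact: hp].
have [m m0 hm] := cross_polytope_positive (pc _ (potential_continuous (fw_f_potential FW)))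
  (fun x xS => fw_F_gt0 FW (nz x xS)).
have num_c : continuous (fun u => I u + `|K| * J u - G u).
  move=> u; apply: cvgB; [apply: cvgD|].
  - exact: (potential_continuous (A_potential FW)).
  - by apply: cvgM; [exact: cvg_cst|exact: (potential_continuous (B_potential FW))].
  - exact: (potential_continuous (fw_g_potential FW)).
have [Q0 hQ0] := cross_polytope_bounded (pc _ num_c); pose Q := `|Q0| + 1.
have Q_gt0 : 0 < Q by rewrite /Q ltr_wpDl.
have sq0 : 0 < s - q by rewrite subr_gt0.
pose x0 : R := Num.min 1 (m / (2 * Q)).
have x00 : 0 < x0 by rewrite lt_min ltr01 divr_gt0// mulr_gt0.
have x01 : x0 <= 1 by rewrite /x0 ge_min lexx.
have x02 : x0 <= m / (2 * Q) by rewrite /x0 ge_min lexx orbT.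
pose t := x0 `^ (s - q)^-1; have t0 : 0 < t by exact: powR_gt0.
have ts : t `^ (s - q) = x0.
  by rewrite /t -powRrM mulVf ?gt_eqF// powRr1// ltW.
have t1 : t <= 1.
  have := @ge0_ler_powR R (s - q)^-1 _ x0 1; rewrite powR1 !nnegrE; apply => //.
  - by rewrite invr_ge0 ltW.
  - exact: ltW.
have tq := powR_gt0 q t0.
exists (- (t `^ q * m / 2)); first by rewrite oppr_lt0 !mulr_gt0.
move=> c cc c0; rewrite -lee_fin -minimaxK//.
apply: (minimax_le_sphere (phi := phi)) => // x xS; exists t => //.
have u0 := nz x xS; have J0 := J_gt0 FW u0; have tss := powR_gt0 s t0.
rewrite /lambda_fun (I_scl FW) ?(J_scl FW) ?(F_scl FW) ?(G_scl FW) ?(ltW t0)//.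
rewrite ler_pdivrMr; last by rewrite mulr_gt0.
have tsE : t `^ s = t `^ q * x0.
  by rewrite -ts -powRD ?(gt_eqF t0) ?implybT//; congr (_ `^ _); ring.
have tr : t `^ r <= t `^ s by apply: ger_powR; rewrite ?t0 ?t1// ltW.
have G0 := G_le0 FW (phi x); have I0 := I_gt0 FW u0.
have h1 := hm x xS; have := hQ0 x xS; rewrite /= in h1 *; move=> h2.
have h3 : I (phi x) + `|K| * J (phi x) - G (phi x) <= Q.
  by apply: le_trans h2 _; rewrite /Q; have := ler_norm Q0; lra.
have h4 : t `^ s * (I (phi x) + `|K| * J (phi x) - G (phi x)) <= t `^ q * (m / 2).
  apply: (@le_trans _ _ (t `^ s * Q)); first by rewrite ler_wpM2l// ltW.
  rewrite tsE -mulrA ler_wpM2l ?(ltW tq)//.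
  have -> : m / 2 = m / (2 * Q) * Q by field; rewrite gt_eqF.
  by rewrite ler_wpM2r// ltW.
have h5 : - (t `^ r * G (phi x)) <= - (t `^ s * G (phi x)).
  by rewrite lerN2 ler_wnM2r.
have h6 : t `^ q * m <= t `^ q * F (phi x) by rewrite ler_wpM2l// ltW.
have h7 : - (`|K| * (t `^ s * J (phi x))) <= K * (t `^ s * J (phi x)).
  rewrite -mulNr ler_wpM2r ?mulr_ge0 ?(ltW tss) ?(ltW J0)//.
  by have := lerNnormlW (lexx `|K|); lra.
lra.
Qed.

Lemma minimax_value (l : R) k : (1 <= k)%N -> exists2 c : R, c < 0 & Lam k c = l.
Proof.
move=> k1; have [c1 c10 H1] := minimax_ninfty l k1; have [c2 c20 H2] := minimax_at0 l k1.
pose x1 : R := Num.min (c1 - 1) (c2 - 1); pose x2 : R := c2 / 2.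
have x1c1 : x1 < c1 by rewrite /x1 gt_min; apply/orP; left; lra.
have x1c2 : x1 <= c2 - 1 by rewrite /x1 ge_min lexx orbT.
have x1x2 : x1 <= x2 by rewrite /x2; lra.
have x20 : x2 < 0 by rewrite /x2; lra.
have l1 := H1 x1 x1c1; have l2 : Lam k x2 <= l by apply: H2 => //; rewrite /x2; lra.
have cont : {within `[x1, x2], continuous (Lam k)}.
  apply: continuous_in_subspaceT => x; rewrite inE /= in_itv /= => /andP[_ xx2].
  by apply: minimax_continuous => //; exact: le_lt_trans x20.
have [|c] := IVT x1x2 cont (v := l).
  by rewrite ge_min l2 orbT le_max l1.
by rewrite in_itv /= => /andP[_ cx] E; exists c => //; exact: le_lt_trans x20.
Qed.

End Minimax.

Theorem theorem2p23 (R : realType) (W : completeNormedModType R)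
  (W_reflexive : reflexive_space W)
  (W_infinite : infinite_dimensional W)
  (scl : W -> R -> W) (q s r : R)
  (A1_5 : is_scaling scl s)
  (A B f g : W -> dual W)
  (A_scaled : scaled_operator scl s A)
  (B_scaled : scaled_operator scl s B)
  (f_odd : odd_operator f) (f_potential : potential_operator f)
  (g_odd : odd_operator g) (g_potential : potential_operator g)
  (A6 : forall u, u != 0 -> 0 < A u u)
  (A7 : forall (u_ : nat -> W) u, weakly_cvg u_ u ->
     A (u_ j) (u_ j - u) @[j --> \oo] --> (0 : R) ->
     exists sigma : nat -> nat, {homo sigma : m n / (m < n)%N} /\
       u_ (sigma j) @[j --> \oo] --> u)
  (A8 : forall u, u != 0 -> 0 < B u u)
  (A9 : weak_to_strong_continuous B)
  (A10 : forall K : R, exists rho : R, forall u, rho <= `|u| -> K <= potential A u)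
  (A11 : forall (lambda : R) u, A u = lambda *: B u ->
     potential A u = lambda * potential B u)
  (q_gt0 : 0 < q) (q_lt_s : q < s) (s_lt_r : s < r)
  (H1f : homogeneous scl q f) (H1g : homogeneous scl r g)
  (H2f : weak_to_strong_continuous f) (H2g : weak_to_strong_continuous g)
  (H3 : forall (alpha beta gamma delta : R) u,
     alpha *: A u = beta *: B u + gamma *: f u + delta *: g u ->
     s * alpha * potential A u =
       s * beta * potential B u + q * gamma * potential f u
       + r * delta * potential g u)
  (F_gt0 : forall u, u != 0 -> 0 < potential f u)
  (G_lt0 : forall u, u != 0 -> potential g u < 0)
  (h_neq0 : forall c u, nehari scl A B f g c u ->
     (s - q) *: f u - (r - s) *: g u != 0) :
  let lam c k : \bar R := minimax scl A B f g c k in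
  let Phi := Phi A B f g in
  [/\ (* (i) *)
      forall c, c < 0 ->
        [/\ forall k, (1 <= k)%N -> lam c k \is a fin_num /\
              lambda_critical_value A B f g c (fine (lam c k)),
            forall j k, (1 <= j)%N -> (j <= k)%N -> (lam c j <= lam c k)%E,
            lam c k @[k --> \oo] --> +oo%E &
            forall k, (1 <= k)%N -> exists u,
              [/\ u != 0, critical_point (Phi (fine (lam c k))) u &
                  Phi (fine (lam c k)) u = c]],
      (* (ii) *)
      forall k, (1 <= k)%N ->
        [/\ forall c, c < 0 -> lam c k \is a fin_num,
            {in `]-oo, 0[, continuous (fun c => fine (lam c k))},
            {in `]-oo, 0[ &, {homo (fun c => fine (lam c k)) : c d / c < d >-> d < c}},
            fine (lam c k) @[c --> 0^'-] --> -oo &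
            fine (lam c k) @[c --> -oo] --> +oo] &
      (* (iii) *)
      forall lambda : R,
        (exists v : nat -> W,
          [/\ forall k, v k != 0 /\ critical_point (Phi lambda) (v k),
              {homo (fun k => Phi lambda (v k)) : j k / (j <= k)%N >-> j <= k},
              Phi lambda (v k) @[k --> \oo] --> (0 : R) &
              `|v k| @[k --> \oo] --> (0 : R)]) /\
        ~ exists u, [/\ u != 0, critical_point (Phi lambda) u &
                        0 <= Phi lambda u]].
Proof.
have FW : framework scl q s r A B f g by [].
have PA := A_potential FW; have PB := B_potential FW.
move=> lam Phi.
have crit (c : R) k : c < 0 -> (1 <= k)%N -> exists u,
    [/\ u != 0, critical_point (Phi (fine (lam c k))) u & Phi (fine (lam c k)) u = c].
  move=> c0 k1; have [u [u0 cu lu]] := minimax_critical FW W_infinite c0 k1.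
  have Eu := (dlam_eq0 A f g PB A8 c u0).1
    ((critical_lambda_fun PA PB f_potential g_potential A8 c u0).1 cu).
  rewrite lu in Eu; exists u; split; first exact: u0.
    exact: ((critical_Phi PA PB f_potential g_potential _ u).2 Eu).
  exact: ((lambda_fun_Phi A f g PB A8 c _ u0).1 lu).
split.
- move=> c c0; split.
  + move=> k k1; split; first exact: (minimax_fin_num FW).
    exact: (minimax_critical FW).
  + by move=> j k _; exact: minimax_nondecreasing.
  + apply/cvgeyPge => a; have [n Hn] := minimax_large_index FW a c0.
    by exists n.+1 => // k /= nk; exact: Hn.
  + by move=> k; exact: crit.
- move=> k k1; split.
  + by move=> c c0; exact: (minimax_fin_num FW).
  + by move=> c; rewrite in_itv /= => c0; exact: (minimax_continuous FW).
  + move=> c d _; rewrite in_itv /= => d0; exact: (minimax_decreasing FW).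
  + apply/cvgrNyPle => K; have [c0 c00 H] := minimax_at0 FW W_infinite K k1.
    near=> c; apply: H; near: c; [exact: nbhs_left_gt|exact: nbhs_left_lt].
  + apply/cvgryPge => C; have [c0 c00 H] := minimax_ninfty FW W_infinite C k1.
    near=> c; apply: H; near: c; apply: nbhs_ninfty_lt; exact: num_real.
move=> l; split; last first.
  move=> [u [u0 /(critical_Phi PA PB f_potential g_potential) E Phi0]].
  by have [_] := critical_nehari FW u0 E; rewrite ltNge Phi0.
(* Sequences start at 0 and minimax values at 1, whence [k.+1]. *)
have /choice[c_ Hc] : forall k : nat, exists c : R, c < 0 /\ fine (lam c k.+1) = l.
  by move=> k; have [c c0 E] := minimax_value FW W_infinite l (ltn0Sn k); exists c.
have /choice[v Hv] : forall k, exists u, [/\ u != 0, critical_point (Phi l) u & Phi l u = c_ k].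
  move=> k; have [c0 E] := Hc k; have := crit _ _ c0 (ltn0Sn k).
  by rewrite E.
have Phiv k : Phi l (v k) = c_ k by have [] := Hv k.
have below (c : R) k : c < 0 -> l < fine (lam c k.+1) -> c < c_ k.
  move=> c0 lc; have [ck0 E] := Hc k; rewrite ltNge; apply/negP => ckc.
  move: lc; rewrite -{1}E ltNge => /negP; apply; move: ckc; rewrite le_eqVlt => /orP[/eqP ->//|h].
  by apply: ltW; exact: (minimax_decreasing FW W_infinite (ltn0Sn k) c0 h).
have c_cvg : c_ k @[k --> \oo] --> (0 : R).
  apply/cvgrPdist_lt => e e0; have ne : - e < 0 by rewrite oppr_lt0.
  (* At c = - e the minimax values exceed [l] for large k, so by strict monotonicity the solution
     [c_ k] lies between - e and 0. *)
  have [n Hn] := minimax_large_index FW (l + 1) ne.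
  exists n => // k /= nk; have [ck0 _] := Hc k.
  rewrite sub0r normrN ltr0_norm// ltrNl; apply: below => //.
  have := Hn k.+1 nk; rewrite /lam (minimaxK FW W_infinite ne (ltn0Sn k)) lee_fin.
  by apply: lt_le_trans; rewrite ltrDl.
exists v; split.
- by move=> k; have [] := Hv k.
(* If c_k < c_j, strict decrease in c and monotonicity in the index give l = lam c_j (j+1) < lam c_k
   (j+1) <= lam c_k (k+1) = l. *)
- move=> j k jk; rewrite !Phiv leNgt; apply/negP => ckj.
  have [cj0 Ej] := Hc j; have [ck0 Ek] := Hc k.
  have := minimax_decreasing FW W_infinite (ltn0Sn j) cj0 ckj.
  rewrite -/lam -[X in X < _]/(fine (lam (c_ j) j.+1)) Ej.
  have : (lam (c_ k) j.+1 <= lam (c_ k) k.+1)%E by exact: minimax_nondecreasing.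
  rewrite /lam (minimaxK FW W_infinite ck0 (ltn0Sn j)) (minimaxK FW W_infinite ck0 (ltn0Sn k)).
  by rewrite lee_fin -[X in _ <= X]/(fine (lam (c_ k) k.+1)) Ek leNgt => /negP.
- by under eq_fun do rewrite Phiv.
- apply/cvgrPdist_lt => e e0; have [c0 c00 H] := critical_small FW l e0.
  have hn : \forall k \near \oo, c0 < c_ k by exact: (cvgr_gt _ c_cvg).
  apply: filterS hn => k ck; rewrite sub0r normrN normr_id.
  have [vk0 vkc vkE] := Hv k; apply: H => //; last by rewrite [X in _ < X]vkE.
  exact/(critical_Phi PA PB f_potential g_potential).
Unshelve. all: by end_near. Qed.
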